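(* Let $A$ be a locally unital graded algebra that is locally finite-dimensional and bounded below, equipped with a graded triangular basis with weight poset $\Lambda$, and suppose that for each $\lambda\in\Lambda$ the algebra $A_\lambda$ is given the structure of a based affine quasi-hereditary algebra with weight poset $(\mathbf B_\lambda,\leq_\lambda)$. Let $V,W$ be graded left $A$-modules. In either of the following situations, $\operatorname{Ext}^n_A(V,W)=0$ for all $n\geq1$: (1) $V$ has a pure $\Delta$-flag and $W$ has a pure $\bar\nabla$-flag; (2) $V$ has a pure $\bar\Delta$-flag and $W$ has a pure $\nabla$-flag.
   Context: Conventions. $\Bbbk$ is an algebraically closed field; all algebras, categories and functors are $\Bbbk$-linear; graded means $\mathbb Z$-graded. For a graded vector space $V$, $qV$ is the shift $(qV)_d=V_{d-1}$. A locally unital graded algebra is a graded associative algebra $A=\bigoplus_{i,j\in\mathbf I}1_iA1_j$ with a given family of mutually orthogonal homogeneous idempotents $1_i$ $(i\in\mathbf I)$. Graded left modules are locally unital: $V=\bigoplus_{i}1_iV$. $A$-gmod is the abelian category of graded left $A$-modules with degree-preserving homomorphisms. $\operatorname{Hom}_A(V,W)=\bigoplus_{d\in\mathbb Z}\operatorname{Hom}_A(V,W)_d$, where $\operatorname{Hom}_A(V,W)_d$ is the space of $A$-module homomorphisms $f$ with $f(V_n)\subseteq W_{n+d}$ for all $n$, and $\operatorname{Ext}^n_A(V,W)=\bigoplus_{d}\operatorname{Ext}^n_{A\text{-gmod}}(q^dV,W)$. $V$ is locally finite-dimensional if $\dim 1_iV_d<\infty$ for all $i,d$; it is bounded below (resp.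 above) if for each $i$ there is $N_i$ with $1_iV_d=0$ for $d<N_i$ (resp. $d>N_i$). $A$ is locally finite-dimensional and bounded below if all $(1_iA1_j)_d$ are finite-dimensional and, for all $i,j$, $(1_iA1_j)_d=0$ for $d\ll 0$. Graded triangular basis. For such $A$ this is the following data: a subset $\mathbf S\subseteq\mathbf I$; a poset $(\Lambda,\leq)$ that is lower finite (each $\{\mu\in\Lambda:\mu\leq\lambda\}$ is finite); a function $\mathbf S\to\Lambda$, $s\mapsto\dot s$, with finite (possibly empty) fibers $\mathbf S_\lambda$; homogeneous sets $\mathrm X(i,s)\subset1_iA1_s$, $\mathrm H(s,t)\subset1_sA1_t$, $\mathrm Y(t,j)\subset1_tA1_j$ for $i,j\in\mathbf I$, $s,t\in\mathbf S$. With $\mathrm X(s)=\bigcup_i\mathrm X(i,s)$, $\mathrm Y(t)=\bigcup_j\mathrm Y(t,j)$, the axioms are: (A1) the products $xhy$ for $(x,h,y)\in\bigcup_{s,t\in\mathbf S}\mathrm X(s)\times\mathrm H(s,t)\times\mathrm Y(t)$ form a basis of $A$; (A2) $\mathrm X(s,s)=\mathrm Y(s,s)=\{1_s\}$ for $s\in\mathbf S$; (A3) for $s\neq t$ in $\mathbf S$: $\mathrm X(s,t)\neq\varnothing\Rightarrow\dot s>\dot t$, $\mathrm H(s,t)\neq\varnothing\Rightarrow\dot s=\dot t$, $\mathrm Y(s,t)\neq\varnothing\Rightarrow\dot s<\dot t$; (A4) for each $i\in\mathbf I-\mathbf S$, the sets $\{s\in\mathbf S:\mathrm X(i,s)\neq\varnothing\}$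 and $\{s\in\mathbf S:\mathrm Y(s,i)\neq\varnothing\}$ are finite. Functors. For $\lambda\in\Lambda$ let $e_\lambda=\sum_{s\in\mathbf S_\lambda}1_s$; let $A_{\geq\lambda}$ be the quotient of $A$ by the two-sided ideal generated by all $e_\mu$ with $\mu\not\geq\lambda$ (with idempotents the images $\bar1_i$), let $\bar e_\lambda$ be the image of $e_\lambda$ in it, and let $A_\lambda=\bar e_\lambda A_{\geq\lambda}\bar e_\lambda$, a unital graded algebra. Let $j^\lambda:A_{\geq\lambda}\text{-gmod}\to A_\lambda\text{-gmod}$, $V\mapsto\bar e_\lambda V$, with left adjoint $j^\lambda_!=A_{\geq\lambda}\bar e_\lambda\otimes_{A_\lambda}-$ (standardization functor) and right adjoint $j^\lambda_*=\bigoplus_{i\in\mathbf I}\operatorname{Hom}_{A_\lambda}(\bar e_\lambda A_{\geq\lambda}\bar1_i,-)$ (costandardization functor). $A_{\geq\lambda}$-modules are viewed as $A$-modules by inflation. Let $\mathbf B=\coprod_{\lambda\in\Lambda}\mathbf B_\lambda$ where $\mathbf B_\lambda$ is a (finite) set labelling the irreducible graded left $A_\lambda$-modules up to isomorphism and degree shift. Refined structure. For each $\lambda\in\Lambda$ we are given a partial order $\leq_\lambda$ on $\mathbf B_\lambda$ and a structure of based affine quasi-hereditary algebra on $A_\lambda$ with weight poset $(\mathbf B_\lambda,\leq_\lambda)$: this means a decomposition $A_\lambda=\bigoplus_{p,r\in\mathbf K}1'_pA_\lambda1'_r$ of $A_\lambda$ as a locally unital graded algebra via some mutually orthogonal homogeneous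 idempotents $1'_p$ $(p\in\mathbf K)$, together with a graded triangular basis for $A_\lambda$ whose set of special idempotents and weight poset are both $\mathbf B_\lambda$ with the map from special indices to weights being the identity, that is, $\mathbf B_\lambda\subseteq\mathbf K$ and there are homogeneous sets $\mathrm X_\lambda(p,b)\subset1'_pA_\lambda1'_b$, $\mathrm H_\lambda(b,c)\subset1'_bA_\lambda1'_c$, $\mathrm Y_\lambda(c,r)\subset1'_cA_\lambda1'_r$ for $p,r\in\mathbf K$, $b,c\in\mathbf B_\lambda$ such that the products $xhy$ for $(x,h,y)\in\bigcup_{p,r\in\mathbf K;\,b,c\in\mathbf B_\lambda}\mathrm X_\lambda(p,b)\times\mathrm H_\lambda(b,c)\times\mathrm Y_\lambda(c,r)$ form a basis of $A_\lambda$, $\mathrm X_\lambda(b,b)=\mathrm Y_\lambda(b,b)=\{1'_b\}$ for $b\in\mathbf B_\lambda$, and for $b\neq c$ in $\mathbf B_\lambda$: $\mathrm X_\lambda(b,c)\neq\varnothing\Rightarrow b>_\lambda c$, $\mathrm H_\lambda(b,c)=\varnothing$, $\mathrm Y_\lambda(b,c)\neq\varnothing\Rightarrow b<_\lambda c$; and such that for each $b\in\mathbf B_\lambda$ the ''Cartan'' algebra $(A_\lambda)_b:=\bar1'_b(A_\lambda)_{\geq b}\bar1'_b$ is graded local, i.e. its quotient by its graded Jacobson radical is $\Bbbk$, where $(A_\lambda)_{\geq b}$ is the quotient of $A_\lambda$ by the two-sided ideal generated by all $1'_c$ with $c\in\mathbf B_\lambda$, $c\not\geq_\lambda b$, and $\bar1'_p$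 is the image of $1'_p$ in it. The standardization and costandardization functors of type $b$ for the basis of $A_\lambda$ are $(A_\lambda)_{\geq b}\bar1'_b\otimes_{(A_\lambda)_b}-$ and $\bigoplus_{p\in\mathbf K}\operatorname{Hom}_{(A_\lambda)_b}(\bar1'_b(A_\lambda)_{\geq b}\bar1'_p,-)$, from graded left $(A_\lambda)_b$-modules to graded left $(A_\lambda)_{\geq b}$-modules, the latter being viewed as $A_\lambda$-modules by inflation; the irreducible $A_\lambda$-module labelled by $b$ is the head of the standard $A_\lambda$-module $(A_\lambda)_{\geq b}\bar1'_b$ of type $b$ arising from this basis. Pure flags. A $\Delta_\lambda$-layer (resp. $\bar\Delta_\lambda$-layer) of type $b\in\mathbf B_\lambda$ is a graded $A_\lambda$-module isomorphic to the module obtained by applying the standardization functor of type $b$ for the basis of $A_\lambda$ to a projective (resp. arbitrary) graded left $(A_\lambda)_b$-module that is locally finite-dimensional and bounded below. A $\nabla_\lambda$-layer (resp. $\bar\nabla_\lambda$-layer) of type $b$ is defined in the same way, applying the costandardization functor of type $b$ for the basis of $A_\lambda$ to an injective (resp. arbitrary) graded left $(A_\lambda)_b$-module that is locally finite-dimensional and bounded above. A pure $\Delta$-layer (resp. pure $\bar\Delta$-layer) of type $b\in\mathbf B_\lambda$ is a graded $A$-module isomorphic to $j^\lambda_!\bar V$ for $\bar V$ a $\Delta_\lambda$-layer (resp. $\bar\Delta_\lambda$-layer) of type $b$; a pure $\nabla$-layer (resp. pure $\bar\nabla$-layer) of type $b$ is a graded $A$-module isomorphic to $j^\lambda_*\bar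 V$ for $\bar V$ a $\nabla_\lambda$-layer (resp. $\bar\nabla_\lambda$-layer) of type $b$. A graded left $A$-module $V$ has a pure $\Delta$-flag (resp. pure $\bar\Delta$-flag, pure $\nabla$-flag, pure $\bar\nabla$-flag) if it has a finite filtration by graded submodules whose sections are pure $\Delta$-layers (resp. pure $\bar\Delta$-layers, pure $\nabla$-layers, pure $\bar\nabla$-layers) of distinct types $b_1,\dots,b_n\in\mathbf B$. *)

(* Defs.v *)
From HB Require Import structures.
From mathcomp Require Import all_boot all_order all_algebra.
From mathcomp Require Import boolp classical_sets functions cardinality fsbigop.

Set Implicit Arguments.
Unset Strict Implicit.
Unset Printing Implicit Defensive.

Import Order.TTheory GRing.Theory Num.Theory.

Local Open Scope classical_set_scope.
Local Open Scope ring_scope.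

Record subspace (k : fieldType) (V : lmodType k) := Subspace {
  ss_set :> V -> Prop;
  ss_lin : forall (c : k) u v, ss_set u -> ss_set v -> ss_set (c *: u + v);
  ss_0 : ss_set 0
}.

Section LinearLemmas.
Variables (k : fieldType) (V W : lmodType k) (f : V -> W).
Hypothesis lin_f : linear f.

Lemma linD u v : f (u + v) = f u + f v.
Proof. by have := lin_f 1 u v; rewrite !scale1r. Qed.
Lemma lin0 : f 0 = 0.
Proof. by apply: (addrI (f 0)); rewrite -linD !addr0. Qed.
Lemma linZ c v : f (c *: v) = c *: f v.
Proof. by rewrite -[c *: v]addr0 lin_f lin0 addr0. Qed.
Lemma linN v : f (- v) = - f v.
Proof. by rewrite -scaleN1r linZ scaleN1r. Qed.
Lemma linB u v : f (u - v) = f u - f v.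
Proof. by rewrite linD linN. Qed.
Lemma lin_sum J (r : seq J) (F : J -> V) :
  f (\sum_(j <- r) F j) = \sum_(j <- r) f (F j).
Proof. by elim: r => [|j r IH]; rewrite ?big_nil ?lin0 // !big_cons linD IH. Qed.
End LinearLemmas.

Section SubspaceLemmas.
Variables (k : fieldType) (V : lmodType k) (U : subspace V).

Lemma ssD u v : U u -> U v -> U (u + v).
Proof. by move=> Uu Uv; rewrite -[u]scale1r; apply: ss_lin. Qed.
Lemma ssZ c v : U v -> U (c *: v).
Proof. by move=> Uv; rewrite -[_ *: _]addr0; apply: ss_lin => //; apply: ss_0. Qed.
Lemma ssN v : U v -> U (- v).
Proof. by move=> Uv; rewrite -scaleN1r; apply: ssZ. Qed.
Lemma ssB u v : U u -> U v -> U (u - v).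
Proof. by move=> Uu Uv; apply: ssD => //; apply: ssN. Qed.
Lemma ss_sum (J : eqType) (r : seq J) (F : J -> V) :
  (forall j, j \in r -> U (F j)) -> U (\sum_(j <- r) F j).
Proof.
elim: r => [|j r IH] UF; first by rewrite big_nil; apply: ss_0.
rewrite big_cons; apply: ssD; first by apply: UF; rewrite mem_head.
by apply: IH => i ir; apply: UF; rewrite in_cons ir orbT.
Qed.
End SubspaceLemmas.

Section SubQuot.
Variables (k : fieldType) (V : lmodType k) (U : subspace V).

Definition ss_pred : {pred V} := fun v => `[< U v >].

Lemma ss_predP v : reflect (U v) (v \in ss_pred).
Proof. exact: asboolP. Qed.

Fact ss_closed : submod_closed ss_pred.
Proof.
split=> [|c u v /ss_predP Uu /ss_predP Uv]; apply/ss_predP; first exact: ss_0.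
exact: ss_lin.
Qed.
HB.instance Definition _ := GRing.isSubmodClosed.Build k V ss_pred ss_closed.

Record sub_space := SubVec { sub_val :> V; sub_valP : sub_val \in ss_pred }.
HB.instance Definition _ := [isSub for sub_val].
HB.instance Definition _ := [Choice of sub_space by <:].
HB.instance Definition _ := [SubChoice_isSubLmodule of sub_space by <:].

Definition mk_sub v (Uv : U v) : sub_space := SubVec (introT (ss_predP v) Uv).

Lemma subP (x : sub_space) : U (sub_val x).
Proof. exact/ss_predP/(sub_valP x). Qed.

Definition quot_space := Quotient.quot ss_pred.
HB.instance Definition _ := GRing.Zmodule.on quot_space.
Definition to_quot (v : V) : quot_space := (\pi_quot_space v)%qT.

Lemma to_quotP u v : to_quot u = to_quot v <-> U (u - v).
Proof.
split=> [/eqP|Uuv].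
  by rewrite /to_quot -(Quotient.idealrBE ss_pred) => /ss_predP.
by apply/eqP; rewrite /to_quot -(Quotient.idealrBE ss_pred); apply/ss_predP.
Qed.

Lemma quot_ind (P : quot_space -> Prop) : (forall v, P (to_quot v)) -> forall q, P q.
Proof. by move=> PV; elim/quotW. Qed.

Lemma to_quotD u v : to_quot (u + v) = to_quot u + to_quot v.
Proof. exact: (raddfD (\pi_quot_space)%qT). Qed.

Definition quot_scale (c : k) (q : quot_space) : quot_space := to_quot (c *: repr q).

Lemma quot_scaleE c v : quot_scale c (to_quot v) = to_quot (c *: v).
Proof.
apply/to_quotP; rewrite -scalerBr; apply: ssZ; apply/to_quotP.
by rewrite /to_quot reprK.
Qed.

Fact quot_scaleA a b q : quot_scale a (quot_scale b q) = quot_scale (a * b) q.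
Proof. by elim/quot_ind: q => v; rewrite !quot_scaleE scalerA. Qed.
Fact quot_scale1 : left_id 1 quot_scale.
Proof. by elim/quot_ind => v; rewrite quot_scaleE scale1r. Qed.
Fact quot_scaleDr : right_distributive quot_scale +%R.
Proof.
move=> c; elim/quot_ind => u; elim/quot_ind => v.
by rewrite -to_quotD !quot_scaleE scalerDr to_quotD.
Qed.
Fact quot_scaleDl q : {morph quot_scale^~ q : a b / a + b}.
Proof. by elim/quot_ind: q => v a b; rewrite !quot_scaleE scalerDl to_quotD. Qed.
HB.instance Definition _ := GRing.Zmodule_isLmodule.Build k quot_space
  quot_scaleA quot_scale1 quot_scaleDr quot_scaleDl.

Lemma to_quot_lin : linear to_quot.
Proof. by move=> c u v; rewrite to_quotD -quot_scaleE. Qed.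

Lemma to_quot0 v : to_quot v = 0 <-> U v.
Proof. by rewrite -(lin0 to_quot_lin) to_quotP subr0. Qed.

Lemma sub_val_lin : linear (sub_val : sub_space -> V).
Proof. exact: (linearP (val : sub_space -> V)). Qed.

Lemma sub_val_inj (x y : sub_space) : sub_val x = sub_val y -> x = y.
Proof. exact: val_inj. Qed.

Section Lift.
Variables (W : lmodType k) (f : V -> W).
Hypotheses (lin_f : linear f) (f0 : forall u, U u -> f u = 0).

Definition quot_lift (g : V -> W) (q : quot_space) : W := g (repr q).

Lemma quot_liftE v : quot_lift f (to_quot v) = f v.
Proof.
apply/eqP; rewrite /quot_lift -subr_eq0 -linB //; apply/eqP/f0/to_quotP.
by rewrite /to_quot reprK.
Qed.

Lemma quot_lift_lin : linear (quot_lift f).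
Proof.
move=> c; elim/quot_ind => u; elim/quot_ind => v.
by rewrite -to_quot_lin !quot_liftE lin_f.
Qed.
End Lift.
End SubQuot.

Section Span.
Variables (k : fieldType) (V : lmodType k) (E : set V).

Definition span_set (v : V) : Prop := forall U : subspace V, (forall e, E e -> U e) -> U v.

Fact span_lin (c : k) u v : span_set u -> span_set v -> span_set (c *: u + v).
Proof. by move=> Su Sv U EU; apply: ss_lin; [apply: Su | apply: Sv]. Qed.
Fact span_0 : span_set 0.
Proof. by move=> U _; apply: ss_0. Qed.
Definition span : subspace V := Subspace span_lin span_0.

Lemma span_gen e : E e -> span e.
Proof. by move=> Ee U; apply. Qed.

Lemma span_ind (P : V -> Prop) :
    P 0 -> (forall (c : k) u v, span u -> span v -> P u -> P v -> P (c *: u + v)) ->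
    (forall e, E e -> P e) -> forall v, span v -> P v.
Proof.
move=> P0 Plin PE v Sv.
have Qlin (c : k) u w : span u /\ P u -> span w /\ P w -> span (c *: u + w) /\ P (c *: u + w).
  by move=> [Su Pu] [Sw Pw]; split; [apply: ss_lin | apply: Plin].
pose Q := @Subspace k V (fun v => span v /\ P v) Qlin (conj span_0 P0).
suff [] : Q v by [].
by apply: Sv => e Ee; split; [apply: span_gen | apply: PE].
Qed.
End Span.

(* A decomposition V = (+)_j V_j, presented by its family of projections; the
   summand V_j is {v | p j v = v}. *)
Record decomposes (k : fieldType) (V : lmodType k) (J : choiceType)
    (p : J -> V -> V) : Prop := Decomposes {
  dec_lin : forall j, linear (p j);
  dec_orth : forall i j v, p i (p j v) = if i == j then p j v else 0;
  dec_sum : forall v, exists2 s : seq J, uniq s & v = \sum_(j <- s) p j v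
}.

Section ProjectionFamilies.
Variables (k : fieldType) (V : lmodType k) (J : choiceType) (p : J -> V -> V).
Hypothesis p_lin : forall j, linear (p j).

Definition locfin v := exists s : seq J, [/\ uniq s, forall j, j \notin s -> p j v = 0
  & v = \sum_(j <- s) p j v].

Lemma locfin_wide v (s : seq J) : uniq s -> locfin v ->
  (forall j, j \notin s -> p j v = 0) -> v = \sum_(j <- s) p j v.
Proof.
move=> us [t [ut t0 vt]] s0; rewrite [LHS]vt.
rewrite (bigID [pred j | j \in s]) /= [X in _ + X]big1 ?addr0; last by move=> j /s0.
rewrite [RHS](bigID [pred j | j \in t]) /= [X in _ = _ + X]big1 ?addr0; last by move=> j /t0.
rewrite -[LHS]big_filter -[RHS]big_filter; apply: perm_big; apply: uniq_perm; rewrite ?filter_uniq //.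
by move=> j; rewrite !mem_filter /= andbC.
Qed.

Lemma locfin_lin c u v : locfin u -> locfin v -> locfin (c *: u + v).
Proof.
move=> lu lv; have [s [us s0 _]] := lu; have [t [ut t0 _]] := lv.
exists (undup (s ++ t)); have uu := undup_uniq (s ++ t); split=> // [j|].
  by rewrite mem_undup mem_cat negb_or => /andP[/s0 pu /t0 pv]; rewrite p_lin pu pv scaler0 addr0.
rewrite [in LHS](locfin_wide uu lu); last by move=> j; rewrite mem_undup mem_cat negb_or => /andP[/s0].
rewrite [in LHS](locfin_wide uu lv); last by move=> j; rewrite mem_undup mem_cat negb_or => /andP[_ /t0].
by rewrite scaler_sumr -big_split /=; apply: eq_bigr => j _; rewrite p_lin.
Qed.

Lemma locfin0 : locfin 0.
Proof. by exists [::]; split=> // [j _|]; rewrite ?big_nil ?lin0. Qed.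

Lemma decomposes_span (G : J -> set V) :
    (forall i j v, G j v -> p i v = if i == j then v else 0) ->
    (forall v, span [set v | exists j, G j v] v) -> decomposes p.
Proof.
move=> pG spanG.
have key v : locfin v /\ forall i j, p i (p j v) = if i == j then p j v else 0.
  elim/span_ind: v / (spanG v) => [|c u w _ _ [lu pu] [lw pw]|e [j Ge]].
  - by split=> [|i j]; [exact: locfin0 | rewrite !(lin0 (p_lin _)) if_same].
  - split=> [|i j]; first exact: locfin_lin.
    by rewrite !p_lin pu pw; case: ifP; rewrite // scaler0 addr0.
  split=> [|i i'].
    exists [:: j]; split=> // [i|]; last by rewrite big_seq1 (pG _ _ _ Ge) eqxx.
    by rewrite inE (pG _ _ _ Ge) => /negPf->.
  rewrite (pG i' _ _ Ge); case: eqP => [->|_]; first by rewrite (pG _ _ _ Ge).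
  by rewrite lin0 ?if_same.
split=> // [i j v|v]; first by have [_ ->] := key v.
by have [[s [us _ vs]] _] := key v; exists s.
Qed.

Hypothesis p_dec : decomposes p.

Lemma dec_locfin v : locfin v.
Proof.
have [s us vs] := dec_sum p_dec v; exists s; split=> // j js.
rewrite vs lin_sum //; apply: big1_seq => i /andP[_ si].
by rewrite (dec_orth p_dec); case: eqP => // ji; rewrite ji si in js.
Qed.
End ProjectionFamilies.

Lemma fsumT_seq (J : choiceType) (V : nmodType) (F : J -> V) (s : seq J) :
  uniq s -> (forall j, j \notin s -> F j = 0) ->
  \sum_(j \in [set: J]) F j = \sum_(j <- s) F j.
Proof.
move=> us s0; rewrite (fsbigE s) //; last by move=> j _ /s0.
by apply: eq_bigl => j; rewrite in_setT.
Qed.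

Lemma fsumT_lin (k : fieldType) (V W : lmodType k) (J : choiceType) (F : J -> V -> W) :
  (forall j, linear (F j)) ->
  (forall v, exists2 s : seq J, uniq s & forall j, j \notin s -> F j v = 0) ->
  linear (fun v => \sum_(j \in [set: J]) F j v).
Proof.
move=> Flin Ffin c u v; have [s us s0] := Ffin u; have [t ut t0] := Ffin v.
have uu := undup_uniq (s ++ t).
rewrite !(fsumT_seq uu) => [|j|j|j]; rewrite ?mem_undup ?mem_cat ?negb_or.
- by rewrite scaler_sumr -big_split /=; apply: eq_bigr => j _; rewrite Flin.
- by case/andP=> _ /t0.
- by case/andP=> /s0.
- by case/andP=> /s0 Fu /t0 Fv; rewrite Flin Fu Fv scaler0 addr0.
Qed.

Section TransportDecomposition.
Variables (k : fieldType) (V : lmodType k) (J : choiceType) (p : J -> V -> V).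
Variable U : subspace V.
Hypotheses (p_dec : decomposes p) (U_p : forall j v, U v -> U (p j v)).

Definition sub_proj j (x : sub_space U) : sub_space U := mk_sub (U_p j (subP x)).

Fact sub_proj_dec : decomposes sub_proj.
Proof.
split=> [j c x y|i j x|x]; try apply: sub_val_inj.
- by rewrite /= (dec_lin p_dec).
- by rewrite /= (dec_orth p_dec); case: ifP.
have [s us xs] := dec_sum p_dec (sub_val x); exists s => //; apply: sub_val_inj.
by rewrite (lin_sum (@sub_val_lin _ _ U)).
Qed.

Definition quot_proj j : quot_space U -> quot_space U :=
  quot_lift (fun v => to_quot U (p j v)).

Lemma quot_projE j v : quot_proj j (to_quot U v) = to_quot U (p j v).
Proof.
rewrite /quot_proj quot_liftE // => [c u w|u Uu]; last exact/to_quot0/U_p.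
by rewrite (dec_lin p_dec) to_quot_lin.
Qed.

Fact quot_proj_dec : decomposes quot_proj.
Proof.
split=> [j c|i j|]; elim/quot_ind=> u.
- by elim/quot_ind=> v; rewrite -to_quot_lin !quot_projE (dec_lin p_dec) to_quot_lin.
- by rewrite !quot_projE (dec_orth p_dec); case: ifP => // _; exact/to_quot0/ss_0.
have [s us xs] := dec_sum p_dec u; exists s => //.
by rewrite [in LHS]xs (lin_sum (@to_quot_lin _ _ U)); apply: eq_bigr => j _; rewrite quot_projE.
Qed.
End TransportDecomposition.

Record grading (k : fieldType) (V : lmodType k) := Grading {
  gr_comp :> int -> V -> V;
  gr_dec : decomposes gr_comp
}.

Definition homog (k : fieldType) (V : lmodType k) (G : grading V) (d : int) (v : V) : Prop :=
  G d v = v.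

Section GradingLemmas.
Variables (k : fieldType) (V : lmodType k) (G : grading V).

Lemma gr_lin d : linear (G d).
Proof. exact: dec_lin (gr_dec G) d. Qed.
Lemma homog_comp d v : homog G d (G d v).
Proof. by rewrite /homog (dec_orth (gr_dec G)) eqxx. Qed.
Lemma homogE d e v : homog G d v -> G e v = if e == d then v else 0.
Proof. by move=> hv; rewrite -hv (dec_orth (gr_dec G)). Qed.
Lemma homog0 d : homog G d 0.
Proof. exact: lin0 (gr_lin d). Qed.
Lemma homog_lin d c u v : homog G d u -> homog G d v -> homog G d (c *: u + v).
Proof. by move=> hu hv; rewrite /homog gr_lin hu hv. Qed.
Lemma homog_sum d (J : Type) (r : seq J) (F : J -> V) :
  (forall j, homog G d (F j)) -> homog G d (\sum_(j <- r) F j).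
Proof. by move=> hF; rewrite /homog (lin_sum (gr_lin d)); apply: eq_bigr => j _; exact: hF. Qed.
Lemma gr_fin v : exists2 s : seq int, uniq s & forall d, d \notin s -> G d v = 0.
Proof. by have [s [us s0 _]] := dec_locfin gr_lin (gr_dec G) v; exists s. Qed.
Lemma span_homog v : span [set u | exists d, homog G d u] v.
Proof.
have [s _ ->] := dec_sum (gr_dec G) v; apply: ss_sum => d _.
by apply: span_gen; exists d; apply: homog_comp.
Qed.
End GradingLemmas.

Section GradedBilinear.
Variables (k : fieldType) (U V W : lmodType k).
Variables (GU : grading U) (GV : grading V) (GW : grading W) (b : U -> V -> W).
Hypotheses (b_linl : forall v, linear (b^~ v)) (b_linr : forall u, linear (b u)).
Hypothesis b_homog : forall d e u v, homog GU d u -> homog GV e v -> homog GW (d + e) (b u v).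

Lemma comp_bil_l d e u v : homog GU e u -> GW d (b u v) = b u (GV (d - e) v).
Proof.
move=> hu; have [s _ ->] := dec_sum (gr_dec GV) v.
rewrite (lin_sum (b_linr u)) (lin_sum (gr_lin GW d)) (lin_sum (gr_lin GV (d - e))).
rewrite (lin_sum (b_linr u)); apply: eq_bigr => f _.
rewrite (homogE _ (b_homog hu (homog_comp GV f v))) (homogE _ (homog_comp GV f v)).
by rewrite subr_eq [f + e]addrC; case: ifP => // _; rewrite (lin0 (b_linr u)).
Qed.

Lemma comp_bil_r d e u v : homog GV e v -> GW d (b u v) = b (GU (d - e) u) v.
Proof.
move=> hv; have [s _ ->] := dec_sum (gr_dec GU) u.
rewrite (lin_sum (b_linl v)) (lin_sum (gr_lin GW d)) (lin_sum (gr_lin GU (d - e))).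
rewrite (lin_sum (b_linl v)); apply: eq_bigr => f _.
rewrite (homogE _ (b_homog (homog_comp GU f u) hv)) (homogE _ (homog_comp GU f u)).
by rewrite subr_eq; case: ifP => // _; rewrite (lin0 (b_linl v)).
Qed.
End GradedBilinear.

(* Not required to have a unit. *)
Record galg (k : fieldType) := GAlg {
  ga_car :> lmodType k;
  ga_mul : ga_car -> ga_car -> ga_car;
  ga_gr : grading ga_car;
  ga_linl : forall y, linear (ga_mul^~ y);
  ga_linr : forall x, linear (ga_mul x);
  ga_assoc : associative ga_mul;
  ga_homog : forall d e x y,
    homog ga_gr d x -> homog ga_gr e y -> homog ga_gr (d + e) (ga_mul x y)
}.

Notation "x ** y" := (ga_mul x y) (at level 40, left associativity).

(* A homogeneous idempotent necessarily lies in degree 0. *)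
Record gidem (k : fieldType) (A : galg k) := GIdem {
  gi_val :> A;
  gi_idem : gi_val ** gi_val = gi_val;
  gi_homog : homog (ga_gr A) 0 gi_val
}.

Record lualg (k : fieldType) (I : choiceType) := LUAlg {
  lu_alg :> galg k;
  lu_one : I -> gidem lu_alg;
  lu_orth : forall i j, i != j -> lu_one i ** lu_one j = 0;
  lu_dec : decomposes (fun (ij : I * I) x => lu_one ij.1 ** x ** lu_one ij.2)
}.

Record gmod (k : fieldType) (I : choiceType) (A : lualg k I) := GMod {
  gm_car :> lmodType k;
  gm_act : A -> gm_car -> gm_car;
  gm_gr : grading gm_car;
  gm_linl : forall v, linear (gm_act^~ v);
  gm_linr : forall a, linear (gm_act a);
  gm_assoc : forall a b v, gm_act a (gm_act b v) = gm_act (a ** b) v;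
  gm_homog : forall d e a v,
    homog (ga_gr A) d a -> homog gm_gr e v -> homog gm_gr (d + e) (gm_act a v);
  gm_dec : decomposes (fun i => gm_act (lu_one A i))
}.

Notation "a **: v" := (gm_act a v) (at level 40, v at level 40).

Section AlgLemmas.
Variables (k : fieldType) (A : galg k).
Implicit Types x y : A.

Lemma comp_mul_l d e x y : homog (ga_gr A) e x ->
  ga_gr A d (x ** y) = x ** ga_gr A (d - e) y.
Proof. exact: comp_bil_l (@ga_linr _ A) (@ga_homog _ A) _ _ _ _. Qed.
Lemma comp_mul_r d e x y : homog (ga_gr A) e y ->
  ga_gr A d (x ** y) = ga_gr A (d - e) x ** y.
Proof. exact: comp_bil_r (@ga_linl _ A) (@ga_homog _ A) _ _ _ _. Qed.
Lemma comp_idem_l d (e : gidem A) x : ga_gr A d (e ** x) = e ** ga_gr A d x.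
Proof. by rewrite (comp_mul_l _ _ (gi_homog e)) subr0. Qed.
Lemma comp_idem_r d (e : gidem A) x : ga_gr A d (x ** e) = ga_gr A d x ** e.
Proof. by rewrite (comp_mul_r _ _ (gi_homog e)) subr0. Qed.
Lemma mul0x x : 0 ** x = 0.
Proof. exact: lin0 (@ga_linl _ A x). Qed.
Lemma mulx0 x : x ** 0 = 0.
Proof. exact: lin0 (@ga_linr _ A x). Qed.
End AlgLemmas.

Section LUAlgLemmas.
Variables (k : fieldType) (I : choiceType) (A : lualg k I).

Lemma lu_oneM i j : lu_one A i ** lu_one A j = if i == j then lu_one A j : ga_car A else 0.
Proof. by case: eqVneq => [->|/lu_orth //]; apply: gi_idem. Qed.

Lemma span_lu (a : A) :
  span [set x | exists d j, homog (ga_gr A) d x /\ lu_one A j ** x = x] a.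
Proof.
have [s _ ->] := dec_sum (lu_dec A) a. apply: ss_sum => -[i j] _; rewrite -[(i, j).1]/i -[(i, j).2]/j.
have [t _ ->] := dec_sum (gr_dec (ga_gr A)) (lu_one A i ** a ** lu_one A j).
apply: ss_sum => d _; apply: span_gen; exists d, i; split; first exact: homog_comp.
by rewrite -comp_idem_l !ga_assoc gi_idem.
Qed.
End LUAlgLemmas.

Section ModLemmas.
Variables (k : fieldType) (I : choiceType) (A : lualg k I) (V : gmod A).

Lemma act_comp_l d e (a : A) (v : V) : homog (ga_gr A) e a ->
  gm_gr V d (a **: v) = a **: gm_gr V (d - e) v.
Proof. exact: comp_bil_l (@gm_linr _ _ _ V) (@gm_homog _ _ _ V) _ _ _ _. Qed.
Lemma act_comp_r d e (a : A) (v : V) : homog (gm_gr V) e v ->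
  gm_gr V d (a **: v) = ga_gr A (d - e) a **: v.
Proof. exact: comp_bil_r (@gm_linl _ _ _ V) (@gm_homog _ _ _ V) _ _ _ _. Qed.
End ModLemmas.

Record hideal (k : fieldType) (A : galg k) := HIdeal {
  hi_ss :> subspace A;
  hi_l : forall a x, hi_ss x -> hi_ss (a ** x);
  hi_r : forall a x, hi_ss x -> hi_ss (x ** a);
  hi_comp : forall d x, hi_ss x -> hi_ss (ga_gr A d x)
}.

Section GeneratedIdeal.
Variables (k : fieldType) (A : galg k) (E : set (gidem A)).

(* The two-sided ideal generated by E; being generated by homogeneous elements,
   it is homogeneous. *)
Definition ideal_set (x : A) : Prop := forall J : subspace A,
  (forall a y, J y -> J (a ** y)) -> (forall a y, J y -> J (y ** a)) ->
  (forall e : gidem A, E e -> J e) -> J x.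

Fact ideal_lin (c : k) x y : ideal_set x -> ideal_set y -> ideal_set (c *: x + y).
Proof. by move=> Ix Iy J Jl Jr JE; apply: ss_lin; [apply: Ix | apply: Iy]. Qed.
Fact ideal_0 : ideal_set 0.
Proof. by move=> J _ _ _; apply: ss_0. Qed.
Definition ideal_ss : subspace A := Subspace ideal_lin ideal_0.

Fact ideal_l a x : ideal_ss x -> ideal_ss (a ** x).
Proof. by move=> Ix J Jl Jr JE; exact: Jl (Ix J Jl Jr JE). Qed.
Fact ideal_r a x : ideal_ss x -> ideal_ss (x ** a).
Proof. by move=> Ix J Jl Jr JE; exact: Jr (Ix J Jl Jr JE). Qed.

Fact ideal_comp d x : ideal_ss x -> ideal_ss (ga_gr A d x).
Proof.
pose P x := forall d, ideal_ss (ga_gr A d x).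
have Plin (c : k) u v : P u -> P v -> P (c *: u + v).
  by move=> Pu Pv e; rewrite gr_lin; apply: ss_lin.
have P0 : P 0 by move=> e; rewrite (lin0 (gr_lin _ e)); apply: ss_0.
move=> Ix; move: d; apply: (Ix (Subspace Plin P0)) => [a y /= Py|a y /= Py|e Ee] /=.
- elim/span_ind: a / (span_homog (G := ga_gr A) a) => [|c u v _ _ Pu Pv|u [d hu]].
  + by rewrite mul0x.
  + by rewrite ga_linl; apply: Plin.
  by move=> e; rewrite (comp_mul_l _ _ hu); apply: ideal_l.
- elim/span_ind: a / (span_homog (G := ga_gr A) a) => [|c u v _ _ Pu Pv|u [d hu]].
  + by rewrite mulx0.
  + by rewrite ga_linr; apply: Plin.
  by move=> e; rewrite (comp_mul_r _ _ hu); apply: ideal_r.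
move=> d; rewrite (homogE _ (gi_homog e)); case: ifP => _; last exact: ss_0.
by move=> J _ _; apply.
Qed.

Definition gen_ideal : hideal A := HIdeal ideal_l ideal_r ideal_comp.
End GeneratedIdeal.

Section QuotientAlgebra.
Variables (k : fieldType) (A : galg k) (J : hideal A).
Notation Q := (quot_space J).
Notation pj := (to_quot J).

Definition qmul (x y : Q) : Q := pj (repr x ** repr y).

Lemma qmulE x y : qmul (pj x) (pj y) = pj (x ** y).
Proof.
have rP z : J (repr (pj z) - z) by apply/to_quotP; rewrite /to_quot reprK.
apply/to_quotP; set x' := repr _; set y' := repr _.
have -> : x' ** y' - x ** y = x' ** (y' - y) + (x' - x) ** y.
  by rewrite (linB (@ga_linr _ A _)) (linB (@ga_linl _ A _)) addrA subrK.
by apply: ssD; [apply: hi_l; apply: rP | apply: hi_r; apply: rP].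
Qed.

Fact qmul_linl y : linear (qmul^~ y).
Proof.
elim/quot_ind: y => y c; elim/quot_ind=> u; elim/quot_ind=> v.
by rewrite -to_quot_lin !qmulE ga_linl to_quot_lin.
Qed.
Fact qmul_linr x : linear (qmul x).
Proof.
elim/quot_ind: x => x c; elim/quot_ind=> u; elim/quot_ind=> v.
by rewrite -to_quot_lin !qmulE ga_linr to_quot_lin.
Qed.
Fact qmulA : associative qmul.
Proof.
by elim/quot_ind=> x; elim/quot_ind=> y; elim/quot_ind=> z; rewrite !qmulE ga_assoc.
Qed.

Definition quot_gr : grading Q := Grading (quot_proj_dec (gr_dec (ga_gr A)) (@hi_comp _ _ J)).

Lemma quot_grE d x : quot_gr d (pj x) = pj (ga_gr A d x).
Proof. exact: quot_projE (gr_dec (ga_gr A)) (@hi_comp _ _ J) d x. Qed.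

Lemma homog_quot d (q : Q) : homog quot_gr d q -> exists2 x, homog (ga_gr A) d x & q = pj x.
Proof.
elim/quot_ind: q => x hq; exists (ga_gr A d x); first exact: homog_comp.
by rewrite -quot_grE.
Qed.

Fact qmul_homog d e x y : homog quot_gr d x -> homog quot_gr e y -> homog quot_gr (d + e) (qmul x y).
Proof.
move=> /homog_quot[u hu ->] /homog_quot[v hv ->].
by rewrite /homog qmulE quot_grE (ga_homog hu hv).
Qed.

Definition quot_galg : galg k := GAlg qmul_linl qmul_linr qmulA qmul_homog.

Fact quot_idem_idem (e : gidem A) : (pj e : quot_galg) ** pj e = pj e.
Proof. by rewrite /= qmulE gi_idem. Qed.
Fact quot_idem_homog (e : gidem A) : homog (ga_gr quot_galg) 0 (pj e).
Proof. by rewrite /homog quot_grE (gi_homog e). Qed.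
Definition quot_idem (e : gidem A) : gidem quot_galg :=
  GIdem (quot_idem_idem e) (quot_idem_homog e).
End QuotientAlgebra.

Section QuotientLUAlgebra.
Variables (k : fieldType) (I : choiceType) (A : lualg k I) (J : hideal A).

Definition quot_one i : gidem (quot_galg J) := quot_idem J (lu_one A i).

Fact quot_orth i j : i != j -> quot_one i ** quot_one j = 0.
Proof. by move=> ij; rewrite /= qmulE lu_orth //; exact/to_quot0/ss_0. Qed.

Fact quot_dec : decomposes (fun (ij : I * I) x => quot_one ij.1 ** x ** quot_one ij.2).
Proof.
have Jp (ij : I * I) x : J x -> J (lu_one A ij.1 ** x ** lu_one A ij.2).
  by move=> Jx; apply: hi_r; apply: hi_l.
have := quot_proj_dec (lu_dec A) Jp; congr decomposes.
apply/funext => ij; apply/funext; elim/quot_ind => x.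
by rewrite (quot_projE (lu_dec A) Jp) /= !qmulE.
Qed.

Definition quot_lualg : lualg k I := LUAlg quot_orth quot_dec.
End QuotientLUAlgebra.

Section Corner.
Variables (k : fieldType) (A : galg k) (e : gidem A).

Fact right_ss_lin (c : k) u v : u ** e = u -> v ** e = v -> (c *: u + v) ** e = c *: u + v.
Proof. by move=> hu hv; rewrite ga_linl hu hv. Qed.
Fact right_ss_0 : 0 ** e = 0.
Proof. exact: mul0x. Qed.
Definition left_ideal : subspace A := @Subspace _ _ (fun x => x ** e = x) right_ss_lin right_ss_0.

Fact left_ss_lin (c : k) u v : e ** u = u -> e ** v = v -> e ** (c *: u + v) = c *: u + v.
Proof. by move=> hu hv; rewrite ga_linr hu hv. Qed.
Fact left_ss_0 : e ** 0 = 0.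
Proof. exact: mulx0. Qed.
Definition right_ideal : subspace A := @Subspace _ _ (fun x => e ** x = x) left_ss_lin left_ss_0.

Fact corner_ss_lin (c : k) u v :
  e ** u ** e = u -> e ** v ** e = v -> e ** (c *: u + v) ** e = c *: u + v.
Proof. by move=> hu hv; rewrite ga_linr ga_linl hu hv. Qed.
Fact corner_ss_0 : e ** 0 ** e = 0.
Proof. by rewrite mulx0 mul0x. Qed.
Definition corner_ss : subspace A :=
  @Subspace _ _ (fun x => e ** x ** e = x) corner_ss_lin corner_ss_0.

Lemma corner_l x : corner_ss x -> e ** x = x.
Proof. by rewrite /= => <-; rewrite !ga_assoc gi_idem. Qed.
Lemma corner_r x : corner_ss x -> x ** e = x.
Proof. by rewrite /= => <-; rewrite -!ga_assoc gi_idem. Qed.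

Fact left_ideal_comp d x : left_ideal x -> left_ideal (ga_gr A d x).
Proof. by move=> /= hx; rewrite -comp_idem_r hx. Qed.
Fact right_ideal_comp d x : right_ideal x -> right_ideal (ga_gr A d x).
Proof. by move=> /= hx; rewrite -comp_idem_l hx. Qed.
Fact corner_comp d x : corner_ss x -> corner_ss (ga_gr A d x).
Proof. by move=> /= hx; rewrite -comp_idem_l -comp_idem_r hx. Qed.

Definition left_ideal_gr : grading (sub_space left_ideal) :=
  Grading (sub_proj_dec (gr_dec (ga_gr A)) left_ideal_comp).
Definition right_ideal_gr : grading (sub_space right_ideal) :=
  Grading (sub_proj_dec (gr_dec (ga_gr A)) right_ideal_comp).
Definition corner_gr : grading (sub_space corner_ss) :=
  Grading (sub_proj_dec (gr_dec (ga_gr A)) corner_comp).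

Fact corner_mul_subproof (x y : sub_space corner_ss) : corner_ss (sub_val x ** sub_val y).
Proof. by rewrite /= ga_assoc (corner_l (subP x)) -ga_assoc (corner_r (subP y)). Qed.
Definition corner_mul x y : sub_space corner_ss := mk_sub (corner_mul_subproof x y).

Fact corner_linl y : linear (corner_mul^~ y).
Proof. by move=> c u v; apply: sub_val_inj; rewrite /= ga_linl. Qed.
Fact corner_linr x : linear (corner_mul x).
Proof. by move=> c u v; apply: sub_val_inj; rewrite /= ga_linr. Qed.
Fact corner_mulA : associative corner_mul.
Proof. by move=> x y z; apply: sub_val_inj; rewrite /= ga_assoc. Qed.
Fact corner_homog d f x y :
  homog corner_gr d x -> homog corner_gr f y -> homog corner_gr (d + f) (corner_mul x y).
Proof.
move=> /(congr1 (@sub_val _ _ _)) /= hx /(congr1 (@sub_val _ _ _)) /= hy.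
by apply: sub_val_inj; rewrite /= (ga_homog hx hy).
Qed.

Definition corner_galg : galg k := GAlg corner_linl corner_linr corner_mulA corner_homog.

Fact corner_one_subproof : corner_ss e.
Proof. by rewrite /= !gi_idem. Qed.
Fact corner_one_idem :
  (mk_sub corner_one_subproof : corner_galg) ** mk_sub corner_one_subproof
  = mk_sub corner_one_subproof.
Proof. by apply: sub_val_inj; rewrite /= gi_idem. Qed.
Fact corner_one_homog : homog (ga_gr corner_galg) 0 (mk_sub corner_one_subproof).
Proof. by apply: sub_val_inj; rewrite /= (gi_homog e). Qed.
Definition corner_one (_ : unit) : gidem corner_galg := GIdem corner_one_idem corner_one_homog.

Fact corner_orth (i j : unit) : i != j -> corner_one i ** corner_one j = 0.
Proof. by case: i j => [] []. Qed.
Fact corner_dec :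
  decomposes (fun (ij : unit * unit) x => corner_one ij.1 ** x ** corner_one ij.2).
Proof.
have one2 (ij : unit * unit) x : corner_one ij.1 ** x ** corner_one ij.2 = x.
  by apply: sub_val_inj; rewrite /=; apply: (subP x).
split=> [ij c x y|[[] []] [[] []] x|x]; first by rewrite !one2.
  by rewrite eqxx one2.
by exists [:: (tt, tt)] => //; rewrite big_seq1 one2.
Qed.

Definition corner : lualg k unit := LUAlg corner_orth corner_dec.
End Corner.

Definition is_ghom (k : fieldType) (I : choiceType) (A : lualg k I) (V W : gmod A)
    (d : int) (f : V -> W) : Prop :=
  [/\ linear f, forall (a : A) v, f (a **: v) = a **: f v
    & forall n v, homog (gm_gr V) n v -> homog (gm_gr W) (n + d) (f v)].

Record gmor (k : fieldType) (I : choiceType) (A : lualg k I) (V W : gmod A) := GMor {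
  gmor_fun :> V -> W;
  gmorP : is_ghom 0 gmor_fun
}.

Definition giso (k : fieldType) (I : choiceType) (A : lualg k I) (V W : gmod A) : Prop :=
  exists f : gmor V W, bijective f.

Record gsub (k : fieldType) (I : choiceType) (A : lualg k I) (V : gmod A) := GSub {
  gs_ss :> subspace V;
  gs_act : forall (a : A) v, gs_ss v -> gs_ss (a **: v);
  gs_comp : forall d v, gs_ss v -> gs_ss (gm_gr V d v)
}.

Section Shift.
Variables (k : fieldType) (I : choiceType) (A : lualg k I) (n : int) (V : gmod A).

Definition shift_comp (d : int) : V -> V := gm_gr V (d - n).
Fact shift_comp_dec : decomposes shift_comp.
Proof.
split=> [d|d e v|v]; first exact: gr_lin.
  by rewrite /shift_comp (dec_orth (gr_dec _)) (inj_eq (addIr _)).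
have [s us vs] := dec_sum (gr_dec (gm_gr V)) v.
exists [seq d + n | d <- s]; first by rewrite map_inj_uniq //; apply: addIr.
by rewrite big_map /shift_comp [LHS]vs; apply: eq_bigr => d _; rewrite addrK.
Qed.
Definition shift_gr : grading V := Grading shift_comp_dec.
Fact shift_homog d e (a : A) v :
  homog (ga_gr A) d a -> homog shift_gr e v -> homog shift_gr (d + e) (a **: v).
Proof. by move=> ha hv; rewrite /homog /= /shift_comp -addrA; apply: gm_homog. Qed.

(* q^n V, with (q^n V)_d = V_(d-n). *)
Definition shift : gmod A :=
  GMod (@gm_linl _ _ _ V) (@gm_linr _ _ _ V) (@gm_assoc _ _ _ V) shift_homog (gm_dec V).
End Shift.

Section SubQuotientModule.
Variables (k : fieldType) (I : choiceType) (A : lualg k I) (V : gmod A) (U : gsub V).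

Definition sub_gr : grading (sub_space U) :=
  Grading (sub_proj_dec (gr_dec (gm_gr V)) (@gs_comp _ _ _ _ U)).
Definition sub_act (a : A) (x : sub_space U) : sub_space U := mk_sub (gs_act a (subP x)).

Fact sub_linl x : linear (sub_act^~ x).
Proof. by move=> c a b; apply: sub_val_inj; rewrite /= gm_linl. Qed.
Fact sub_linr a : linear (sub_act a).
Proof. by move=> c x y; apply: sub_val_inj; rewrite /= gm_linr. Qed.
Fact sub_assoc a b x : sub_act a (sub_act b x) = sub_act (a ** b) x.
Proof. by apply: sub_val_inj; rewrite /= gm_assoc. Qed.
Fact sub_homog d e a x :
  homog (ga_gr A) d a -> homog sub_gr e x -> homog sub_gr (d + e) (sub_act a x).
Proof.
move=> ha /(congr1 (@sub_val _ _ _)) /= hx.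
by apply: sub_val_inj; rewrite /= (gm_homog ha hx).
Qed.
Fact sub_dec : decomposes (fun i => sub_act (lu_one A i)).
Proof. exact: sub_proj_dec (gm_dec V) (fun i => @gs_act _ _ _ _ U (lu_one A i)). Qed.

Definition sub_gmod : gmod A := GMod sub_linl sub_linr sub_assoc sub_homog sub_dec.

Definition quotm_gr : grading (quot_space U) :=
  Grading (quot_proj_dec (gr_dec (gm_gr V)) (@gs_comp _ _ _ _ U)).
Definition quotm_act (a : A) : quot_space U -> quot_space U :=
  quot_lift (fun v => to_quot U (a **: v)).

Lemma quotm_actE a v : quotm_act a (to_quot U v) = to_quot U (a **: v).
Proof.
rewrite /quotm_act quot_liftE // => [c u w|u Uu]; last exact/to_quot0/gs_act.
by rewrite gm_linr to_quot_lin.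
Qed.

Fact quotm_linl x : linear (quotm_act^~ x).
Proof. by elim/quot_ind: x => v c a b; rewrite !quotm_actE gm_linl to_quot_lin. Qed.
Fact quotm_linr a : linear (quotm_act a).
Proof.
move=> c; elim/quot_ind => u; elim/quot_ind => v.
by rewrite -to_quot_lin !quotm_actE gm_linr to_quot_lin.
Qed.
Fact quotm_assoc a b x : quotm_act a (quotm_act b x) = quotm_act (a ** b) x.
Proof. by elim/quot_ind: x => v; rewrite !quotm_actE gm_assoc. Qed.
Lemma quotm_grE d v : quotm_gr d (to_quot U v) = to_quot U (gm_gr V d v).
Proof. exact: quot_projE (gr_dec (gm_gr V)) (@gs_comp _ _ _ _ U) d v. Qed.
Fact quotm_homog d e a x :
  homog (ga_gr A) d a -> homog quotm_gr e x -> homog quotm_gr (d + e) (quotm_act a x).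
Proof.
elim/quot_ind: x => v ha <-; rewrite quotm_grE quotm_actE /homog quotm_grE.
by rewrite (gm_homog ha (homog_comp _ _ _)).
Qed.
Fact quotm_dec : decomposes (fun i => quotm_act (lu_one A i)).
Proof. exact: quot_proj_dec (gm_dec V) (fun i => @gs_act _ _ _ _ U (lu_one A i)). Qed.

Definition quot_gmod : gmod A := GMod quotm_linl quotm_linr quotm_assoc quotm_homog quotm_dec.
End SubQuotientModule.

Section Subquotient.
Variables (k : fieldType) (I : choiceType) (A : lualg k I) (V : gmod A) (U U' : gsub V).

Fact restrict_lin (c : k) (x y : sub_gmod U) :
  U' (sub_val x) -> U' (sub_val y) -> U' (sub_val (c *: x + y)).
Proof. by rewrite sub_val_lin; apply: ss_lin. Qed.
Fact restrict_0 : U' (sub_val (0 : sub_gmod U)).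
Proof. exact: ss_0. Qed.
Fact restrict_act (a : A) (x : sub_gmod U) : U' (sub_val x) -> U' (sub_val (a **: x)).
Proof. exact: gs_act. Qed.
Fact restrict_comp d (x : sub_gmod U) : U' (sub_val x) -> U' (sub_val (gm_gr (sub_gmod U) d x)).
Proof. exact: gs_comp. Qed.
Definition restrict : gsub (sub_gmod U) :=
  @GSub _ _ _ (sub_gmod U) (@Subspace _ _ (fun x : sub_gmod U => U' (sub_val x)) restrict_lin restrict_0)
    restrict_act restrict_comp.

(* The section U / U' of a filtration (used only for U' contained in U). *)
Definition subquotient : gmod A := quot_gmod restrict.
End Subquotient.

Section RadicalHead.
Variables (k : fieldType) (I : choiceType) (A : lualg k I) (V : gmod A).

Definition maximal_gsub (M : gsub V) : Prop :=
  (exists v, ~ M v) /\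
  forall U : gsub V, (forall v, M v -> U v) -> (forall v, U v -> M v) \/ (forall v, U v).

Definition rad_set (v : V) : Prop := forall M : gsub V, maximal_gsub M -> M v.
Fact rad_lin (c : k) u v : rad_set u -> rad_set v -> rad_set (c *: u + v).
Proof. by move=> Ru Rv M mM; apply: ss_lin; [apply: Ru | apply: Rv]. Qed.
Fact rad_0 : rad_set 0.
Proof. by move=> M _; apply: ss_0. Qed.
Fact rad_act (a : A) v : rad_set v -> rad_set (a **: v).
Proof. by move=> Rv M mM; apply/gs_act/Rv. Qed.
Fact rad_comp d v : rad_set v -> rad_set (gm_gr V d v).
Proof. by move=> Rv M mM; apply/gs_comp/Rv. Qed.
Definition rad : gsub V := @GSub _ _ _ V (Subspace rad_lin rad_0) rad_act rad_comp.

Definition gmod_head : gmod A := quot_gmod rad.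

Definition irreducible : Prop :=
  (exists v : V, v <> 0) /\
  forall U : gsub V, (forall v, U v -> v = 0) \/ (forall v, U v).
End RadicalHead.

Definition projective (k : fieldType) (I : choiceType) (A : lualg k I) (P : gmod A) : Prop :=
  forall (V W : gmod A) (p : gmor V W) (f : gmor P W), (forall w, exists v, p v = w) ->
  exists g : gmor P V, forall x, p (g x) = f x.

Definition injective_gmod (k : fieldType) (I : choiceType) (A : lualg k I) (Q : gmod A) : Prop :=
  forall (V W : gmod A) (i : gmor V W) (f : gmor V Q), injective i ->
  exists g : gmor W Q, forall x, g (i x) = f x.

Definition findim (k : fieldType) (V : lmodType k) (U : set V) : Prop :=
  exists n (b : 'I_n -> V), forall v, U v -> exists c : 'I_n -> k, v = \sum_(i < n) c i *: b i.

Section Finiteness.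
Variables (k : fieldType) (I : choiceType) (A : lualg k I).

Definition alg_locally_findim : Prop := forall i j d,
  findim [set x : A | lu_one A i ** x ** lu_one A j = x /\ homog (ga_gr A) d x].
Definition alg_bounded_below : Prop := forall i j, exists N : int, forall d, d < N ->
  forall x : A, lu_one A i ** x ** lu_one A j = x -> homog (ga_gr A) d x -> x = 0.

Variable V : gmod A.
Definition locally_findim : Prop := forall i d,
  findim [set v : V | lu_one A i **: v = v /\ homog (gm_gr V) d v].
Definition bounded_below : Prop := forall i, exists N : int, forall d, d < N ->
  forall v : V, lu_one A i **: v = v -> homog (gm_gr V) d v -> v = 0.
Definition bounded_above : Prop := forall i, exists N : int, forall d, N < d ->
  forall v : V, lu_one A i **: v = v -> homog (gm_gr V) d v -> v = 0.
End Finiteness.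

Lemma lu_left_dec (k : fieldType) (I : choiceType) (A : lualg k I) :
  decomposes (fun i (x : A) => lu_one A i ** x).
Proof.
apply: (@decomposes_span _ _ _ _ _ (fun j => [set x | lu_one A j ** x = x])).
- by move=> j; apply: ga_linr.
- move=> i j x /= <-; rewrite !ga_assoc lu_oneM.
  by case: (i == j); rewrite ?mul0x.
move=> a; elim/span_ind: a / (span_lu a) => [|c a b _ _ Sa Sb|a [d [j [_ ja]]]].
- exact: ss_0.
- exact: ss_lin.
by apply: span_gen; exists j.
Qed.

Section LeftModule.
Variables (k : fieldType) (I : choiceType) (A : lualg k I) (e : gidem A).

Fact left_act_subproof (a : A) (x : sub_space (left_ideal e)) : left_ideal e (a ** sub_val x).
Proof. by rewrite /= -ga_assoc (subP x). Qed.
Definition left_act (a : A) (x : sub_space (left_ideal e)) := mk_sub (left_act_subproof a x).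
Fact left_linl x : linear (left_act^~ x).
Proof. by move=> c a b; apply: sub_val_inj; rewrite /= ga_linl. Qed.
Fact left_linr a : linear (left_act a).
Proof. by move=> c x y; apply: sub_val_inj; rewrite /= ga_linr. Qed.
Fact left_assoc a b x : left_act a (left_act b x) = left_act (a ** b) x.
Proof. by apply: sub_val_inj; rewrite /= ga_assoc. Qed.
Fact left_homog d f a x : homog (ga_gr A) d a -> homog (left_ideal_gr e) f x ->
  homog (left_ideal_gr e) (d + f) (left_act a x).
Proof.
move=> ha /(congr1 (@sub_val _ _ _)) /= hx.
by apply: sub_val_inj; rewrite /= (ga_homog ha hx).
Qed.
Fact left_dec : decomposes (fun i => left_act (lu_one A i)).
Proof.
have cl i (x : A) : left_ideal e x -> left_ideal e (lu_one A i ** x).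
  by rewrite /= -ga_assoc => ->.
have := sub_proj_dec (lu_left_dec A) cl; congr decomposes.
by apply/funext => i; apply/funext => x; apply: sub_val_inj.
Qed.

Definition left_module : gmod A :=
  GMod left_linl left_linr left_assoc left_homog left_dec.
End LeftModule.

Section Inflation.
Variables (k : fieldType) (I : choiceType) (A : lualg k I) (J : hideal A).
Variable V : gmod (quot_lualg J).

Definition infl_act (a : A) (v : V) : V := (to_quot J a : quot_lualg J) **: v.
Fact infl_linl v : linear (infl_act^~ v).
Proof. by move=> c a b; rewrite /infl_act to_quot_lin; apply: gm_linl. Qed.
Fact infl_assoc a b v : infl_act a (infl_act b v) = infl_act (a ** b) v.
Proof. by rewrite /infl_act gm_assoc /= qmulE. Qed.
Fact infl_homog d e a v :
  homog (ga_gr A) d a -> homog (gm_gr V) e v -> homog (gm_gr V) (d + e) (infl_act a v).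
Proof. by move=> ha; apply: gm_homog; exact: etrans (quot_grE J d a) (congr1 (to_quot J) ha). Qed.

Definition inflation : gmod A :=
  @GMod _ _ A V infl_act (gm_gr V) infl_linl (fun a => @gm_linr _ _ _ V (to_quot J a))
    infl_assoc infl_homog (gm_dec V).
End Inflation.

(* A refinement of the identity of a unital graded algebra C into orthogonal
   homogeneous idempotents. *)
Record refinement (k : fieldType) (C : lualg k unit) (K : choiceType) := Refinement {
  rf_one : K -> gidem C;
  rf_orth : forall p r, p != r -> rf_one p ** rf_one r = 0;
  rf_dec : decomposes (fun (pr : K * K) x => rf_one pr.1 ** x ** rf_one pr.2)
}.

Definition refined (k : fieldType) (C : lualg k unit) (K : choiceType)
  (D : refinement C K) : lualg k K := LUAlg (@rf_orth _ _ _ D) (rf_dec D).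

Section Unrefine.
Variables (k : fieldType) (C : lualg k unit) (K : choiceType) (D : refinement C K).
Variable V : gmod (refined D).

Lemma one_mul (x : C) : lu_one C tt ** x = x.
Proof.
have [s _ ->] := dec_sum (lu_dec C) x; rewrite (lin_sum (@ga_linr _ C _)).
by apply: eq_bigr => -[[] []] _; rewrite !ga_assoc gi_idem.
Qed.

Fact unrefine_dec :
  decomposes (fun (_ : unit) v => @gm_act _ _ (refined D) V (lu_one C tt) v).
Proof.
have one1 v : @gm_act _ _ (refined D) V (lu_one C tt) v = v.
  have [s _ ->] := dec_sum (gm_dec V) v; rewrite (lin_sum (@gm_linr _ _ _ V _)).
  by apply: eq_bigr => p _; rewrite gm_assoc /= one_mul.
split=> [_ c u v|[] [] v|v]; first by rewrite !one1.
  by rewrite eqxx one1.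
by exists [:: tt] => //; rewrite big_seq1 one1.
Qed.

Fact unrefine_dec_unit :
  decomposes (fun i : unit => @gm_act _ _ (refined D) V (lu_one C i)).
Proof.
by have := unrefine_dec; congr decomposes; apply/funext => -[].
Qed.

(* The category of graded C-modules does not depend on the chosen idempotents. *)
Definition unrefine : gmod C :=
  @GMod _ _ C V (@gm_act _ _ (refined D) V) (gm_gr V) (@gm_linl _ _ _ V) (@gm_linr _ _ _ V)
    (@gm_assoc _ _ _ V) (@gm_homog _ _ _ V) unrefine_dec_unit.
End Unrefine.

Section FreeSpace.
Variables (k : fieldType) (T : choiceType).

Definition finsupp_set (f : T -> k^o) : Prop := exists s : seq T, forall t, t \notin s -> f t = 0.
Fact finsupp_lin (c : k) f g : finsupp_set f -> finsupp_set g -> finsupp_set (c *: f + g).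
Proof.
move=> [s s0] [t t0]; exists (s ++ t) => u; rewrite mem_cat negb_or => /andP[us ut].
have -> : (c *: f + g) u = c *: f u + g u by [].
by rewrite s0 // t0 // scaler0 addr0.
Qed.
Fact finsupp_0 : finsupp_set 0.
Proof. by exists [::]. Qed.

Definition free_space := sub_space (Subspace finsupp_lin finsupp_0).

Fact basis_subproof (t : T) : finsupp_set (fun u => (u == t)%:R).
Proof. by exists [:: t] => u; rewrite inE => /negPf->. Qed.
Definition basis_vec (t : T) : free_space := @mk_sub _ _ (Subspace finsupp_lin finsupp_0) _ (basis_subproof t).

Lemma free_supp (f : free_space) :
  exists2 s : seq T, uniq s & forall t, t \notin s -> sub_val f t = 0.
Proof.
have [s s0] : finsupp_set (sub_val f) := subP f.
by exists (undup s) => [|t]; rewrite ?undup_uniq // mem_undup => /s0.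
Qed.

Lemma sub_val_sum J (r : seq J) (F : J -> free_space) t :
  sub_val (\sum_(j <- r) F j) t = \sum_(j <- r) sub_val (F j) t.
Proof. by elim: r => [|j r IH]; rewrite ?big_nil // !big_cons -IH. Qed.

Lemma free_sum (f : free_space) (s : seq T) : uniq s -> (forall t, t \notin s -> sub_val f t = 0) ->
  f = \sum_(t <- s) (sub_val f t : k) *: basis_vec t.
Proof.
move=> us s0; apply: sub_val_inj; apply/funext => u; rewrite sub_val_sum.
have E t : sub_val ((sub_val f t : k) *: basis_vec t) u = sub_val f t * (u == t)%:R by [].
under eq_bigr do rewrite E.
have [us'|us'] := boolP (u \in s); last first.
  by rewrite s0 // big1_seq // => t /andP[_ ts]; case: eqP us' => [->|_]; rewrite ?mulr0 // ts.
rewrite (bigD1_seq u) //= eqxx mulr1 big1 ?addr0 // => t /negPf.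
by rewrite eq_sym => ->; rewrite mulr0.
Qed.

Variable W : lmodType k.
Definition free_ext (phi : T -> W) (f : free_space) : W :=
  \sum_(t \in [set: T]) (sub_val f t : k) *: phi t.

Lemma free_ext_lin phi : linear (free_ext phi).
Proof.
apply: (@fsumT_lin _ _ _ T (fun t (f : free_space) => (sub_val f t : k) *: phi t)) => [t c f g|f].
  by rewrite scalerA -scalerDl.
have [s us s0] := free_supp f; exists s => // t /s0 ->; exact: scale0r.
Qed.

Lemma free_extE phi t : free_ext phi (basis_vec t) = phi t.
Proof.
rewrite /free_ext (@fsumT_seq _ _ _ [:: t]) // => [|u].
  by rewrite big_seq1 /= eqxx scale1r.
by rewrite inE /= => /negPf->; rewrite scale0r.
Qed.
End FreeSpace.

(* M (x)_B V, for a right action r of B on M and a left action l of B on V. *)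
Section Tensor.
Variables (k : fieldType) (M V : lmodType k) (B : Type) (r : M -> B -> M) (l : B -> V -> V).
Notation F := (free_space k (M * V)%type).
Notation "[ m , v ]" := (@basis_vec k (M * V)%type (m, v)).

Definition tensor_rel : set F := [set x |
  [\/ exists c m m' v, x = [c *: m + m', v] - (c *: [m, v] + [m', v]),
      exists c m v v', x = [m, c *: v + v'] - (c *: [m, v] + [m, v'])
    | exists m b v, x = [r m b, v] - [m, l b v]]].

Definition tensor : lmodType k := quot_space (span tensor_rel).
Definition tens (m : M) (v : V) : tensor := to_quot (span tensor_rel) [m, v].

Lemma tens_linl v : linear (tens^~ v).
Proof.
move=> c m m'; rewrite /tens -to_quot_lin; apply/to_quotP/span_gen.
by apply: Or31; exists c, m, m', v.
Qed.
Lemma tens_linr m : linear (tens m).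
Proof.
move=> c v v'; rewrite /tens -to_quot_lin; apply/to_quotP/span_gen.
by apply: Or32; exists c, m, v, v'.
Qed.
Lemma tens_bal m b v : tens (r m b) v = tens m (l b v).
Proof. by apply/to_quotP/span_gen; apply: Or33; exists m, b, v. Qed.

Lemma span_tens (t : tensor) : span [set t | exists m v, t = tens m v] t.
Proof.
elim/quot_ind: t => f; have [s us s0] := free_supp f.
rewrite (free_sum us s0) (lin_sum (@to_quot_lin _ _ _)); apply: ss_sum => -[m v] _.
rewrite (linZ (@to_quot_lin _ _ _)); apply: ssZ; apply: span_gen; by exists m, v.
Qed.

Section Lift.
Variables (W : lmodType k) (phi : M -> V -> W).
Hypotheses (phi_linl : forall v, linear (phi^~ v)) (phi_linr : forall m, linear (phi m)).
Hypothesis phi_bal : forall m b v, phi (r m b) v = phi m (l b v).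

Definition tens_lift : tensor -> W :=
  quot_lift (free_ext (fun p : M * V => phi p.1 p.2)).

Fact tens_lift0 f : span tensor_rel f -> free_ext (fun p : M * V => phi p.1 p.2) f = 0.
Proof.
set g := free_ext _; have glin : linear g := free_ext_lin _.
elim/span_ind: f / => [|c u v _ _ gu gv|_ [[c [m [m' [v ->]]]]|[c [m [v [v' ->]]]]|[m [b [v ->]]]]].
- exact: lin0.
- by rewrite glin gu gv scaler0 addr0.
- by rewrite linB // glin /g !free_extE /= phi_linl subrr.
- by rewrite linB // glin /g !free_extE /= phi_linr subrr.
- by rewrite linB // /g !free_extE /= phi_bal subrr.
Qed.

Lemma tens_liftE m v : tens_lift (tens m v) = phi m v.
Proof. by rewrite /tens_lift quot_liftE ?free_extE //; [apply: free_ext_lin | apply: tens_lift0]. Qed.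
Lemma tens_lift_lin : linear tens_lift.
Proof. by apply: quot_lift_lin; [apply: free_ext_lin | apply: tens_lift0]. Qed.
End Lift.
End Tensor.

Lemma span_sub (k : fieldType) (V : lmodType k) (E : set V) (x : sub_space (span E)) :
  span [set y : sub_space (span E) | E (sub_val y)] x.
Proof.
suff key v : span E v -> forall y : sub_space (span E), sub_val y = v ->
    span [set y : sub_space (span E) | E (sub_val y)] y by exact: key (subP x) x erefl.
elim/span_ind => [|c u w Su Sw Pu Pw|e Ee] y yv.
- by have -> : y = 0 by [apply: sub_val_inj]; apply: ss_0.
- have -> : y = c *: mk_sub Su + mk_sub Sw by [apply: sub_val_inj].
  by apply: ss_lin; [apply: Pu | apply: Pw].
by apply: span_gen; rewrite /= yv.
Qed.

Section LeftAdjoint.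
Variables (k : fieldType) (I : choiceType) (Q : lualg k I) (e : gidem Q) (V : gmod (corner e)).
Notation M := (sub_space (left_ideal e)).
Notation C := (corner e).
Notation MG := (left_ideal_gr e).

Fact corner_ract_subproof (m : M) (b : C) : left_ideal e (sub_val m ** sub_val b).
Proof. by rewrite /= -ga_assoc (corner_r (subP b)). Qed.
Definition corner_ract (m : M) (b : C) : M := mk_sub (corner_ract_subproof m b).

(* The underlying space Q e (x)_(e Q e) V of the left adjoint of V |-> e V. *)
Definition jsh_space : lmodType k :=
  tensor corner_ract (fun (b : C) (v : V) => b **: v).
Notation T := jsh_space.
Definition jsh_tens (m : M) (v : V) : T := tens corner_ract (fun (b : C) (v : V) => b **: v) m v.
Notation "m (x) v" := (jsh_tens m v) (at level 40).

Lemma jsh_linl v : linear (jsh_tens^~ v). Proof. exact: tens_linl. Qed.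
Lemma jsh_linr m : linear (jsh_tens m). Proof. exact: tens_linr. Qed.
Lemma jsh_bal m (b : C) v : corner_ract m b (x) v = m (x) (b **: v).
Proof. exact: tens_bal. Qed.

Lemma jsh_span (t : T) : span [set t | exists a b m v,
  [/\ homog MG a m, homog (gm_gr V) b v & t = m (x) v]] t.
Proof.
elim/span_ind: t / (span_tens t) => [|c u w _ _|_ [m [v ->]]]; first exact: ss_0.
  exact: ss_lin.
rewrite -/(jsh_tens m v).
elim/span_ind: m / (span_homog (G := MG) m) => [|c m m' _ _ Sm Sm'|m [a hm]].
- by rewrite (lin0 (jsh_linl v)); apply: ss_0.
- by rewrite (jsh_linl v c m m'); apply: ss_lin.
elim/span_ind: v / (span_homog (G := gm_gr V) v) => [|c v v' _ _ Sv Sv'|v [b hv]].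
- by rewrite (lin0 (jsh_linr m)); apply: ss_0.
- by rewrite (jsh_linr m c v v'); apply: ss_lin.
by apply: span_gen; exists a, b, m, v.
Qed.

Definition jsh_act (a : Q) : T -> T := tens_lift (fun m v => left_act a m (x) v).

Fact jsh_act_linl' a v : linear (fun m => left_act a m (x) v).
Proof. by move=> c m m'; rewrite left_linr jsh_linl. Qed.
Fact jsh_act_linr' a m : linear (fun v => left_act a m (x) v).
Proof. exact: jsh_linr. Qed.
Fact jsh_act_bal a m (b : C) v : left_act a (corner_ract m b) (x) v = left_act a m (x) (b **: v).
Proof. by rewrite -jsh_bal; congr jsh_tens; apply: sub_val_inj; rewrite /= ga_assoc. Qed.
Lemma jsh_actE a m v : jsh_act a (m (x) v) = left_act a m (x) v.
Proof. exact: tens_liftE (jsh_act_linl' a) (jsh_act_linr' a) (jsh_act_bal a) m v. Qed.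
Fact jsh_act_linr a : linear (jsh_act a).
Proof. exact: tens_lift_lin (jsh_act_linl' a) (jsh_act_linr' a) (jsh_act_bal a). Qed.

Lemma jsh_ext (W : lmodType k) (f g : T -> W) : linear f -> linear g ->
  (forall m v, f (m (x) v) = g (m (x) v)) -> f =1 g.
Proof.
move=> flin glin fg t; elim/span_ind: t / (span_tens t) => [|c u w _ _ fu fw|_ [m [v ->]]].
- by rewrite !lin0.
- by rewrite flin glin fu fw.
exact: fg.
Qed.

Fact jsh_act_linl t : linear (jsh_act^~ t).
Proof.
move=> c a b; move: t; apply: jsh_ext; first exact: jsh_act_linr.
  by move=> d u v; rewrite !jsh_act_linr !scalerDr !scalerA mulrC addrACA.
by move=> m v; rewrite !jsh_actE left_linl jsh_linl.
Qed.
Fact jsh_assoc a b t : jsh_act a (jsh_act b t) = jsh_act (a ** b) t.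
Proof.
move: t; apply: jsh_ext; first by move=> c u v; rewrite !jsh_act_linr.
  exact: jsh_act_linr.
by move=> m v; rewrite !jsh_actE left_assoc.
Qed.

Definition jsh_comp0 (d : int) (m : M) (v : V) : T :=
  \sum_(f \in [set: int]) (MG f m (x) gm_gr V (d - f) v).
Definition jsh_comp (d : int) : T -> T := tens_lift (jsh_comp0 d).

Fact jsh_comp0_linl d v : linear ((jsh_comp0 d)^~ v).
Proof.
apply: (@fsumT_lin _ _ _ int (fun f m => MG f m (x) gm_gr V (d - f) v)) => [f c m m'|m].
  by rewrite gr_lin jsh_linl.
have [s us s0] := gr_fin MG m; exists s => // f /s0 ->; exact: lin0 (jsh_linl _).
Qed.
Fact jsh_comp0_linr d m : linear (jsh_comp0 d m).
Proof.
apply: (@fsumT_lin _ _ _ int (fun f v => MG f m (x) gm_gr V (d - f) v)) => [f c v v'|v].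
  by rewrite gr_lin jsh_linr.
have [s us s0] := gr_fin MG m; exists s => // f /s0 ->; exact: lin0 (jsh_linl _).
Qed.

Lemma jsh_comp0E d a m v : homog MG a m -> jsh_comp0 d m v = m (x) gm_gr V (d - a) v.
Proof.
move=> hm; rewrite /jsh_comp0 (@fsumT_seq _ _ _ [:: a]) ?big_seq1 ?hm // => f.
by rewrite inE (homogE _ hm) => /negPf->; exact: lin0 (jsh_linl _).
Qed.

Lemma homog_ract a b m c : homog MG a m -> homog (ga_gr C) b c -> homog MG (a + b) (corner_ract m c).
Proof.
move=> /(congr1 (@sub_val _ _ _)) /= hm /(congr1 (@sub_val _ _ _)) /= hc.
by apply: sub_val_inj; rewrite /= (ga_homog hm hc).
Qed.

Fact jsh_comp0_bal d m (b : C) v : jsh_comp0 d (corner_ract m b) v = jsh_comp0 d m (b **: v).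
Proof.
have rl c x y (z : C) : corner_ract (c *: x + y) z = c *: corner_ract x z + corner_ract y z.
  by apply: sub_val_inj; rewrite /= ga_linl.
have rr c x (y z : C) : corner_ract x (c *: y + z) = c *: corner_ract x y + corner_ract x z.
  by apply: sub_val_inj; rewrite /= ga_linr.
have r0l z : corner_ract 0 z = 0 by apply: sub_val_inj; rewrite /= mul0x.
have r0r x : corner_ract x 0 = 0 by apply: sub_val_inj; rewrite /= mulx0.
have l0 x : jsh_comp0 d 0 x = 0 := lin0 (jsh_comp0_linl d x).
elim/span_ind: m / (span_homog (G := MG) m) => [|c m m' _ _ Sm Sm'|m [a hm]].
- by rewrite r0l !l0.
- by rewrite rl !jsh_comp0_linl Sm Sm'.
elim/span_ind: b / (span_homog (G := ga_gr C) b) => [|c b b' _ _ Sb Sb'|b [n hb]].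
- by rewrite r0r l0 (lin0 (gm_linl v)) (lin0 (jsh_comp0_linr d m)).
- by rewrite rr gm_linl jsh_comp0_linr jsh_comp0_linl Sb Sb'.
rewrite (jsh_comp0E _ _ (homog_ract hm hb)) (jsh_comp0E _ _ hm) jsh_bal.
by rewrite (act_comp_l _ _ hb) opprD addrA.
Qed.

Lemma jsh_comp_lin d : linear (jsh_comp d).
Proof. exact: tens_lift_lin (jsh_comp0_linl d) (jsh_comp0_linr d) (jsh_comp0_bal d). Qed.
Lemma jsh_compE d a b m v : homog MG a m -> homog (gm_gr V) b v ->
  jsh_comp d (m (x) v) = if d == a + b then m (x) v else 0.
Proof.
move=> hm hv.
rewrite [LHS](tens_liftE (jsh_comp0_linl d) (jsh_comp0_linr d) (jsh_comp0_bal d) m v).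
rewrite (jsh_comp0E _ _ hm) (homogE _ hv) subr_eq [b + a]addrC.
by case: ifP => // _; rewrite (lin0 (jsh_linr m)).
Qed.

Fact jsh_comp_dec : decomposes jsh_comp.
Proof.
apply: (@decomposes_span _ _ _ _ jsh_comp_lin (fun n => [set t | exists a b m v,
  [/\ n = a + b, homog MG a m, homog (gm_gr V) b v & t = m (x) v]])).
  by move=> i j t [a [b [m [v [-> hm hv ->]]]]]; apply: jsh_compE.
move=> t; elim/span_ind: t / (jsh_span t) => [|c u w _ _|_ [a [b [m [v [hm hv ->]]]]]].
- exact: ss_0.
- exact: ss_lin.
by apply: span_gen; exists (a + b), a, b, m, v.
Qed.
Definition jsh_gr : grading T := Grading jsh_comp_dec.

Fact jsh_homog d n a t : homog (ga_gr Q) d a -> homog jsh_gr n t -> homog jsh_gr (d + n) (jsh_act a t).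
Proof.
move=> ha; suff key p u : jsh_comp p (jsh_act a u) = jsh_act a (jsh_comp (p - d) u).
  by rewrite /homog /= key [d + n]addrC addrK => ->.
elim/span_ind: u / (jsh_span u) => [|c u w _ _ Pu Pw|_ [b [f [m [v [hm hv ->]]]]]].
- by rewrite !(lin0 (jsh_act_linr a), lin0 (@jsh_comp_lin _)).
- by rewrite !(jsh_act_linr, jsh_comp_lin) Pu Pw.
rewrite jsh_actE (jsh_compE _ (left_homog ha hm) hv) (jsh_compE _ hm hv) subr_eq.
rewrite [b + f + d]addrC addrA; case: ifP => _; first by rewrite jsh_actE.
by rewrite (lin0 (jsh_act_linr a)).
Qed.

Fact jsh_dec : decomposes (fun i => jsh_act (lu_one Q i)).
Proof.
apply: (@decomposes_span _ _ _ _ _ (fun j => [set t | jsh_act (lu_one Q j) t = t])).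
- by move=> j; apply: jsh_act_linr.
- move=> i j t /= <-; rewrite jsh_assoc lu_oneM.
  by case: (i == j); rewrite ?(lin0 (jsh_act_linl t)).
move=> t; elim/span_ind: t / (span_tens t) => [|c u w _ _|_ [m [v ->]]]; first exact: ss_0.
  exact: ss_lin.
rewrite -/(jsh_tens m v); have [s _ ->] := dec_sum (left_dec e) m.
rewrite (lin_sum (jsh_linl v)); apply: ss_sum => i _; apply: span_gen; exists i.
by rewrite /= jsh_actE left_assoc gi_idem.
Qed.

Definition left_adjoint : gmod Q :=
  GMod jsh_act_linl jsh_act_linr jsh_assoc jsh_homog jsh_dec.
End LeftAdjoint.

Section RightAdjoint.
Variables (k : fieldType) (I : choiceType) (Q : lualg k I) (e : gidem Q) (V : gmod (corner e)).
Notation N := (sub_space (right_ideal e)).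
Notation C := (corner e).
Notation NG := (right_ideal_gr e).

Fact corner_lact_subproof (b : C) (x : N) : right_ideal e (sub_val b ** sub_val x).
Proof. by rewrite /= ga_assoc (corner_l (subP b)). Qed.
Definition corner_lact (b : C) (x : N) : N := mk_sub (corner_lact_subproof b x).
Fact right_act_subproof (x : N) (a : Q) : right_ideal e (sub_val x ** a).
Proof. by rewrite /= ga_assoc (subP x). Qed.
Definition right_act (x : N) (a : Q) : N := mk_sub (right_act_subproof x a).

Definition is_chom (d : int) (g : N -> V) : Prop :=
  [/\ linear g, forall b x, g (corner_lact b x) = b **: g x
    & forall n x, homog NG n x -> homog (gm_gr V) (n + d) (g x)].

(* Hom_(e Q e)(e Q 1_i, V)_d, its elements being extended by zero to
   e Q = (+)_j e Q 1_j. *)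
Definition chom (i : I) (d : int) : set (N -> V) :=
  [set g | is_chom d g /\ forall x, g x = g (right_act x (lu_one Q i))].

(* The underlying space (+)_(i,d) Hom_(e Q e)(e Q 1_i, V)_d of the right adjoint
   of V |-> e V, realized inside the space of all functions e Q -> V. *)
Definition jst_ss : subspace (N -> V) := span [set g | exists i d, chom i d g].
Definition jst_space : lmodType k := sub_space jst_ss.

Lemma jst_lin g : jst_ss g -> linear g.
Proof.
elim/span_ind => [|c u w _ _ lu lw|_ [i [d [[lg _ _] _]]]] //.
- by move=> a x y; rewrite scaler0 addr0.
move=> a x y.
have E z : (c *: u + w) z = c *: u z + w z by [].
by rewrite !E lu lw !scalerDr !scalerA mulrC addrACA.
Qed.

Lemma right_act_linr x : linear (right_act x).
Proof. by move=> c a b; apply: sub_val_inj; rewrite /= ga_linr. Qed.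
Lemma right_act_linl a : linear (right_act^~ a).
Proof. by move=> c x y; apply: sub_val_inj; rewrite /= ga_linl. Qed.
Lemma right_assoc x a b : right_act (right_act x a) b = right_act x (a ** b).
Proof. by apply: sub_val_inj; rewrite /= ga_assoc. Qed.
Lemma right_homog n d x a :
  homog NG n x -> homog (ga_gr Q) d a -> homog NG (n + d) (right_act x a).
Proof.
move=> /(congr1 (@sub_val _ _ _)) /= hx ha.
by apply: sub_val_inj; rewrite /= (ga_homog hx ha).
Qed.

Definition jst_act0 (a : Q) (g : N -> V) : N -> V := fun x => g (right_act x a).

Lemma is_chom_act d n a g : homog (ga_gr Q) d a -> is_chom n g -> is_chom (d + n) (jst_act0 a g).
Proof.
move=> ha [lg bg hg]; split=> [c x y|b x|p x hx]; rewrite /jst_act0.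
- by rewrite right_act_linl lg.
- by rewrite -bg; congr g; apply: sub_val_inj; rewrite /= ga_assoc.
by rewrite addrA; apply/hg/right_homog.
Qed.

Fact jst_act_subproof a g : jst_ss g -> jst_ss (jst_act0 a g).
Proof.
elim/span_ind => [|c u w _ _ Su Sw|g' [i [d [cg ig]]]]; first exact: ss_0.
  by have -> : jst_act0 a (c *: u + w) = c *: jst_act0 a u + jst_act0 a w by []; apply: ss_lin.
have [lg _ _] := cg.
elim/span_ind: a / (span_lu a) => [|c a b _ _ Sa Sb|a [n [j [ha ja]]]].
- have -> : jst_act0 0 g' = 0; last exact: ss_0.
  by apply/funext => x; rewrite /jst_act0 (lin0 (right_act_linr x)) lin0.
- have -> : jst_act0 (c *: a + b) g' = c *: jst_act0 a g' + jst_act0 b g'; last exact: ss_lin.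
  by apply/funext => x; rewrite /jst_act0 right_act_linr lg.
apply: span_gen; exists j, (n + d); split; first exact: is_chom_act.
by move=> x; rewrite /jst_act0 right_assoc ja.
Qed.
Definition jst_act (a : Q) (g : jst_space) : jst_space := mk_sub (jst_act_subproof a (subP g)).

Fact jst_linl g : linear (jst_act^~ g).
Proof.
move=> c a b; apply: sub_val_inj; apply/funext => x /=; rewrite /jst_act0 right_act_linr.
exact: (jst_lin (subP g)).
Qed.
Fact jst_linr a : linear (jst_act a).
Proof. by move=> c g h; apply: sub_val_inj. Qed.
Fact jst_assoc a b g : jst_act a (jst_act b g) = jst_act (a ** b) g.
Proof. by apply: sub_val_inj; apply/funext => x /=; rewrite /jst_act0 right_assoc. Qed.

Definition jst_comp0 (d : int) (g : N -> V) : N -> V :=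
  fun x => \sum_(n \in [set: int]) gm_gr V (n + d) (g (NG n x)).

Lemma jst_comp0_lin d c g h : linear g -> linear h ->
  jst_comp0 d (c *: g + h) = c *: jst_comp0 d g + jst_comp0 d h.
Proof.
move=> lg lh; apply/funext => x; rewrite /jst_comp0.
have E (u v : N -> V) z : (c *: u + v) z = c *: u z + v z by [].
have [s us s0] := gr_fin NG x.
have z f n : linear f -> n \notin s -> gm_gr V (n + d) (f (NG n x)) = 0.
  by move=> lf /s0 ->; rewrite lin0 // lin0 //; apply: gr_lin.
rewrite E !(fsumT_seq us) => [|n|n|n ns].
- rewrite scaler_sumr -big_split; apply: eq_bigr => n _.
  by rewrite E gr_lin.
- exact: z.
- exact: z.
by rewrite E gr_lin !z // scaler0 addr0.
Qed.

Lemma jst_comp0E d n g : is_chom n g -> jst_comp0 d g = if d == n then g else 0.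
Proof.
move=> [lg _ hg]; apply/funext => x; rewrite /jst_comp0.
have E p : gm_gr V (p + d) (g (NG p x)) = if d == n then g (NG p x) else 0.
  by rewrite (homogE _ (hg _ _ (homog_comp NG p x))) (inj_eq (addrI p)).
have [s [us s0 xs]] := dec_locfin (@gr_lin _ _ NG) (gr_dec NG) x.
rewrite (fsumT_seq us) => [|p /s0 px]; last by rewrite E px lin0 // if_same.
under eq_bigr do rewrite E.
by case: ifP => _; [rewrite [in RHS]xs lin_sum | rewrite big1].
Qed.

Fact jst_comp_subproof d g : jst_ss g -> jst_ss (jst_comp0 d g).
Proof.
elim/span_ind => [|c u w Su Sw Pu Pw|g' [i [n [cg ig]]]].
- have -> : jst_comp0 d 0 = 0; last exact: ss_0.
  apply/funext => x; rewrite /jst_comp0 (@fsumT_seq _ _ _ [::]) ?big_nil // => n _.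
  exact: lin0 (gr_lin _ _).
- by rewrite jst_comp0_lin; [apply: ss_lin | apply: jst_lin | apply: jst_lin].
rewrite (jst_comp0E _ cg); case: ifP => _; last exact: ss_0.
by apply: span_gen; exists i, n.
Qed.
Definition jst_comp (d : int) (g : jst_space) : jst_space := mk_sub (jst_comp_subproof d (subP g)).

Fact jst_comp_lin d : linear (jst_comp d).
Proof. by move=> c g h; apply: sub_val_inj; rewrite /= jst_comp0_lin //; apply/jst_lin/subP. Qed.

Lemma jst_span (g : jst_space) : span [set h : jst_space | exists i d, chom i d (sub_val h)] g.
Proof. exact: span_sub. Qed.

Fact jst_comp_dec : decomposes jst_comp.
Proof.
apply: (@decomposes_span _ _ _ _ jst_comp_lin
  (fun d => [set g : jst_space | exists i, chom i d (sub_val g)])).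
  move=> p n g [i [cg _]]; apply: sub_val_inj; rewrite /= (jst_comp0E _ cg).
  by case: ifP.
move=> g; elim/span_ind: g / (jst_span g) => [|c u w _ _|g [i [d cg]]].
- exact: ss_0.
- exact: ss_lin.
by apply: span_gen; exists d, i.
Qed.
Definition jst_gr : grading jst_space := Grading jst_comp_dec.

Fact jst_homog d n a g : homog (ga_gr Q) d a -> homog jst_gr n g -> homog jst_gr (d + n) (jst_act a g).
Proof.
move=> ha; suff key p h : jst_comp p (jst_act a h) = jst_act a (jst_comp (p - d) h).
  by rewrite /homog /= key [d + n]addrC addrK => ->.
elim/span_ind: h / (jst_span h) => [|c u w _ _ Pu Pw|h [i [f [ch _]]]].
- by rewrite !(lin0 (jst_linr a), lin0 (@jst_comp_lin _)).
- by rewrite !(jst_linr, jst_comp_lin) Pu Pw.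
apply: sub_val_inj; rewrite /= (jst_comp0E _ ch) (jst_comp0E _ (is_chom_act ha ch)).
by rewrite subr_eq [f + d]addrC; case: ifP.
Qed.

Fact jst_dec : decomposes (fun i => jst_act (lu_one Q i)).
Proof.
apply: (@decomposes_span _ _ _ _ _ (fun j => [set g | jst_act (lu_one Q j) g = g])).
- by move=> j; apply: jst_linr.
- move=> i j g /= <-; rewrite jst_assoc lu_oneM.
  by case: (i == j); rewrite ?(lin0 (jst_linl g)).
move=> g; elim/span_ind: g / (jst_span g) => [|c u w _ _|g [i [d [_ ig]]]].
- exact: ss_0.
- exact: ss_lin.
apply: span_gen; exists i; apply: sub_val_inj; apply/funext => x.
by rewrite /= /jst_act0 -ig.
Qed.

Definition right_adjoint : gmod Q :=
  GMod jst_linl jst_linr jst_assoc jst_homog jst_dec.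
End RightAdjoint.

Record resolution (k : fieldType) (I : choiceType) (A : lualg k I) (V : gmod A) := Resolution {
  res_mod : nat -> gmod A;
  res_d : forall n, gmor (res_mod n.+1) (res_mod n);
  res_aug : gmor (res_mod 0%N) V;
  res_proj : forall n, projective (res_mod n);
  res_surj : forall v, exists x, res_aug x = v;
  res_exact0 : forall x, res_aug x = 0 <-> exists y, res_d 0%N y = x;
  res_exact : forall n x, res_d n x = 0 <-> exists y, res_d n.+1 y = x
}.

Section FreeModule.
Variables (k : fieldType) (I : choiceType) (A : lualg k I) (V : gmod A).
Notation X := (I * int * V)%type.

Definition free_set (f : X -> A) : Prop :=
  (forall x, f x ** lu_one A x.1.1 = f x) /\ exists s : seq X, forall x, x \notin s -> f x = 0.
Fact free_lin (c : k) f g : free_set f -> free_set g -> free_set (c *: f + g).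
Proof.
have E z : (c *: f + g) z = c *: f z + g z by [].
move=> [fr [s s0]] [gr [t t0]]; split=> [x|]; first by rewrite E ga_linl fr gr.
exists (s ++ t) => x; rewrite mem_cat negb_or E => /andP[xs xt].
by rewrite s0 // t0 // scaler0 addr0.
Qed.
Fact free_0 : free_set 0.
Proof. by split=> [x|]; [apply: mul0x | exists [::]]. Qed.
Notation F := (sub_space (Subspace free_lin free_0)).

Fact free_act_subproof (a : A) (f : F) : free_set (fun x => a ** sub_val f x).
Proof.
have [fr [s s0]] : free_set (sub_val f) := subP f.
split=> [x|]; first by rewrite -ga_assoc fr.
by exists s => x /s0 ->; rewrite mulx0.
Qed.
Definition free_act (a : A) (f : F) : F :=
  @mk_sub _ _ (Subspace free_lin free_0) _ (free_act_subproof a f).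
Fact free_comp_subproof d (f : F) : free_set (fun x => ga_gr A (d - x.1.2) (sub_val f x)).
Proof.
have [fr [s s0]] : free_set (sub_val f) := subP f.
split=> [x|]; first by rewrite -comp_idem_r fr.
by exists s => x /s0 ->; rewrite (lin0 (gr_lin _ _)).
Qed.
Definition free_comp (d : int) (f : F) : F :=
  @mk_sub _ _ (Subspace free_lin free_0) _ (free_comp_subproof d f).

Fact free_gen_subproof (x : X) : free_set (fun y => if y == x then lu_one A x.1.1 : A else 0).
Proof.
split=> [y|]; first by case: eqP => [->|_]; rewrite ?gi_idem ?mul0x.
by exists [:: x] => y; rewrite inE => /negPf->.
Qed.
Definition free_gen (x : X) : F :=
  @mk_sub _ _ (Subspace free_lin free_0) _ (free_gen_subproof x).

Fact free_act_linl f : linear (free_act^~ f).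
Proof. by move=> c a b; apply: sub_val_inj; apply/funext => x; rewrite /= ga_linl. Qed.
Fact free_act_linr a : linear (free_act a).
Proof. by move=> c f g; apply: sub_val_inj; apply/funext => x; rewrite /= ga_linr. Qed.
Fact free_assoc a b f : free_act a (free_act b f) = free_act (a ** b) f.
Proof. by apply: sub_val_inj; apply/funext => x; rewrite /= ga_assoc. Qed.
Fact free_comp_lin d : linear (free_comp d).
Proof. by move=> c f g; apply: sub_val_inj; apply/funext => x; rewrite /= gr_lin. Qed.

Lemma free_module_supp (f : F) : exists2 s : seq X, uniq s & forall x, x \notin s -> sub_val f x = 0.
Proof.
have [_ [s s0]] : free_set (sub_val f) := subP f.
by exists (undup s) => [|t]; rewrite ?undup_uniq // mem_undup => /s0.
Qed.

Lemma free_module_sum (f : F) (s : seq X) : uniq s -> (forall x, x \notin s -> sub_val f x = 0) ->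
  f = \sum_(x <- s) free_act (sub_val f x) (free_gen x).
Proof.
have [fr _] : free_set (sub_val f) := subP f.
move=> us s0; apply: sub_val_inj; apply/funext => u.
have sumE (r : seq X) (G : X -> F) :
    sub_val (\sum_(x <- r) G x) u = \sum_(x <- r) sub_val (G x) u.
  by elim: r => [|j r IH]; rewrite ?big_nil // !big_cons -IH.
rewrite sumE; have [us'|us'] := boolP (u \in s); last first.
  rewrite s0 // big1_seq // => t /andP[_ ts] /=.
  by case: eqP us' => [->|_]; rewrite ?mulx0 // ts.
rewrite (bigD1_seq u) //= eqxx fr big1 ?addr0 // => t /negPf.
by rewrite eq_sym => ->; rewrite mulx0.
Qed.

Lemma free_span (f : F) : span [set f | exists a x d,
  homog (ga_gr A) d a /\ f = free_act a (free_gen x)] f.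
Proof.
have [s us s0] := free_module_supp f; rewrite (free_module_sum us s0).
apply: ss_sum => x _; move: (sub_val f x) => a.
elim/span_ind: a / (span_homog (G := ga_gr A) a) => [|c a b _ _ Sa Sb|a [d ha]].
- by rewrite (lin0 (free_act_linl _)); apply: ss_0.
- by rewrite free_act_linl; apply: ss_lin.
by apply: span_gen; exists a, x, d.
Qed.

Fact free_comp_dec : decomposes free_comp.
Proof.
apply: (@decomposes_span _ _ _ _ free_comp_lin
  (fun d => [set f : F | forall x, homog (ga_gr A) (d - x.1.2) (sub_val f x)])).
  move=> i j f hf; apply: sub_val_inj; apply/funext => x /=.
  by rewrite (homogE _ (hf x)) (inj_eq (addIr _)); case: ifP.
move=> f; elim/span_ind: f / (free_span f) => [|c u w _ _|_ [a [x [d [ha ->]]]]].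
- exact: ss_0.
- exact: ss_lin.
apply: span_gen; exists (d + x.1.2) => y.
rewrite -[sub_val _ _]/(a ** (if y == x then lu_one A x.1.1 : A else 0)); case: eqP => [->|_].
  rewrite (_ : _ - _ = d + 0); last by rewrite addr0; exact: addrK.
  exact: ga_homog ha (gi_homog _).
by rewrite mulx0; apply: homog0.
Qed.
Definition free_gr : grading F := Grading free_comp_dec.

Fact free_homog d n a f :
  homog (ga_gr A) d a -> homog free_gr n f -> homog free_gr (d + n) (free_act a f).
Proof.
move=> ha hf; apply: sub_val_inj; apply/funext => x /=.
rewrite (comp_mul_l _ _ ha) -[in RHS](congr1 (fun g : F => sub_val g x) hf) /=.
suff -> : d + n - x.1.2 - d = n - x.1.2 :> int by [].
by rewrite addrAC [d + n]addrC addrK.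
Qed.

Fact free_dec : decomposes (fun i => free_act (lu_one A i)).
Proof.
apply: (@decomposes_span _ _ _ _ _ (fun j => [set f | free_act (lu_one A j) f = f])).
- by move=> j; apply: free_act_linr.
- move=> i j f /= <-; rewrite free_assoc lu_oneM.
  by case: (i == j); rewrite ?(lin0 (free_act_linl f)).
move=> f; elim/span_ind: f / (free_span f) => [|c u w _ _|_ [a [x [d [_ ->]]]]].
- exact: ss_0.
- exact: ss_lin.
elim/span_ind: a / (span_lu a) => [|c a b _ _ Sa Sb|a [n [j [_ ja]]]].
- by rewrite (lin0 (free_act_linl _)); apply: ss_0.
- by rewrite free_act_linl; apply: ss_lin.
by apply: span_gen; exists j; rewrite /= free_assoc ja.
Qed.

(* The direct sum of the modules q^n A 1_i, over all (i, n, v). *)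
Definition free_module : gmod A :=
  GMod free_act_linl free_act_linr free_assoc free_homog free_dec.

Section Extend.
Variables (W : gmod A) (phi : X -> W).
Hypothesis phi_one : forall x, lu_one A x.1.1 **: phi x = phi x.
Hypothesis phi_homog : forall x, homog (gm_gr W) x.1.2 (phi x).

Definition free_extend (f : free_module) : W := \sum_(x \in [set: X]) sub_val f x **: phi x.

Lemma free_extend_lin : linear free_extend.
Proof.
apply: (@fsumT_lin _ _ _ X (fun x (f : F) => sub_val f x **: phi x)) => [x c f g|f].
  by rewrite -gm_linl.
have [s us s0] := free_module_supp f; exists s => // x /s0 ->; exact: lin0 (gm_linl _).
Qed.

Lemma free_extend_act (a : A) f : free_extend (a **: f) = a **: free_extend f.
Proof.
have [s us s0] := free_module_supp f; rewrite /free_extend.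
rewrite !(fsumT_seq us) => [|x /s0 fx|x /s0 fx].
- rewrite (lin_sum (gm_linr a)); apply: eq_bigr => x _.
  by rewrite gm_assoc.
- by rewrite fx (lin0 (gm_linl _)).
by rewrite /= fx mulx0 (lin0 (gm_linl _)).
Qed.

Lemma free_extend_gen x : free_extend (free_gen x) = phi x.
Proof.
rewrite /free_extend (@fsumT_seq _ _ _ [:: x]) // => [|y].
  by rewrite big_seq1 /= eqxx.
by rewrite inE /= => /negPf->; exact: lin0 (gm_linl _).
Qed.

Fact free_extend_ghom : is_ghom 0 free_extend.
Proof.
split=> [||n f hf]; [exact: free_extend_lin | exact: free_extend_act|].
have [s us s0] := free_module_supp f; rewrite /free_extend.
rewrite (fsumT_seq us) => [|x /s0 ->]; last exact: lin0 (gm_linl _).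
apply: homog_sum => x; rewrite addr0 -[n](subrK x.1.2); apply: gm_homog => //.
by have /(congr1 (fun g : F => sub_val g x)) := hf.
Qed.
Definition free_extend_mor : gmor free_module W := GMor free_extend_ghom.
End Extend.

Lemma gmor_lin (U W : gmod A) (f : gmor U W) : linear f.
Proof. by case: (gmorP f). Qed.
Lemma gmor_act (U W : gmod A) (f : gmor U W) (a : A) v : f (a **: v) = a **: f v.
Proof. by case: (gmorP f). Qed.
Lemma gmor_homog (U W : gmod A) (f : gmor U W) n v :
  homog (gm_gr U) n v -> homog (gm_gr W) n (f v).
Proof. by case: (gmorP f) => _ _ hf /hf; rewrite addr0. Qed.
Lemma gmor_comp (U W : gmod A) (f : gmor U W) n v : gm_gr W n (f v) = f (gm_gr U n v).
Proof.
have [s _ ->] := dec_sum (gr_dec (gm_gr U)) v.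
rewrite !(lin_sum (gmor_lin f)) !(lin_sum (gr_lin _ _)) (lin_sum (gmor_lin f)).
apply: eq_bigr => d _; rewrite (homogE _ (gmor_homog f (homog_comp _ d v))).
by rewrite (homogE _ (homog_comp _ d v)); case: ifP; rewrite ?(lin0 (gmor_lin f)).
Qed.

Lemma free_module_projective : projective free_module.
Proof.
move=> U W p f p_surj.
have gen_one x : lu_one A x.1.1 **: (free_gen x : free_module) = free_gen x.
  apply: sub_val_inj; apply/funext => y /=.
  by case: eqP => _; rewrite ?gi_idem ?mulx0.
have gen_homog x : homog (gm_gr free_module) x.1.2 (free_gen x).
  apply: sub_val_inj; apply/funext => y /=; case: eqP => [->|_].
    by rewrite subrr; apply: gi_homog.
  exact: lin0 (gr_lin _ _).
have /choice[phi phiP] : forall x : X, exists u : U,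
    [/\ lu_one A x.1.1 **: u = u, homog (gm_gr U) x.1.2 u & p u = f (free_gen x)].
  move=> x; have [u pu] := p_surj (f (free_gen x)).
  exists (lu_one A x.1.1 **: gm_gr U x.1.2 u); split.
  - by rewrite gm_assoc gi_idem.
  - by rewrite -[x.1.2]add0r; apply: gm_homog; [apply: gi_homog | rewrite add0r; apply: homog_comp].
  by rewrite gmor_act -gmor_comp pu (gmor_homog f (gen_homog x)) -gmor_act gen_one.
have phi1 x : lu_one A x.1.1 **: phi x = phi x by case: (phiP x).
have phih x : homog (gm_gr U) x.1.2 (phi x) by case: (phiP x).
exists (free_extend_mor phih) => h.
have [s us s0] := free_module_supp h; rewrite [h](free_module_sum us s0).
pose g := free_extend_mor phih; rewrite (lin_sum (gmor_lin g)) (lin_sum (gmor_lin p)).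
rewrite (lin_sum (gmor_lin f)); apply: eq_bigr => x _.
rewrite -[free_act _ _]/(sub_val h x **: (free_gen x : free_module)).
rewrite !gmor_act /g /= free_extend_gen //.
by case: (phiP x) => _ _ ->.
Qed.

Fact free_cover_one x : lu_one A x.1.1 **: (lu_one A x.1.1 **: gm_gr V x.1.2 x.2)
  = lu_one A x.1.1 **: gm_gr V x.1.2 x.2.
Proof. by rewrite gm_assoc gi_idem. Qed.
Fact free_cover_homog (x : X) : homog (gm_gr V) x.1.2 (lu_one A x.1.1 **: gm_gr V x.1.2 x.2).
Proof. by rewrite -[x.1.2]add0r; apply: gm_homog; [apply: gi_homog | rewrite add0r; apply: homog_comp]. Qed.
Definition free_cover : gmor free_module V := free_extend_mor free_cover_homog.

Lemma free_cover_surj v : exists f, free_cover f = v.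
Proof.
have [s us ->] := dec_sum (gr_dec (gm_gr V)) v.
have /choice[F0 F0P] : forall n, exists f, free_cover f = gm_gr V n v.
  move=> n; have [t ut tv] := dec_sum (gm_dec V) (gm_gr V n v).
  exists (\sum_(i <- t) free_gen (i, n, v)).
  rewrite (lin_sum (gmor_lin free_cover)) [RHS]tv; apply: eq_bigr => i _.
  exact: free_extend_gen free_cover_one (i, n, v).
exists (\sum_(n <- s) F0 n); rewrite (lin_sum (gmor_lin free_cover)).
by apply: eq_bigr => n _; apply: F0P.
Qed.
End FreeModule.

Section ResolutionExists.
Variables (k : fieldType) (I : choiceType) (A : lualg k I).

Section Kernel.
Variables (U W : gmod A) (f : gmor U W).
Fact ker_lin (c : k) u v : f u = 0 -> f v = 0 -> f (c *: u + v) = 0.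
Proof. by move=> fu fv; rewrite gmor_lin fu fv scaler0 addr0. Qed.
Fact ker_act (a : A) u : f u = 0 -> f (a **: u) = 0.
Proof. by move=> fu; rewrite gmor_act fu (lin0 (gm_linr a)). Qed.
Fact ker_comp d u : f u = 0 -> f (gm_gr U d u) = 0.
Proof. by move=> fu; rewrite -gmor_comp fu (lin0 (gr_lin _ _)). Qed.
Definition gker : gsub U :=
  @GSub _ _ _ U (@Subspace _ _ (fun u => f u = 0) ker_lin (lin0 (gmor_lin f))) ker_act ker_comp.
Lemma ker_val (u : sub_gmod gker) : f (sub_val u) = 0.
Proof. exact: (subP u). Qed.
End Kernel.

Variable V : gmod A.

Fixpoint syzygy (n : nat) : gmod A :=
  if n is m.+1 then sub_gmod (gker (free_cover (syzygy m))) else V.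

Fact syzygy_d_ghom n : is_ghom 0 (fun x : free_module (syzygy n.+1) =>
  sub_val (free_cover (syzygy n.+1) x) : free_module (syzygy n)).
Proof.
split=> [c u v|a v|m v hv]; rewrite ?gmor_lin ?gmor_act //.
have := gmor_homog (free_cover (syzygy n.+1)) hv.
by rewrite addr0 => /(congr1 (@sub_val _ _ _)).
Qed.

Lemma resolution_exists : inhabited (resolution V).
Proof.
constructor; apply: (@Resolution _ _ _ _ (fun n => free_module (syzygy n))
  (fun n => GMor (syzygy_d_ghom n)) (free_cover V)).
- by move=> n; apply: free_module_projective.
- exact: free_cover_surj.
- move=> x; split=> [x0|[y <-]]; last exact: (ker_val (free_cover (syzygy 1) y)).
  have [y yx] := free_cover_surj (@mk_sub _ _ (gker (free_cover V)) x x0 : syzygy 1).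
  exists y; exact: (congr1 (fun z : sub_space (gker (free_cover V)) => sub_val z) yx).
move=> n x; split=> [x0|[y <-]].
  have x1 : free_cover (syzygy n.+1) x = 0 by apply: sub_val_inj.
  have [y yx] := free_cover_surj (@mk_sub _ _ (gker (free_cover (syzygy n.+1))) x x1 : syzygy n.+2).
  exists y; exact: (congr1 (fun z : sub_space (gker (free_cover (syzygy n.+1))) => sub_val z) yx).
have z := ker_val (f := free_cover (syzygy n.+1)) (free_cover (syzygy n.+2) y).
exact: (congr1 (fun u : sub_space (gker (free_cover (syzygy n))) => sub_val u) z).
Qed.
End ResolutionExists.

Section HomSpace.
Variables (k : fieldType) (I : choiceType) (A : lualg k I) (V W : gmod A).

Fact hom_lin (c : k) (f g : V -> W) : is_ghom 0 f -> is_ghom 0 g -> is_ghom 0 (c *: f + g).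
Proof.
have E z : (c *: f + g) z = c *: f z + g z by [].
move=> [lf af hf] [lg ag hg]; split=> [a u v|a v|n v hv].
- by rewrite !E lf lg !scalerDr !scalerA mulrC addrACA.
- by rewrite !E af ag gm_linr.
by rewrite E; apply: homog_lin; [apply: hf | apply: hg].
Qed.
Fact hom_0 : is_ghom 0 (0 : V -> W).
Proof.
split=> [a u v|a v|n v _]; [by rewrite scaler0 addr0| |exact: homog0].
by rewrite (lin0 (gm_linr a)).
Qed.
Definition hom_ss : subspace (V -> W) := Subspace hom_lin hom_0.
End HomSpace.

(* Ext^n_(A-gmod)(V,W), as the n-th cohomology of the complex of morphisms from
   the projective resolution R of V to W. *)
Section Ext.
Variables (k : fieldType) (I : choiceType) (A : lualg k I) (V : gmod A) (R : resolution V).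
Variables (W : gmod A) (n : nat).
Notation H := (sub_space (hom_ss (res_mod R n) W)).

Fact cocycle_lin (c : k) (f g : H) :
  (forall x, sub_val f (res_d R n x) = 0) -> (forall x, sub_val g (res_d R n x) = 0) ->
  forall x, sub_val (c *: f + g) (res_d R n x) = 0.
Proof.
move=> hf hg x.
have -> : sub_val (c *: f + g) (res_d R n x)
  = c *: sub_val f (res_d R n x) + sub_val g (res_d R n x) by [].
by rewrite hf hg scaler0 addr0.
Qed.
Definition cocycles : subspace H :=
  @Subspace _ _ (fun f : H => forall x, sub_val f (res_d R n x) = 0) cocycle_lin (fun=> erefl).

Definition is_coboundary : (res_mod R n -> W) -> Prop :=
  match n return (res_mod R n -> W) -> Prop with
  | 0%N => fun f => forall x, f x = 0
  | m.+1 => fun f => exists g : gmor (res_mod R m) W, forall x, f x = g (res_d R m x)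
  end.

Fact coboundary_lin (c : k) (f g : sub_space cocycles) :
  is_coboundary (sub_val (sub_val f)) -> is_coboundary (sub_val (sub_val g)) ->
  is_coboundary (sub_val (sub_val (c *: f + g))).
Proof.
have -> : sub_val (sub_val (c *: f + g)) = c *: sub_val (sub_val f) + sub_val (sub_val g) by [].
move: (sub_val (sub_val f)) (sub_val (sub_val g)); rewrite /is_coboundary.
case: n => [|m] u v; first by move=> hu hv x; rewrite /= -[LHS]/(c *: u x + v x) hu hv scaler0 addr0.
move=> [u' hu] [v' hv]; exists (GMor (hom_lin c (gmorP u') (gmorP v'))) => x.
by rewrite -[LHS]/(c *: u x + v x) hu hv.
Qed.
Fact coboundary_0 : is_coboundary (sub_val (sub_val (0 : sub_space cocycles))).
Proof.
have -> : sub_val (sub_val (0 : sub_space cocycles)) = 0 by [].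
rewrite /is_coboundary; case: n => [//|m].
by exists (GMor (hom_0 _ _)).
Qed.
Definition coboundaries : subspace (sub_space cocycles) :=
  @Subspace _ _ (fun f : sub_space cocycles => is_coboundary (sub_val (sub_val f)))
    coboundary_lin coboundary_0.

Definition Ext_gmod : lmodType k := quot_space coboundaries.
End Ext.

(* Ext^n_A(V,W) = (+)_d Ext^n_(A-gmod)(q^d V, W) vanishes iff all summands do; each
   summand is computed by an arbitrary projective resolution of q^d V (there is
   one by [resolution_exists]). *)
Definition Ext_vanishes (k : fieldType) (I : choiceType) (A : lualg k I) (n : nat)
    (V W : gmod A) : Prop :=
  forall (d : int) (R : resolution (shift d V)) (x : Ext_gmod R W n), x = 0.

Section Stratification.
Variables (k : fieldType) (I : choiceType) (A : lualg k I).
Variables (disp : Order.disp_t) (L : porderType disp) (w : L -> gidem A) (l : L).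

Definition strat_ideal : hideal A :=
  gen_ideal [set e | exists m, ~~ (l <= m)%O /\ e = w m].

(* The quotient A_(>= l); its idempotent truncation by the image of w l is the
   algebra [stratum] below. *)
Definition upper_quot : lualg k I := quot_lualg strat_ideal.
Definition upper_idem : gidem upper_quot := quot_idem strat_ideal (w l).

Definition stratum : lualg k unit := corner upper_idem.

Definition standardize (V : gmod stratum) : gmod A := inflation (left_adjoint V).
Definition costandardize (V : gmod stratum) : gmod A := inflation (right_adjoint V).

Definition standard : gmod A := inflation (left_module upper_idem).
End Stratification.

Definition is_basis (k : fieldType) (V : lmodType k) (J : eqType) (T : set J) (v : J -> V) : Prop :=
  (forall x : V, exists (s : seq J) (c : J -> k),
     (forall j, j \in s -> T j) /\ x = \sum_(j <- s) c j *: v j) /\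
  (forall (s : seq J) (c : J -> k), uniq s -> (forall j, j \in s -> T j) ->
     \sum_(j <- s) c j *: v j = 0 -> forall j, j \in s -> c j = 0).

(* The special indices, a subset S of I given by its inclusion map, with their
   weights in a lower finite poset. *)
Record weights (I : choiceType) (disp : Order.disp_t) (L : porderType disp) := Weights {
  ws_S : choiceType;
  ws_inc : ws_S -> I;
  ws_wt : ws_S -> L;
  ws_inj : injective ws_inc;
  ws_fib : forall l, finite_set [set s | ws_wt s = l];
  ws_low : forall l : L, finite_set [set m | (m <= l)%O]
}.

Section WeightIdempotents.
Variables (k : fieldType) (I : choiceType) (A : lualg k I).
Variables (disp : Order.disp_t) (L : porderType disp) (D : weights I L) (l : L).

Definition weight_sum : A := \sum_(s \in [set s : ws_S D | ws_wt s = l]) (lu_one A (ws_inc s) : A).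

Fact weight_sum_idem : weight_sum ** weight_sum = weight_sum.
Proof.
rewrite /weight_sum (lin_sum (@ga_linr _ A _)); apply: eq_big_seq => s sP.
set r := finite_support _ _ _ in sP *.
have ur : uniq r by apply: finite_support_uniq.
have lin := lin_sum (@ga_linl _ A (lu_one A (ws_inc s))).
rewrite lin (bigD1_seq s) //= gi_idem big1 ?addr0 // => t ts.
by rewrite lu_orth // (inj_eq (@ws_inj _ _ _ D)).
Qed.
Fact weight_sum_homog : homog (ga_gr A) 0 weight_sum.
Proof. by apply: homog_sum => s; apply: gi_homog. Qed.

Definition weight_idem : gidem A := GIdem weight_sum_idem weight_sum_homog.
End WeightIdempotents.

Section TriangularBasis.
Variables (k : fieldType) (I : choiceType) (A : lualg k I).
Variables (disp : Order.disp_t) (L : porderType disp) (D : weights I L).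
Notation S := (ws_S D).
Notation inc := (@ws_inc _ _ _ D).
Notation wt := (@ws_wt _ _ _ D).
Notation one := (lu_one A).

Definition homog_in (i j : I) (x : A) : Prop :=
  one i ** x ** one j = x /\ exists d, homog (ga_gr A) d x.

Record triangular_basis := TriangularBasis {
  tb_X : I -> S -> set A;
  tb_H : S -> S -> set A;
  tb_Y : S -> I -> set A;
  tb_X_homog : forall i s x, tb_X i s x -> homog_in i (inc s) x;
  tb_H_homog : forall s t h, tb_H s t h -> homog_in (inc s) (inc t) h;
  tb_Y_homog : forall t j y, tb_Y t j y -> homog_in (inc t) j y;
  tb_basis : is_basis
    [set p : (A * A * A)%type | exists i s t j,
       [/\ tb_X i s p.1.1, tb_H s t p.1.2 & tb_Y t j p.2]]
    (fun p => p.1.1 ** p.1.2 ** p.2);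
  tb_X_diag : forall s, tb_X (inc s) s = [set (one (inc s) : A)];
  tb_Y_diag : forall s, tb_Y s (inc s) = [set (one (inc s) : A)];
  tb_X_tri : forall s t, s != t -> tb_X (inc s) t !=set0 -> (wt t < wt s)%O;
  tb_H_tri : forall s t, s != t -> tb_H s t !=set0 -> wt s = wt t;
  tb_Y_tri : forall s t, s != t -> tb_Y s (inc t) !=set0 -> (wt s < wt t)%O;
  tb_X_fin : forall i, (forall s, inc s != i) -> finite_set [set s | tb_X i s !=set0];
  tb_Y_fin : forall i, (forall s, inc s != i) -> finite_set [set s | tb_Y s i !=set0]
}.
End TriangularBasis.

Section GradedLocal.
Variables (k : fieldType) (C : lualg k unit).

Record left_gideal := LeftGIdeal {
  lg_ss :> subspace C;
  lg_l : forall a x, lg_ss x -> lg_ss (a ** x);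
  lg_comp : forall d x, lg_ss x -> lg_ss (ga_gr C d x)
}.

Definition maximal_left_gideal (M : left_gideal) : Prop :=
  (exists x, ~ M x) /\ forall U : left_gideal, (forall x, M x -> U x) ->
    (forall x, U x -> M x) \/ (forall x, U x).

Definition graded_jacobson (x : C) : Prop :=
  forall M : left_gideal, maximal_left_gideal M -> M x.

(* The quotient of C by its graded Jacobson radical is the ground field. *)
Definition graded_local : Prop :=
  ~ graded_jacobson (lu_one C tt) /\
  forall x : C, exists c : k, graded_jacobson (x - c *: (lu_one C tt : C)).
End GradedLocal.

(* A labelling by B of the irreducible graded C-modules up to isomorphism and
   degree shift. *)
Record irr_labelling (k : fieldType) (C : lualg k unit) (B : Type) := IrrLabelling {
  irr_mod :> B -> gmod C;
  irr_irr : forall b, irreducible (irr_mod b);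
  irr_inj : forall b c n, giso (shift n (irr_mod b)) (irr_mod c) -> b = c;
  irr_all : forall V : gmod C, irreducible V -> exists b n, giso V (shift n (irr_mod b))
}.

Fact id_weights_low (disp : Order.disp_t) (B : finPOrderType disp) (b : B) :
  finite_set [set c : B | (c <= b)%O].
Proof. exact: finite_finset. Qed.
Fact id_weights_fib (disp : Order.disp_t) (B : finPOrderType disp) (b : B) :
  finite_set [set c : B | c = b].
Proof. exact: finite_finset. Qed.

Definition id_weights (K : choiceType) (disp : Order.disp_t) (B : finPOrderType disp)
    (inc : B -> K) (inj_inc : injective inc) : weights K B :=
  @Weights K disp B B inc id inj_inc (@id_weights_fib disp B) (@id_weights_low disp B).

Record based_affine_qh (k : fieldType) (C : lualg k unit) (disp : Order.disp_t)
    (B : finPOrderType disp) (irr : irr_labelling C B) := BasedAffineQH {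
  qh_K : choiceType;
  qh_ref : refinement C qh_K;
  qh_inc : B -> qh_K;
  qh_inj : injective qh_inc;
  qh_basis : triangular_basis (refined qh_ref) (id_weights qh_inj);
  qh_idem := fun b => lu_one (refined qh_ref) (qh_inc b);
  qh_local : forall b, graded_local (stratum qh_idem b);
  qh_irr : forall b, giso (irr b) (gmod_head (unrefine (standard qh_idem b)))
}.

Section Layers.
Variables (k : fieldType) (C : lualg k unit) (disp : Order.disp_t) (B : finPOrderType disp).
Variables (irr : irr_labelling C B) (Q : based_affine_qh irr) (b : B) (V : gmod C).
Notation Cb := (stratum (qh_idem Q) b).

(* The prefix b stands for the bar in \bar\Delta and \bar\nabla. *)
Definition Delta_layer : Prop := exists P : gmod Cb,
  [/\ projective P, locally_findim P, bounded_below P & giso V (unrefine (standardize P))].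
Definition bDelta_layer : Prop := exists M : gmod Cb,
  [/\ locally_findim M, bounded_below M & giso V (unrefine (standardize M))].
Definition nabla_layer : Prop := exists E : gmod Cb,
  [/\ injective_gmod E, locally_findim E, bounded_above E & giso V (unrefine (costandardize E))].
Definition bnabla_layer : Prop := exists M : gmod Cb,
  [/\ locally_findim M, bounded_above M & giso V (unrefine (costandardize M))].
End Layers.

(* A finite filtration 0 = F_0 <= ... <= F_n = V with sections layers of pairwise
   distinct types. *)
Definition has_flag (k : fieldType) (I : choiceType) (A : lualg k I) (B : Type)
    (layer : B -> gmod A -> Prop) (V : gmod A) : Prop :=
  exists (n : nat) (F : nat -> gsub V) (b : 'I_n -> B),
  [/\ injective b, forall v, F 0%N v -> v = 0, forall v, F n v
    & forall i : 'I_n, (forall v, F i v -> F i.+1 v) /\ layer (b i) (subquotient (F i.+1) (F i))].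

Section PureFlags.
Variables (k : fieldType) (I : choiceType) (A : lualg k I).
Variables (disp : Order.disp_t) (L : porderType disp) (D : weights I L).

Definition weight_algebra (l : L) : lualg k unit := stratum (weight_idem A D) l.

Variables (disp' : Order.disp_t) (B : L -> finPOrderType disp').
Variables (irr : forall l, irr_labelling (weight_algebra l) (B l)).
Variables (Q : forall l, based_affine_qh (irr l)).
Notation BB := {l : L & B l}.

Definition pure_Delta_layer (b : BB) (V : gmod A) : Prop :=
  exists2 M : gmod (weight_algebra (tag b)), Delta_layer (Q (tag b)) (tagged b) M &
    giso V (standardize M).
Definition pure_bDelta_layer (b : BB) (V : gmod A) : Prop :=
  exists2 M : gmod (weight_algebra (tag b)), bDelta_layer (Q (tag b)) (tagged b) M &
    giso V (standardize M).
Definition pure_nabla_layer (b : BB) (V : gmod A) : Prop :=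
  exists2 M : gmod (weight_algebra (tag b)), nabla_layer (Q (tag b)) (tagged b) M &
    giso V (costandardize M).
Definition pure_bnabla_layer (b : BB) (V : gmod A) : Prop :=
  exists2 M : gmod (weight_algebra (tag b)), bnabla_layer (Q (tag b)) (tagged b) M &
    giso V (costandardize M).

Definition pure_Delta_flag : gmod A -> Prop := has_flag pure_Delta_layer.
Definition pure_bDelta_flag : gmod A -> Prop := has_flag pure_bDelta_layer.
Definition pure_nabla_flag : gmod A -> Prop := has_flag pure_nabla_layer.
Definition pure_bnabla_flag : gmod A -> Prop := has_flag pure_bnabla_layer.
End PureFlags.

(* Main.v *)
From mathcomp Require Import all_boot all_order all_algebra.
From mathcomp Require Import boolp classical_sets functions cardinality fsbigop.
Require Import Defs.

(** Let J_m be the ideal of A generated by the idempotents e_r with r not above m.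
    Truncation in weight m sends V to F_m V = e_m (V / J_m V), a module over the
    weight algebra A_m = e_m (A / J_m) e_m; it is left adjoint to costandardization
    ([trunc], [adj_flat], [adj_sharp]). Because e_m (A / J_m) is free over A_m on
    the part Y of the basis, costandardization preserves surjections
    ([coind_surj]), so F_m preserves projectives ([trunc_projective]). Hence
    whenever F_m keeps a projective resolution of V exact, Ext over A from V to
    the costandardization of Z is Ext over A_m from F_m V to Z
    ([ext_vanish_costandardize]).

    Exactness is controlled by the part X of the basis. Call V independent if, for
    each weight m, the subspaces x V with x in X of weight m are in direct sum
    modulo J_m V, up to the obvious relations ([upper_independent]). The filtration
    of an independent module by finite lower sets of weights then has sections
    that are sums of copies of its truncations. Removing maximal weights one at a
    time ([weight_part_kernel]), one sees that along an exact complex of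
    independent modules exactness of the truncations at one place implies
    exactness at the next ([strat_exact_step]); it holds at the start by right
    exactness. Projectives are independent, standardizations are independent, and
    so are extensions of independent modules; moreover F_m of a standardization
    from A_l is the given module if l = m and zero otherwise ([trunc_ind],
    [trunc_ind_other]).

    All of this is used twice, for A and for each A_l with its own triangular basis.
    Starting from a class of modules over the Cartan algebras that is closed under
    extensions, [lift_class] produces such a class over A_l and then over A, which
    contains every V with a flag of the corresponding kind; the class at the
    bottom consists of the projectives in situation (1) and of all modules in
    situation (2). For a layer W, the two adjunctions identify Ext from V to W
    with Ext over a Cartan algebra from P to M, where P is projective in
    situation (1) and M is injective in situation (2). Modules W with a flag are
    reached by extensions ([ext_vanish_closed]). *)

Set Implicit Arguments.
Unset Strict Implicit.
Unset Printing Implicit Defensive.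

Import Order.TTheory GRing.Theory.
Local Open Scope classical_set_scope.
Local Open Scope ring_scope.

(** * Linear maps out of a basis, and triangular bases modulo an ideal of weights *)

Lemma span_map (k : fieldType) (V W : lmodType k) (f : V -> W) (E : set V) (U : subspace W) :
  linear f -> (forall e, E e -> U (f e)) -> forall v, span E v -> U (f v).
Proof.
move=> lf EE v; elim/span_ind=> [|c u u' _ _ Su Su'|e /EE //].
  by rewrite lin0 //; apply: ss_0.
by rewrite lf; apply: ss_lin.
Qed.

Lemma span_in (k : fieldType) (V : lmodType k) (E : set V) (U : subspace V) :
  (forall e, E e -> U e) -> forall v, span E v -> U v.
Proof. by move=> EU v; apply. Qed.

Lemma lin_eq_span (k : fieldType) (V W : lmodType k) (f g : V -> W) (E : set V) :
  linear f -> linear g -> (forall e, E e -> f e = g e) ->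
  forall v, span E v -> f v = g v.
Proof.
move=> lf lg fg v; elim/span_ind=> [|c u u' _ _ fu fu'|e /fg //].
  by rewrite !lin0.
by rewrite lf lg fu fu'.
Qed.

Lemma lin_comp (k : fieldType) (U V W : lmodType k) (g : V -> W) (f : U -> V) :
  linear g -> linear f -> linear (fun u => g (f u)).
Proof. by move=> lg lf c u v; rewrite lf lg. Qed.

Lemma lin_zero (k : fieldType) (V W : lmodType k) : linear (fun _ : V => 0 : W).
Proof. by move=> c u v; rewrite scaler0 addr0. Qed.

Section BasisExtension.
Variables (k : fieldType) (V W : lmodType k) (J : eqType) (T : set J) (v : J -> V).
Hypothesis v_basis : is_basis T v.
Variable phi : J -> W.

Let comb (Z : lmodType k) (z : J -> Z) (l : seq (J * k)) := \sum_(p <- l) p.2 *: z p.1.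

(** A vector is presented by a list that may repeat indices, while independence
    concerns duplicate-free lists; gathering equal indices bridges the two. *)
Lemma comb_gather (Z : lmodType k) (z : J -> Z) (l : seq (J * k)) :
  comb z l = \sum_(j <- undup [seq p.1 | p <- l])
    (\sum_(p <- l) if p.1 == j then p.2 else 0) *: z j.
Proof.
under [RHS]eq_bigr do rewrite scaler_suml.
rewrite exchange_big /comb; apply: eq_big_seq => p pl.
rewrite (bigD1_seq p.1) ?undup_uniq ?mem_undup ?map_f //= eqxx big1 ?addr0 // => j.
by rewrite eq_sym => /negPf->; rewrite scale0r.
Qed.

Lemma comb_eq0 (l : seq (J * k)) : (forall p, p \in l -> T p.1) -> comb v l = 0 -> comb phi l = 0.
Proof.
move=> lT; rewrite !comb_gather => l0; have [_ free] := v_basis.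
rewrite big1_seq // => j /andP[_ jl]; rewrite (free _ _ _ _ l0) ?scale0r ?undup_uniq //.
by move=> {jl}j; rewrite mem_undup => /mapP[p pl ->]; apply: lT.
Qed.

Lemma basis_ext : exists2 f : V -> W, linear f & forall j, T j -> f (v j) = phi j.
Proof.
(* The extension is defined by its graph, so that the presentations of the
   vectors need not be chosen coherently. *)
pose G x y := exists l : seq (J * k), [/\ forall p, p \in l -> T p.1, x = comb v l & y = comb phi l].
have combZ (Z : lmodType k) (z : J -> Z) c l : comb z [seq (p.1, c * p.2) | p <- l] = c *: comb z l.
  by rewrite /comb big_map scaler_sumr; apply: eq_bigr => p _; rewrite scalerA.
have G_lin c x y x' y' : G x y -> G x' y' -> G (c *: x + x') (c *: y + y').
  move=> [l [lT -> ->]] [l' [lT' -> ->]]; exists ([seq (p.1, c * p.2) | p <- l] ++ l').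
  split=> [p| |]; try by rewrite -combZ /comb big_cat.
  by rewrite mem_cat => /orP[/mapP[q ql ->]|]; [exact: lT ql | exact: lT'].
have G0 y : G 0 y -> y = 0 by move=> [l [lT l0 ->]]; apply: comb_eq0.
have G_fun x y y' : G x y -> G x y' -> y = y'.
  move=> /(G_lin (-1) _ _ _ _) Gx /Gx; rewrite !scaleN1r addNr => /G0 /eqP.
  by rewrite addrC subr_eq0 => /eqP.
have /choice[f fP] : forall x, exists y, G x y.
  move=> x; have [gen _] := v_basis; have [s [c [sT ->]]] := gen x.
  exists (comb phi [seq (j, c j) | j <- s]), [seq (j, c j) | j <- s].
  by split=> // [p /mapP[j js ->]|]; [apply: sT | rewrite /comb big_map].
exists f => [c x y|j Tj]; first exact: G_fun (fP _) (G_lin _ _ _ _ _ (fP _) (fP _)).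
apply: G_fun (fP _) _; exists [:: (j, 1)]; rewrite /comb !big_seq1 !scale1r.
by split=> // p; rewrite inE => /eqP->.
Qed.
End BasisExtension.

Lemma lower_finite_ind (disp : Order.disp_t) (L : porderType disp) (P : L -> Prop) :
  (forall l : L, finite_set [set m | (m <= l)%O]) ->
  (forall l, (forall m, (m < l)%O -> P m) -> P l) -> forall l, P l.
Proof.
move=> low IH l; have /finite_seqP[r rP] := low l.
have : forall m, (m < l)%O -> m \in r.
  by move=> m /ltW ml; have : [set m | (m <= l)%O] m by []; rewrite rP.
move: {2}(size r) (leqnn (size r)) => n; elim: n l r {rP} => [|n IHn] l r.
  by rewrite leqn0 => /nilP-> l0; apply: IH => m /l0.
move=> rn lr; apply: IH => m ml; apply: (IHn m (rem m r)).
  by rewrite size_rem ?lr // -ltnS prednK //; have := lr m ml; case: (r).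
move=> m' m'm; have := lr m' (lt_trans m'm ml).
by rewrite (perm_mem (perm_to_rem (lr m ml))) inE (lt_eqF m'm).
Qed.

Section Triangular.
Variables (k : fieldType) (I : choiceType) (A : lualg k I).
Variables (disp : Order.disp_t) (L : porderType disp) (D : weights I L).
Variables (T : triangular_basis A D) (w : L -> gidem A).
Hypothesis w_sum : forall l, gi_val (w l) = weight_sum A D l.
Notation S := (ws_S D).
Notation inc := (@ws_inc _ _ _ D).
Notation wt := (@ws_wt _ _ _ D).
Notation one i := (gi_val (lu_one A i)).
Notation X := (tb_X T).
Notation H := (tb_H T).
Notation Y := (tb_Y T).
Notation J m := (strat_ideal w m).

Lemma w_expand l : exists r : seq S,
  [/\ uniq r, forall s, (s \in r) = (wt s == l) & w l = \sum_(s <- r) one (inc s) :> A].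
Proof.
have /finite_seqP[r rP] := ws_fib D l; exists (undup r).
have memr s : (s \in undup r) = (wt s == l).
  rewrite mem_undup; apply/idP/eqP => [sr|sl].
    by have : [set` r] s by []; rewrite -rP.
  by have : [set s | wt s = l] s by []; rewrite rP.
split; rewrite ?undup_uniq // w_sum /weight_sum.
have -> : [set s | wt s = l] = [set` undup r].
  by apply/seteqP; split=> s /=; rewrite memr => /eqP.
by rewrite -fsbig_seq ?undup_uniq.
Qed.

Lemma w_one l s : w l ** one (inc s) = if wt s == l then one (inc s) else 0.
Proof.
have [r [ur memr ->]] := w_expand l; rewrite (lin_sum (@ga_linl _ A _)) -memr.
case: ifP => sr; last first.
  rewrite big1_seq // => t /andP[_ tr]; rewrite lu_oneM (inj_eq (@ws_inj _ _ _ D)).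
  by case: eqP tr => // ->; rewrite sr.
rewrite (bigD1_seq s) //= gi_idem big1 ?addr0 // => t ts.
by rewrite lu_orth // (inj_eq (@ws_inj _ _ _ D)).
Qed.

Lemma one_w l s : one (inc s) ** w l = if wt s == l then one (inc s) else 0.
Proof.
have [r [ur memr ->]] := w_expand l; rewrite (lin_sum (@ga_linr _ A _)) -memr.
case: ifP => sr; last first.
  rewrite big1_seq // => t /andP[_ tr]; rewrite lu_oneM (inj_eq (@ws_inj _ _ _ D)).
  by case: eqP tr => // <-; rewrite sr.
rewrite (bigD1_seq s) //= gi_idem big1 ?addr0 // => t ts.
by rewrite lu_orth // (inj_eq (@ws_inj _ _ _ D)) eq_sym.
Qed.

Lemma J_w m l : ~~ (m <= l)%O -> J m (w l).
Proof. by move=> ml I' _ _; apply; exists l. Qed.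

Lemma J_one m s : ~~ (m <= wt s)%O -> J m (one (inc s)).
Proof. by move=> ms; have := one_w (wt s) s; rewrite eqxx => <-; apply/hi_l/J_w. Qed.

Lemma J_gen m a : J m a ->
  span [set x | exists s b c, ~~ (m <= wt s)%O /\ x = b ** one (inc s) ** c] a.
Proof.
move=> Ja; apply: (Ja (span _)) => [b x|b x|_ [l [ml ->]]].
- apply: (span_map (f := ga_mul b)); first exact: ga_linr.
  by move=> _ [s [c [d [ms ->]]]]; apply: span_gen; exists s, (b ** c), d; rewrite !ga_assoc.
- apply: (span_map (f := fun u => u ** b)); first exact: ga_linl.
  by move=> _ [s [c [d [ms ->]]]]; apply: span_gen; exists s, c, (d ** b); rewrite !ga_assoc.
have [r [_ memr ->]] := w_expand l; apply: ss_sum => s; rewrite memr => /eqP sl.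
by apply: span_gen; exists s, (one (inc s)), (one (inc s)); rewrite sl !gi_idem.
Qed.

Lemma X_l i s x : X i s x -> one i ** x = x.
Proof. by case/tb_X_homog=> <- _; rewrite !ga_assoc gi_idem. Qed.
Lemma X_r i s x : X i s x -> x ** one (inc s) = x.
Proof. by case/tb_X_homog=> <- _; rewrite -!ga_assoc gi_idem. Qed.
Lemma H_l s t h : H s t h -> one (inc s) ** h = h.
Proof. by case/tb_H_homog=> <- _; rewrite !ga_assoc gi_idem. Qed.
Lemma H_r s t h : H s t h -> h ** one (inc t) = h.
Proof. by case/tb_H_homog=> <- _; rewrite -!ga_assoc gi_idem. Qed.
Lemma Y_l t j y : Y t j y -> one (inc t) ** y = y.
Proof. by case/tb_Y_homog=> <- _; rewrite !ga_assoc gi_idem. Qed.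
Lemma Y_r t j y : Y t j y -> y ** one j = y.
Proof. by case/tb_Y_homog=> <- _; rewrite -!ga_assoc gi_idem. Qed.
Lemma H_wt s t h : H s t h -> wt s = wt t.
Proof. by case: (eqVneq s t) => [->|st] // hh; apply: (@tb_H_tri _ _ _ _ _ _ T _ _ st); exists h. Qed.

Variant X_spec s t x : Prop :=
  | XDiag of s = t & x = one (inc s)
  | XLow of (wt t < wt s)%O.
Lemma XP s t x : X (inc s) t x -> X_spec s t x.
Proof.
case: (eqVneq s t) => [->|st] xx; last by apply: XLow; apply: (@tb_X_tri _ _ _ _ _ _ T _ _ st); exists x.
by apply: XDiag => //; move: xx; rewrite tb_X_diag.
Qed.
Variant Y_spec s t y : Prop :=
  | YDiag of s = t & y = one (inc t)
  | YLow of (wt s < wt t)%O.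
Lemma YP s t y : Y s (inc t) y -> Y_spec s t y.
Proof.
case: (eqVneq s t) => [->|st] yy; last by apply: YLow; apply: (@tb_Y_tri _ _ _ _ _ _ T _ _ st); exists y.
by apply: YDiag => //; move: yy; rewrite tb_Y_diag.
Qed.

Definition tri (P : I -> S -> I -> Prop) : set A := [set a | exists i s t j x h y,
  [/\ P i s j, X i s x, H s t h, Y t j y & a = x ** h ** y]].

Lemma tri_all a : span (tri (fun _ _ _ => True)) a.
Proof.
have [gen _] := tb_basis T; have [r [c [rT ->]]] := gen a.
apply: ss_sum => p /rT [i [s [t [j [Xx Hh Yy]]]]]; apply/ssZ/span_gen.
by exists i, s, t, j, p.1.1, p.1.2, p.2.
Qed.
Lemma tri_l P i a : span (tri P) a -> span (tri (fun i' s j => P i' s j /\ i' = i)) (one i ** a).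
Proof.
apply: (span_map (f := ga_mul (one i))); first exact: ga_linr.
move=> _ [i' [s [t [j [x [h [y [Pi Xx Hh Yy ->]]]]]]]]; rewrite !ga_assoc -{1}(X_l Xx) ga_assoc lu_oneM.
case: eqP => [ii'|_]; last by rewrite !mul0x; apply: ss_0.
by rewrite (X_l Xx); apply: span_gen; exists i', s, t, j, x, h, y.
Qed.
Lemma tri_r P j a : span (tri P) a -> span (tri (fun i s j' => P i s j' /\ j' = j)) (a ** one j).
Proof.
apply: (span_map (f := fun u => u ** one j)); first exact: ga_linl.
move=> _ [i [s [t [j' [x [h [y [Pi Xx Hh Yy ->]]]]]]]]; rewrite -!ga_assoc -{1}(Y_r Yy) -ga_assoc lu_oneM.
case: eqP => [jj'|_]; last by rewrite !mulx0; apply: ss_0.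
by rewrite -jj' (Y_r Yy); apply: span_gen; exists i, s, t, j', x, h, y; rewrite !ga_assoc.
Qed.
Lemma tri_from i a : one i ** a = a -> span (tri (fun i' _ _ => i' = i)) a.
Proof.
move=> <-; move: (@tri_l _ i _ (tri_all a)); apply: span_in => _ [i' [s [t [j [x [h [y [[_ Pi] Xx Hh Yy ->]]]]]]]].
by apply: span_gen; exists i', s, t, j, x, h, y.
Qed.
Lemma tri_to j a : a ** one j = a -> span (tri (fun _ _ j' => j' = j)) a.
Proof.
move=> <-; move: (@tri_r _ j _ (tri_all a)); apply: span_in => _ [i [s [t [j' [x [h [y [[_ Pi] Xx Hh Yy ->]]]]]]]].
by apply: span_gen; exists i, s, t, j', x, h, y.
Qed.

(** Expand b 1_s, and then what stands to the right of the resulting factor in X: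
    each expansion either passes through an idempotent of smaller weight, to which
    induction applies, or has a trivial factor in Y, respectively X, and leaves the
    weight of s unchanged. *)
Lemma tri_ideal m s b c : ~~ (m <= wt s)%O ->
  span (tri (fun _ t _ => ~~ (m <= wt t)%O)) (b ** one (inc s) ** c).
Proof.
move: {2}(wt s) (erefl (wt s)) => l; move: l s b c.
apply: (lower_finite_ind (ws_low D)) => l IH s b c sl ms.
have low t : (wt t < wt s)%O -> ~~ (m <= wt t)%O.
  by move=> ts; apply: contra ms => mt; apply: le_trans mt (ltW ts).
have bs : (b ** one (inc s)) ** one (inc s) = b ** one (inc s) by rewrite -ga_assoc gi_idem.
move: (tri_to bs); apply: (span_map (f := fun u => u ** c)); first exact: ga_linl.
move=> _ [i [s' [t [j [x [h [y [-> Xx Hh Yy ->]]]]]]]].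
case: (YP Yy) => [ts ->|ts]; last first.
  by rewrite -(Y_l Yy) !ga_assoc -ga_assoc; apply: IH erefl (low _ ts); rewrite -sl.
subst t; rewrite -!ga_assoc.
have hc : one (inc s') ** (h ** (one (inc s) ** c)) = h ** (one (inc s) ** c).
  by rewrite ga_assoc (H_l Hh).
have s's := H_wt Hh.
move: (tri_from hc); apply: (span_map (f := ga_mul x)); first exact: ga_linr.
move=> _ [_ [s2 [t2 [j2 [x2 [h2 [y2 [-> Xx2 Hh2 Yy2 ->]]]]]]]].
case: (XP Xx2) => [ss2 ->|ss2].
  subst s2; apply: span_gen; exists i, s', t2, j2, x, h2, y2; split=> //; first by rewrite s's.
  by rewrite !ga_assoc (X_r Xx).
have -> : x ** (x2 ** h2 ** y2) = (x ** x2) ** one (inc s2) ** (h2 ** y2).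
  by rewrite -{1}(X_r Xx2) !ga_assoc.
by rewrite s's in ss2; apply: IH erefl (low _ ss2); rewrite -sl.
Qed.

Lemma J_tri m a : J m a -> span (tri (fun _ t _ => ~~ (m <= wt t)%O)) a.
Proof. by move/J_gen; apply: span_in => _ [s [b [c [ms ->]]]]; apply: tri_ideal. Qed.

(** The elements of X of weight m freely generate the right module A_(>= m) e_m
    over the weight algebra; this is the universal property behind that fact.
    It holds because, modulo the ideal, an element of 1_s A is a combination of
    products h y: a nontrivial factor in X would lower the weight. So the
    coordinates of x a along X are those read off from a. *)
Lemma X_free m (Z : lmodType k) (theta : A -> A -> Z) :
  (forall x, linear (theta x)) -> (forall x a, J m a -> theta x a = 0) ->
  exists Psi : A -> Z, [/\ linear Psi, forall a, J m a -> Psi a = 0 &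
    forall i s x a, X i s x -> wt s = m -> one (inc s) ** a = a -> Psi (x ** a) = theta x a].
Proof.
move=> lin_t t0.
have [Psi lin_Psi PsiE] := basis_ext (tb_basis T) (fun p => theta p.1.1 (p.1.2 ** p.2)).
have E i s t j x h y : X i s x -> H s t h -> Y t j y -> Psi (x ** h ** y) = theta x (h ** y).
  by move=> Xx Hh Yy; apply: (PsiE (x, h, y)); exists i, s, t, j.
have Psi0 a : J m a -> Psi a = 0.
  move/J_tri; apply: (lin_eq_span lin_Psi (@lin_zero _ _ _)).
  move=> _ [i [s [t [j [x [h [y [ms Xx Hh Yy ->]]]]]]]].
  by rewrite (E _ _ _ _ _ _ _ Xx Hh Yy) -(H_l Hh); apply/t0/hi_r/hi_r/J_one.
exists Psi; split=> // i s x a Xx sm /tri_from.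
apply: (lin_eq_span (lin_comp lin_Psi (@ga_linr _ A x)) (lin_t x)).
move=> _ [_ [s' [t [j [x' [h [y [-> Xx' Hh Yy ->]]]]]]]].
case: (XP Xx') => [ss' ->|ss'].
  by subst s'; rewrite !ga_assoc (X_r Xx) (H_l Hh); apply: E Xx Hh Yy.
have Je : J m (x' ** h ** y).
  by rewrite -(X_r Xx'); apply/hi_r/hi_r/hi_l/J_one; rewrite -sm lt_geF.
by rewrite Psi0 ?t0 //; apply: hi_l.
Qed.

(** The mirror image of [X_free]. The formula on the basis is kept because it also
    controls the degree of the extension. *)
Lemma Y_free m (Z : lmodType k) (theta : A -> A -> Z) :
  (forall y, linear (theta y)) -> (forall y a, J m a -> theta y a = 0) ->
  exists Phi : A -> Z, [/\ linear Phi, forall a, J m a -> Phi a = 0,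
    forall t j y a, Y t j y -> wt t = m -> a ** one (inc t) = a -> Phi (a ** y) = theta y a
    & forall i s t j x h y, X i s x -> H s t h -> Y t j y -> Phi (x ** h ** y) = theta y (x ** h)].
Proof.
move=> lin_t t0.
have [Phi lin_Phi PhiE] := basis_ext (tb_basis T) (fun p => theta p.2 (p.1.1 ** p.1.2)).
have E i s t j x h y : X i s x -> H s t h -> Y t j y -> Phi (x ** h ** y) = theta y (x ** h).
  by move=> Xx Hh Yy; apply: (PhiE (x, h, y)); exists i, s, t, j.
have Phi0 a : J m a -> Phi a = 0.
  move/J_tri; apply: (lin_eq_span lin_Phi (@lin_zero _ _ _)).
  move=> _ [i [s [t [j [x [h [y [ms Xx Hh Yy ->]]]]]]]].
  by rewrite (E _ _ _ _ _ _ _ Xx Hh Yy) -(X_r Xx); apply/t0/hi_r/hi_l/J_one.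
exists Phi; split=> // t j y a Yy tm /tri_to.
apply: (lin_eq_span (lin_comp lin_Phi (@ga_linl _ A y)) (lin_t y)).
move=> _ [i [s [t' [_ [x [h [y' [-> Xx Hh Yy' ->]]]]]]]].
case: (YP Yy') => [tt' ->|tt'].
  by subst t'; rewrite -[_ ** _ ** y]ga_assoc (Y_l Yy) -(ga_assoc x h (one _)) (H_r Hh); apply: E Xx Hh Yy.
have Je : J m (x ** h ** y').
  by rewrite -(Y_l Yy'); apply/hi_l/hi_r/J_one; rewrite -tm lt_geF.
by rewrite Phi0 ?t0 //; apply: hi_r.
Qed.
End Triangular.

Arguments tri_from {k I A disp L D} T {i a}.
Arguments tri_to {k I A disp L D} T {j a}.
Arguments tri_all {k I A disp L D} T a.

(** * Independence over a triangular basis and exactness *)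

Lemma span_mono (k : fieldType) (V : lmodType k) (E E' : set V) :
  (forall e, E e -> E' e) -> forall v, span E v -> span E' v.
Proof. by move=> EE; apply: span_in => e /EE Ee; apply: span_gen. Qed.

Lemma seq_maximal (disp : Order.disp_t) (L : porderType disp) (r : seq L) :
  r != [::] -> exists2 m, m \in r & forall l, l \in r -> ~~ (m < l)%O.
Proof.
elim: r => // x [|y r] IH _.
  by exists x => [|l]; rewrite inE // => /eqP->; rewrite ltxx.
have [//|m mr mmax] := IH; have [mx|mx] := boolP (m < x)%O.
  exists x => [|l]; rewrite inE ?eqxx // => /orP[/eqP->|/mmax]; first by rewrite ltxx.
  by apply: contra; apply: lt_trans.
by exists m => [|l]; rewrite inE ?mr ?orbT // => /orP[/eqP->|/mmax].
Qed.

Definition short_exact (k : fieldType) (I : choiceType) (A : lualg k I) (V1 V2 V3 : gmod A)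
    (g : gmor V1 V2) (f : gmor V2 V3) : Prop :=
  [/\ injective g, forall z, exists y, f y = z & forall y, f y = 0 <-> exists x, g x = y].

Section IdealPart.
Variables (k : fieldType) (I : choiceType) (A : lualg k I) (J : hideal A).

Definition ideal_part_set (V : gmod A) : set V := [set x | exists a v, J a /\ x = a **: v].
Fact ideal_part_act (V : gmod A) (a : A) (v : V) : span (@ideal_part_set V) v -> span (@ideal_part_set V) (a **: v).
Proof.
apply: span_map; first exact: gm_linr.
move=> _ [b [u [Jb ->]]]; apply: span_gen; exists (a ** b), u.
by rewrite gm_assoc; split=> //; apply: hi_l.
Qed.
Fact ideal_part_comp (V : gmod A) d (v : V) :
  span (@ideal_part_set V) v -> span (@ideal_part_set V) (gm_gr V d v).
Proof.
apply: span_map; first exact: gr_lin.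
move=> _ [b [u [Jb ->]]]; have [s _ ->] := dec_sum (gr_dec (ga_gr A)) b.
rewrite (lin_sum (gm_linl u)) (lin_sum (gr_lin _ _)); apply: ss_sum => e _.
rewrite (act_comp_l _ _ (homog_comp (ga_gr A) e b)); apply: span_gen.
by exists (ga_gr A e b), (gm_gr V (d - e) u); split=> //; apply: hi_comp.
Qed.
Definition ideal_part (V : gmod A) : gsub V :=
  @GSub _ _ _ V (span (@ideal_part_set V)) (@ideal_part_act V) (@ideal_part_comp V).

Lemma ideal_part_gen (V : gmod A) (a : A) (v : V) : J a -> ideal_part V (a **: v).
Proof. by move=> Ja; apply: span_gen; exists a, v. Qed.

Lemma ideal_part_map (V W : gmod A) d (f : V -> W) : is_ghom d f ->
  forall v, ideal_part V v -> ideal_part W (f v).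
Proof.
move=> [lf af _] v; apply: (span_map lf) => _ [a [u [Ja ->]]].
by rewrite af; apply: ideal_part_gen.
Qed.

Lemma ideal_part_lift (V W : gmod A) (f : gmor V W) : (forall y, exists x, f x = y) ->
  forall y, ideal_part W y -> exists2 x, ideal_part V x & f x = y.
Proof.
move=> fs y; elim/span_ind=> [|c u v _ _ [x tx <-] [x' tx' <-]|_ [a [u [Ja ->]]]].
- by exists 0; [apply: ss_0 | rewrite (lin0 (gmor_lin f))].
- by exists (c *: x + x'); [apply: ss_lin | rewrite gmor_lin].
have [x <-] := fs u; exists (a **: x); last by rewrite gmor_act.
exact: ideal_part_gen.
Qed.
End IdealPart.

Section TriangularModules.
Variables (k : fieldType) (I : choiceType) (A : lualg k I).
Variables (disp : Order.disp_t) (L : porderType disp) (D : weights I L).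
Variables (T : triangular_basis A D) (w : L -> gidem A).
Hypothesis w_sum : forall l, gi_val (w l) = weight_sum A D l.
Notation S := (ws_S D).
Notation inc := (@ws_inc _ _ _ D).
Notation wt := (@ws_wt _ _ _ D).
Notation one i := (gi_val (lu_one A i)).
Notation X := (tb_X T).
Notation H := (tb_H T).
Notation Y := (tb_Y T).
Notation J m := (strat_ideal w m).
Notation U m V := (ideal_part (J m) V).

Section WeightPart.
Variable V : gmod A.

Definition weight_part (P : L -> Prop) : subspace V :=
  span [set x | exists s a v, P (wt s) /\ x = (a ** one (inc s)) **: v].

Lemma weight_part_gen (P : L -> Prop) s a (v : V) : P (wt s) -> weight_part P ((a ** one (inc s)) **: v).
Proof. by move=> Ps; apply: span_gen; exists s, a, v. Qed.

Lemma weight_part_mono (P P' : L -> Prop) v : (forall l, P l -> P' l) -> weight_part P v -> weight_part P' v.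
Proof.
move=> PP; apply: span_mono => _ [s [a [u [Ps ->]]]].
by exists s, a, u; split=> //; apply: PP.
Qed.

Lemma ideal_partE m v : U m V v <-> weight_part (fun l => ~~ (m <= l)%O) v.
Proof.
split; apply: span_in => x; last first.
  by move=> [s [a [u [ms ->]]]]; apply/ideal_part_gen/hi_l/(J_one w_sum).
move=> [a [u [Ja ->]]].
move: (J_gen w_sum Ja).
apply: (span_map (f := fun a => a **: u)); first by move=> c b b'; rewrite gm_linl.
by move=> _ [s [b [c [ms ->]]]]; rewrite -gm_assoc; apply: weight_part_gen.
Qed.

(** Lower finiteness of the poset makes the lower set finite, which is what allows
    induction on its size later on. *)
Lemma ideal_part_finite m v : U m V v -> exists r : seq L,
  [/\ forall l l', l \in r -> (l' <= l)%O -> l' \in r, forall l, l \in r -> ~~ (m <= l)%O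
    & weight_part (fun l => l \in r) v].
Proof.
move/ideal_partE; elim/span_ind=> [|c u u' _ _ [r [rl rm ru]] [r' [rl' rm' ru']]|_ [s [a [u [ms ->]]]]].
- by exists [::]; split=> //; apply: ss_0.
- exists (r ++ r'); split=> [l l'|l|]; rewrite ?mem_cat.
  + by move=> /orP[lr|lr] ll'; rewrite ?(rl _ _ lr ll') ?(rl' _ _ lr ll') ?orbT.
  + by case/orP; [apply: rm | apply: rm'].
  by apply: ss_lin; [move: ru | move: ru']; apply: weight_part_mono => l lr; rewrite mem_cat lr ?orbT.
have /finite_seqP[r rP] := ws_low D (wt s).
have memr l : (l \in r) = (l <= wt s)%O.
  apply/idP/idP => lr; first by have : [set` r] l by []; rewrite -rP.
  by have : [set m | (m <= wt s)%O] l by []; rewrite rP.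
exists r; split=> [l l'|l|]; rewrite ?memr.
- by move=> ls ll'; apply: le_trans ll' ls.
- by move=> ls; apply: contra ms => ml; apply: le_trans ml ls.
by apply: (weight_part_gen (P := fun l => l \in r)); rewrite memr.
Qed.

(** A factor 1_s in the expansion of 1_s a 1_t would force the weight of s to be
    at most that of t. *)
Lemma ideal_part_low m s v : wt s = m -> U m V v -> weight_part (fun l => (l < m)%O) (one (inc s) **: v).
Proof.
move=> sm /ideal_partE; apply: span_map; first exact: gm_linr.
move=> _ [t [a [u [mt ->]]]]; rewrite gm_assoc.
have sa : one (inc s) ** (one (inc s) ** a) = one (inc s) ** a by rewrite ga_assoc gi_idem.
have := tri_r (j := inc t) (tri_from T sa); rewrite ga_assoc.
apply: (span_map (f := fun a => a **: u)); first by move=> c b b'; rewrite gm_linl.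
move=> _ [_ [s' [t' [_ [x [h [y [[-> ->] Xx Hh Yy ->]]]]]]]].
rewrite -(X_r Xx) -!ga_assoc ga_assoc -gm_assoc; apply: weight_part_gen.
case: (XP Xx) => [ss' _|]; last by rewrite sm.
subst s'; case/negP: mt; rewrite -sm (H_wt Hh).
by case: (YP Yy) => [->|/ltW].
Qed.

(** The index is the pair (s, x) and not x alone because an element of X may vanish,
    and then belong to several s. *)
Definition top_family m i (r : seq (S * A)) (v : S * A -> V) : Prop :=
  uniq r /\ forall p, p \in r -> [/\ wt p.1 = m, X i p.1 p.2 & one (inc p.1) **: v p = v p].

Definition top_set m i x := exists r v, top_family m i r v /\ x = \sum_(p <- r) p.2 **: v p.

Lemma top_lin m i c x y : top_set m i x -> top_set m i y -> top_set m i (c *: x + y).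
Proof.
move=> [r [v [[ur rv] ->]]] [r' [v' [[ur' rv'] ->]]].
pose q := undup (r ++ r'); have uq : uniq q by apply: undup_uniq.
pose e (r0 : seq (S * A)) (v0 : S * A -> V) p := if p \in r0 then v0 p else 0.
have E r0 v0 : uniq r0 -> {subset r0 <= q} ->
    \sum_(p <- r0) p.2 **: v0 p = \sum_(p <- q) p.2 **: e r0 v0 p.
  move=> ur0 sub; rewrite [RHS](bigID (fun p => p \in r0)) /= [X in _ + X]big1 => [|p pr0].
    rewrite addr0 -[RHS]big_filter [RHS](perm_big r0) /=.
      by apply: eq_big_seq => p pr0; rewrite /e pr0.
    apply: uniq_perm; rewrite ?filter_uniq // => p; rewrite mem_filter.
    by case pr0: (p \in r0); rewrite //= (sub _ pr0).
  by rewrite /e (negPf pr0) (lin0 (gm_linr _)).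
exists q, (fun p => c *: e r v p + e r' v' p); split; first split=> // p pq.
  have [sp Xp] : wt p.1 = m /\ X i p.1 p.2.
    by move: pq; rewrite mem_undup mem_cat => /orP[/rv[]|/rv'[]].
  split=> //; rewrite gm_linr /e; congr (_ *: _ + _).
    by case: ifP => [/rv[]|] // _; rewrite (lin0 (gm_linr _)).
  by case: ifP => [/rv'[]|] // _; rewrite (lin0 (gm_linr _)).
rewrite (E r v) ?(E r' v') // => [|p pr|p pr]; try by rewrite mem_undup mem_cat pr ?orbT.
by rewrite scaler_sumr -big_split; apply: eq_bigr => p _; rewrite gm_linr.
Qed.

Lemma top0 m i : top_set m i 0.
Proof. by exists [::], (fun _ => 0); rewrite big_nil. Qed.

Definition top_span m i : subspace V := Subspace (@top_lin m i) (top0 m i).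

Lemma top_gen m i s x v : wt s = m -> X i s x -> one (inc s) **: v = v -> top_span m i (x **: v).
Proof.
move=> sm Xx sv; exists [:: (s, x)], (fun _ => v); rewrite big_seq1; split=> //.
by split=> // p; rewrite inE => /eqP->.
Qed.

(** Modulo lower weights, only products with a trivial factor in Y survive. *)
Lemma weight_part_top (P : L -> Prop) m i v : (forall l l', P l -> (l' <= l)%O -> P l') ->
  weight_part P v -> exists2 t, top_span m i t & weight_part (fun l => P l /\ l != m) (one i **: v - t).
Proof.
move=> Pl; elim/span_ind=> [|c u u' _ _ [t tt lt] [t' tt' lt']|_ [s [a [u [Ps ->]]]]].
- by exists 0; [apply: ss_0 | rewrite (lin0 (gm_linr _)) subr0; apply: ss_0].
- exists (c *: t + t'); first exact: ss_lin.
  by rewrite gm_linr opprD addrACA -scalerBr; apply: ss_lin.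
have [sm|sm] := eqVneq (wt s) m; last first.
  exists 0; first exact: ss_0.
  by rewrite subr0 gm_assoc ga_assoc; apply: weight_part_gen.
have ia : one i ** (one i ** a) = one i ** a by rewrite ga_assoc gi_idem.
rewrite gm_assoc ga_assoc; move: (tri_r (j := inc s) (tri_from T ia)).
elim/span_ind=> [|c b b' _ _ [t tt lt] [t' tt' lt']|].
- by exists 0; [apply: ss_0 | rewrite (lin0 (gm_linl _)) subr0; apply: ss_0].
- exists (c *: t + t'); first exact: ss_lin.
  by rewrite gm_linl opprD addrACA -scalerBr; apply: ss_lin.
move=> _ [_ [s' [t' [_ [x [h [y [[-> ->] Xx Hh Yy ->]]]]]]]].
have s't' := H_wt Hh.
have hyE : one (inc s') **: ((h ** y) **: u) = (h ** y) **: u.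
  by rewrite gm_assoc ga_assoc (H_l Hh).
have xhyE : (x ** h ** y) **: u = x **: ((h ** y) **: u) by rewrite gm_assoc ga_assoc.
case: (YP Yy) => [t's _|t's].
  exists ((x ** h ** y) **: u); last by rewrite subrr; apply: ss_0.
  by rewrite xhyE; apply: top_gen Xx hyE; rewrite s't' t's.
exists 0; first exact: ss_0.
rewrite subr0 xhyE -{1}(X_r Xx); apply: weight_part_gen; rewrite s't'; split.
  exact: Pl Ps (ltW t's).
by rewrite -sm lt_eqF.
Qed.
End WeightPart.

Lemma weight_part_map (V W : gmod A) (f : gmor V W) P v : weight_part V P v -> weight_part W P (f v).
Proof.
apply: span_map; first exact: gmor_lin.
by move=> _ [s [a [u [Ps ->]]]]; rewrite gmor_act; apply: weight_part_gen.
Qed.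

(** Equivalently, the canonical map to V / (J m) V from the standardization of the
    weight space of weight m of V / (J m) V is injective, for every weight m. *)
Definition upper_independent (V : gmod A) : Prop := forall m i r (v : S * A -> V),
  top_family m i r v -> U m V (\sum_(p <- r) p.2 **: v p) -> forall p, p \in r -> U m V (v p).

(** Exactness at V2 after truncation to every weight, expressed inside V2 and V3. *)
Definition strat_exact (V1 V2 V3 : gmod A) (g : gmor V1 V2) (f : gmor V2 V3) : Prop :=
  forall s v, one (inc s) **: v = v -> U (wt s) V3 (f v) -> exists x, U (wt s) V2 (v - g x).

(** Maximal weights m of r are removed one at a time: independence of V3 puts the
    images of the coefficients of weight m into the ideal part of V3, exactness
    in weight m corrects these coefficients by images from V1, and what remains
    has lower weight. *)
Lemma weight_part_kernel (V1 V2 V3 : gmod A) (g : gmor V1 V2) (f : gmor V2 V3) :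
  (forall x, f (g x) = 0) -> upper_independent V3 -> strat_exact g f ->
  forall r : seq L, (forall l l', l \in r -> (l' <= l)%O -> l' \in r) ->
  forall z, weight_part V2 (fun l => l \in r) z -> f z = 0 ->
  exists2 x, weight_part V1 (fun l => l \in r) x & g x = z.
Proof.
move=> fg0 indep ex r; move: {2}(size r) (leqnn (size r)) => n.
elim: n r => [|n IH] r rn rl z lz fz.
  exists 0; first exact: ss_0.
  rewrite (lin0 (gmor_lin g)); apply/esym; clear fz.
  elim/span_ind: z / lz => [//|c u v _ _ -> ->|]; first by rewrite scaler0 addr0.
  by move: rn; rewrite leqn0 => /nilP-> e [s [a [v [+ _]]]]; rewrite in_nil.
have [r0|/seq_maximal[m mr mmax]] := eqVneq r [::]; first by apply: IH => //; rewrite r0.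
pose r' := [seq l <- r | l != m].
have r'P l : (l \in r') = (l != m) && (l \in r) by rewrite mem_filter.
have r'n : (size r' <= n)%N.
  by rewrite size_filter -ltnS (leq_trans _ rn) // -(count_predC (fun l => l != m) r)
       -[ltnLHS]addn0 ltn_add2l -has_count; apply/hasP; exists m; rewrite //= eqxx.
have r'l l l' : l \in r' -> (l' <= l)%O -> l' \in r'.
  rewrite !r'P => /andP[lm lr] ll'; rewrite (rl _ _ lr ll') andbT.
  apply: contraNneq lm => l'm; rewrite l'm le_eqVlt in ll'.
  by rewrite (negPf (mmax _ lr)) orbF eq_sym in ll'.
have r'm l : l \in r' -> ~~ (m <= l)%O.
  by rewrite r'P le_eqVlt eq_sym negb_or => /andP[-> /mmax].
have weight_part_r' V v : weight_part V (fun l => l \in r') v -> U m V v.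
  by move=> lv; apply/ideal_partE; apply: weight_part_mono lv.
suff /choice[x xP] : forall i, exists x, weight_part V1 (fun l => l \in r) x /\ g x = one i **: z.
  have [s _ ->] := dec_sum (gm_dec V2) z; exists (\sum_(i <- s) x i).
    by apply: ss_sum => i _; case: (xP i).
  by rewrite (lin_sum (gmor_lin g)); apply: eq_bigr => i _; case: (xP i).
move=> i; have [_ [q [u [[uq qu] ->]]] lz'] := weight_part_top m i rl lz.
set t := \sum_(p <- q) _ in lz'; set z' := _ - t in lz'.
have {}lz' : weight_part V2 (fun l => l \in r') z'.
  by apply: weight_part_mono lz' => l [lr lm]; rewrite r'P lm lr.
have fu p : p \in q -> U m V3 (f (u p)).
  move: p; apply: (indep m i q (fun p => f (u p))).
    split=> // p /qu[pm Xp up]; split=> //.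
    by rewrite -gmor_act up.
  have -> : \sum_(p <- q) p.2 **: f (u p) = - f z'.
    rewrite /z' (linB (gmor_lin f)) gmor_act fz (lin0 (gm_linr _)) sub0r opprK.
    by rewrite (lin_sum (gmor_lin f)); apply: eq_bigr => p _; rewrite gmor_act.
  by apply/ssN/weight_part_r'/weight_part_map.
have /choice[y yP] : forall p, exists y : V1, p \in q -> U m V2 (u p - g y).
  move=> p; have [pq|pq] := boolP (p \in q); last by exists 0.
  have [pm _ up] := qu _ pq; have := fu _ pq; rewrite -pm => fup.
  by have [y yP] := ex _ _ up fup; exists y.
pose y' p := one (inc p.1) **: y p; pose e p := u p - g (y' p).
have eE p : p \in q -> e p = one (inc p.1) **: (u p - g (y p)).
  by move=> /qu[_ _ up]; rewrite (linB (gm_linr _)) up /e gmor_act.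
(* After the correction by g, the remainder only involves weights of r'. *)
have zE : z' + \sum_(p <- q) p.2 **: e p = one i **: z - g (\sum_(p <- q) p.2 **: y' p).
  have -> : \sum_(p <- q) p.2 **: e p = t - g (\sum_(p <- q) p.2 **: y' p).
    rewrite (lin_sum (gmor_lin g)) /t -sumrB; apply: eq_bigr => p _.
    by rewrite gmor_act -(linB (gm_linr _)).
  by rewrite /z' addrA subrK.
have [x lx gx] : exists2 x, weight_part V1 (fun l => l \in r') x & g x = z' + \sum_(p <- q) p.2 **: e p.
  apply: IH => //.
    apply: ssD => //; apply: ss_sum => p pq; have [pm Xp _] := qu _ pq.
    have := ideal_part_low pm (yP _ pq); rewrite -(eE _ pq).
    apply: span_map; first exact: gm_linr.
    move=> _ [s [a [v [sm ->]]]]; rewrite gm_assoc ga_assoc.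
    by apply: (weight_part_gen (P := fun l => l \in r')); rewrite r'P (lt_eqF sm) (rl _ _ mr (ltW sm)).
  by rewrite zE (linB (gmor_lin f)) fg0 subr0 gmor_act fz (lin0 (gm_linr _)).
exists (\sum_(p <- q) p.2 **: y' p + x); split.
  apply: ssD; last by apply: weight_part_mono lx => l; rewrite r'P => /andP[].
  apply: ss_sum => p /qu[pm Xp _]; rewrite /y' gm_assoc.
  by apply: (weight_part_gen (P := fun l => l \in r)); rewrite pm.
by rewrite (linD (gmor_lin g)) gx zE addrC subrK.
Qed.

Lemma strat_exact_base (V1 V2 V3 : gmod A) (g : gmor V1 V2) (f : gmor V2 V3) :
  (forall z, exists y, f y = z) -> (forall y, f y = 0 -> exists x, g x = y) -> strat_exact g f.
Proof.
move=> f_surj exact_gf s v _ /(ideal_part_lift f_surj)[u tu fu].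
have /exact_gf[x gx] : f (v - u) = 0 by rewrite (linB (gmor_lin f)) fu subrr.
by exists x; rewrite gx opprB addrC subrK.
Qed.

(** Exactness propagates to the left along a complex of independent modules: g v is
    in the kernel of f, so it lifts along g inside the ideal part, and the
    difference with v lies in the image of h. *)
Lemma strat_exact_step (V0 V1 V2 V3 : gmod A)
    (h : gmor V0 V1) (g : gmor V1 V2) (f : gmor V2 V3) :
  (forall x, f (g x) = 0) -> (forall x, g x = 0 -> exists y, h y = x) ->
  upper_independent V3 -> strat_exact g f -> strat_exact h g.
Proof.
move=> fg0 exact_hg indep ex s v _ /ideal_part_finite[r [rl rs lv]].
have [x lx gx] := weight_part_kernel fg0 indep ex rl lv (fg0 v).
have /exact_hg[y hy] : g (v - x) = 0 by rewrite (linB (gmor_lin g)) gx subrr.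
exists y; rewrite hy opprB addrC subrK; apply/ideal_partE.
exact: weight_part_mono lx.
Qed.

(** For a short exact sequence whose quotient is independent, the filtration of the
    middle term restricts to the filtration of the submodule. *)
Lemma ideal_part_ses (V1 V2 V3 : gmod A) (g : gmor V1 V2) (f : gmor V2 V3) :
  short_exact g f -> upper_independent V3 -> forall m v, U m V2 (g v) -> U m V1 v.
Proof.
move=> [g_inj f_surj exact_gf] indep m v /ideal_part_finite[r [rl rm lv]].
have fg0 x : f (g x) = 0 by apply/exact_gf; exists x.
have ex := strat_exact_base f_surj (fun y => proj1 (exact_gf y)).
have [x lx /g_inj <-] := weight_part_kernel fg0 indep ex rl lv (fg0 v).
by apply/ideal_partE; apply: weight_part_mono lx.
Qed.

(** The coefficients of a relation in V2 come from V1 up to the ideal part of V2, and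
    [ideal_part_ses] turns the relation into one in V1. *)
Lemma upper_independent_ext (V1 V2 V3 : gmod A) (g : gmor V1 V2) (f : gmor V2 V3) :
  short_exact g f -> upper_independent V1 -> upper_independent V3 -> upper_independent V2.
Proof.
move=> gf_exact ind1 ind3 m i r v [ur rv] tv; have [g_inj f_surj exact_gf] := gf_exact.
have ex := strat_exact_base f_surj (fun y => proj1 (exact_gf y)).
have fv p : p \in r -> U m V3 (f (v p)).
  move: p; apply: (ind3 m i r (fun p => f (v p))).
    by split=> // p /rv[pm Xp pv]; split=> //; rewrite -gmor_act pv.
  have := ideal_part_map (gmorP f) tv; rewrite (lin_sum (gmor_lin f)).
  by under eq_bigr do rewrite gmor_act.
have /choice[x xP] : forall p, exists x, p \in r -> U m V2 (v p - g x).
  move=> p; have [pr|pr] := boolP (p \in r); last by exists 0.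
  have [pm _ pv] := rv _ pr; have := fv _ pr; rewrite -pm => fvp.
  by have [x xP] := ex _ _ pv fvp; exists x.
pose x' p := one (inc p.1) **: x p.
have vx p : p \in r -> U m V2 (v p - g (x' p)).
  move=> pr; have [_ _ pv] := rv _ pr; rewrite -pv gmor_act -(linB (gm_linr _)).
  exact/gs_act/xP.
have tx p : p \in r -> U m V1 (x' p).
  move: p; apply: (ind1 m i r x').
    by split=> // p /rv[pm Xp _]; split=> //; rewrite gm_assoc gi_idem.
  apply: (ideal_part_ses gf_exact ind3).
  have -> : g (\sum_(p <- r) p.2 **: x' p)
      = \sum_(p <- r) p.2 **: v p - \sum_(p <- r) p.2 **: (v p - g (x' p)).
    rewrite (lin_sum (gmor_lin g)) -sumrB; apply: eq_bigr => p _.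
    by rewrite gmor_act (linB (gm_linr _)) opprB addrC subrK.
  by apply: ssB => //; apply: ss_sum => p pr; apply/gs_act/vx.
move=> p pr; rewrite -(subrK (g (x' p)) (v p)).
by apply: ssD; [apply: vx | apply: ideal_part_map (gmorP g) _ (tx _ pr)].
Qed.

Lemma upper_independent_retract (V V' : gmod A) d e (f : V -> V') (f' : V' -> V) :
  is_ghom d f -> is_ghom e f' -> cancel f f' -> upper_independent V' -> upper_independent V.
Proof.
move=> hf hf' fK ind m i r v [ur rv] tv p pr; have [lf af _] := hf.
rewrite -[v p]fK; apply: (ideal_part_map hf'); move: p pr.
apply: (ind m i r (fun p => f (v p))).
  by split=> // p /rv[pm Xp pv]; split=> //; rewrite -af pv.
by have := ideal_part_map hf tv; rewrite (lin_sum lf); under eq_bigr do rewrite af.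
Qed.

(** The extension of the projection A -> A_(>= m) along a single x isolates the
    terms with that x; multiplication by 1_s then separates those indices (s, x)
    that share x. *)
Lemma algebra_independent m i (r : seq (S * A)) (a : S * A -> A) : uniq r ->
  (forall p, p \in r -> [/\ wt p.1 = m, X i p.1 p.2 & one (inc p.1) ** a p = a p]) ->
  J m (\sum_(p <- r) p.2 ** a p) -> forall p, p \in r -> J m (a p).
Proof.
move=> ur ra Ja [s x] sr.
pose theta y := if y == x then to_quot (J m) else fun _ => 0.
have lin_t y : linear (theta y).
  by rewrite /theta; case: ifP => _; [apply: to_quot_lin | apply: lin_zero].
have t0 y b : J m b -> theta y b = 0 by rewrite /theta; case: ifP => // _ /to_quot0.
have [Psi [lin_Psi Psi0 PsiE]] := X_free T w_sum lin_t t0.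
have := Psi0 _ Ja; rewrite (lin_sum lin_Psi).
have -> : \sum_(p <- r) Psi (p.2 ** a p) = to_quot (J m) (\sum_(p <- r) if p.2 == x then a p else 0).
  rewrite (lin_sum (@to_quot_lin _ _ _)); apply: eq_big_seq => p /ra[pm Xp pa].
  rewrite (PsiE _ _ _ _ Xp) // /theta; case: ifP => // _.
  by rewrite (lin0 (@to_quot_lin _ _ _)).
move/to_quot0/(hi_l (h := J m) (one (inc s))); rewrite (lin_sum (@ga_linr _ A _)).
rewrite (bigD1_seq (s, x)) //= eqxx; have [_ _ ->] := ra _ sr.
rewrite big1_seq ?addr0 // => -[s' y] /= /andP[ne /ra[_ _ /= <-]].
case: eqP => [yx|_]; last exact: mulx0.
rewrite ga_assoc lu_orth ?mul0x // (inj_eq (@ws_inj _ _ _ D)).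
by apply: contra ne => /eqP->; rewrite yx.
Qed.

Lemma free_independent (V : gmod A) : upper_independent (free_module V).
Proof.
move=> m i r v [ur rv] tv.
have lin_c x : linear (fun f : free_module V => sub_val f x : A) by [].
have coord f x : U m (free_module V) f -> J m (sub_val f x).
  by apply: (span_map (lin_c x)) => _ [a [u [Ja ->]]]; apply: hi_r.
move=> p pr; have [s us s0] := free_module_supp (v p).
rewrite (free_module_sum us s0); apply: ss_sum => x _.
apply: (ideal_part_gen (V := free_module V)); move: p pr {us s0}.
apply: (@algebra_independent m i r (fun p => sub_val (v p) x)) => //.
  by move=> p /rv[pm Xp pv]; split=> //; rewrite -[in RHS]pv.
by have := coord _ x tv; rewrite (lin_sum (lin_c x)).
Qed.

Lemma projective_independent (P : gmod A) : projective P -> upper_independent P.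
Proof.
move=> proj_P.
have idP : is_ghom 0 (id : P -> P) by split=> // n v; rewrite addr0.
have [g gK] := proj_P _ _ (free_cover P) (GMor idP) (@free_cover_surj _ _ _ P).
have gK' : cancel g (free_cover P) by move=> x; rewrite gK.
exact: upper_independent_retract (gmorP g) (gmorP (free_cover P)) gK' (@free_independent P).
Qed.
End TriangularModules.

(** * Truncation and its right adjoint, coinduction *)

Section Truncation.
Variables (k : fieldType) (I : choiceType) (A : lualg k I) (J : hideal A) (e : gidem A).
Notation ebar := (quot_idem J e).
Notation C := (corner ebar).
Notation N := (sub_space (right_ideal ebar)).
Notation pj := (to_quot J).
Notation lact := (@corner_lact k I (quot_lualg J) ebar).
Notation ract := (@right_act k I (quot_lualg J) ebar).

Fact to_corner_subproof (a : A) : corner_ss ebar (pj (e ** a ** e)).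
Proof. by rewrite /= !qmulE !ga_assoc gi_idem -!ga_assoc gi_idem. Qed.
Definition to_corner (a : A) : C := mk_sub (to_corner_subproof a).

Lemma to_corner_lin : linear to_corner.
Proof. by move=> c a b; apply: sub_val_inj; rewrite /= ga_linr ga_linl to_quot_lin. Qed.

Lemma to_corner_repr (c : C) : to_corner (repr (sub_val c)) = c.
Proof.
apply: sub_val_inj => /=; have := subP c; rewrite /= => {2}<-.
by case: (quot_ind (P := fun q => exists a, q = pj a) _ (sub_val c)) => [v|a ->];
  [exists v | rewrite !qmulE; apply/to_quotP; rewrite -(linB (@ga_linl _ A _)) -(linB (@ga_linr _ A _));
   apply/hi_r/hi_l/to_quotP; rewrite /to_quot reprK].
Qed.

Lemma to_corner_surj (c : C) : exists a, to_corner a = c.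
Proof. by exists (repr (sub_val c)); apply: to_corner_repr. Qed.

Lemma to_cornerM a b : to_corner a ** to_corner b = to_corner (a ** e ** b).
Proof. by apply: sub_val_inj; rewrite /= qmulE -!ga_assoc (ga_assoc e e) gi_idem. Qed.

Lemma to_corner_l a : to_corner (e ** a) = to_corner a.
Proof. by apply: sub_val_inj; rewrite /= !ga_assoc gi_idem. Qed.

Lemma to_corner_r a : to_corner (a ** e) = to_corner a.
Proof. by apply: sub_val_inj; rewrite /= -!ga_assoc gi_idem. Qed.

Lemma to_corner_one : to_corner e = lu_one C tt.
Proof. by apply: sub_val_inj; rewrite /= !gi_idem. Qed.

Lemma to_corner0 a : to_corner a = 0 <-> J (e ** a ** e).
Proof.
split=> [/(congr1 (@sub_val _ _ _))/to_quot0 //|Ja].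
by apply: sub_val_inj; apply/to_quot0.
Qed.

Lemma to_corner_gr d a : ga_gr C d (to_corner a) = to_corner (ga_gr A d a).
Proof.
apply: sub_val_inj; rewrite /= -[LHS]/(quot_gr J d _) quot_grE.
by rewrite comp_idem_r comp_idem_l.
Qed.

Lemma to_corner_homog d (c : C) : homog (ga_gr C) d c -> exists2 a, homog (ga_gr A) d a & to_corner a = c.
Proof.
have [a <-] := to_corner_surj c; rewrite /homog to_corner_gr => <-.
by exists (ga_gr A d a); first exact: homog_comp.
Qed.

Fact to_right_subproof (a : A) : right_ideal ebar (pj (e ** a)).
Proof. by rewrite /= qmulE ga_assoc gi_idem. Qed.
Definition to_right (a : A) : N := mk_sub (to_right_subproof a).

Lemma to_right_lin : linear to_right.
Proof. by move=> c a b; apply: sub_val_inj; rewrite /= ga_linr to_quot_lin. Qed.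

Lemma to_right_surj (x : N) : exists a, to_right a = x.
Proof.
have [a xa] : exists a, sub_val x = pj a by elim/quot_ind: (sub_val x) => a; exists a.
by exists a; apply: sub_val_inj; have := subP x; rewrite /= xa qmulE.
Qed.

Lemma to_right_e a : to_right (e ** a) = to_right a.
Proof. by apply: sub_val_inj; rewrite /= ga_assoc gi_idem. Qed.

Lemma to_right_gr d a : right_ideal_gr ebar d (to_right a) = to_right (ga_gr A d a).
Proof. by apply: sub_val_inj; rewrite /= -[LHS]/(quot_gr J d _) quot_grE comp_idem_l. Qed.

Lemma to_right_homog d (x : N) : homog (right_ideal_gr ebar) d x ->
  exists2 a, homog (ga_gr A) d a & to_right a = x.
Proof.
have [a <-] := to_right_surj x; rewrite /homog to_right_gr => <-.
by exists (ga_gr A d a); first exact: homog_comp.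
Qed.

Lemma to_right_lact a b : lact (to_corner a) (to_right b) = to_right (a ** e ** b).
Proof. by apply: sub_val_inj; rewrite /= qmulE -!ga_assoc (ga_assoc e e) gi_idem. Qed.

Lemma to_right_ract a b : ract (to_right a) (pj b) = to_right (a ** b).
Proof. by apply: sub_val_inj; rewrite /= qmulE ga_assoc. Qed.

Section Module.
Variable V : gmod A.

Fact trunc_lin (c : k) u v : ideal_part J V (e **: u) -> ideal_part J V (e **: v) -> ideal_part J V (e **: (c *: u + v)).
Proof. by rewrite gm_linr; apply: ss_lin. Qed.
Fact trunc_0 : ideal_part J V (e **: 0).
Proof. by rewrite (lin0 (gm_linr _)); apply: ss_0. Qed.
Definition trunc_ss : subspace V := @Subspace _ _ (fun v => ideal_part J V (e **: v)) trunc_lin trunc_0.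
Notation cls := (to_quot trunc_ss).
Lemma trunc_ssE v : trunc_ss v = ideal_part J V (e **: v). Proof. by []. Qed.

Lemma act_gr0 (f : gidem A) d v : gm_gr V d (f **: v) = f **: gm_gr V d v.
Proof. by rewrite (act_comp_l _ _ (gi_homog f)) subr0. Qed.

Fact trunc_comp d v : trunc_ss v -> trunc_ss (gm_gr V d v).
Proof.
by rewrite !trunc_ssE -act_gr0; apply: gs_comp.
Qed.

Definition trunc_gr : grading (quot_space trunc_ss) :=
  Grading (quot_proj_dec (gr_dec (gm_gr V)) trunc_comp).
Lemma trunc_grE d v : trunc_gr d (cls v) = cls (gm_gr V d v).
Proof. exact: quot_projE (gr_dec (gm_gr V)) trunc_comp d v. Qed.

Definition trunc_act (c : C) : quot_space trunc_ss -> quot_space trunc_ss :=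
  quot_lift (fun v => cls ((e ** repr (sub_val c) ** e) **: v)).

Lemma trunc_actE a v : trunc_act (to_corner a) (cls v) = cls ((e ** a ** e) **: v).
Proof.
rewrite /trunc_act quot_liftE => [|c u u'|u tu]; first last.
- by apply/to_quot0; rewrite trunc_ssE -gm_assoc; apply/gs_act/gs_act.
- by rewrite gm_linr to_quot_lin.
apply/to_quotP; rewrite trunc_ssE -(linB (gm_linl _)); apply/gs_act/ideal_part_gen.
rewrite -(linB (@ga_linl _ A _)) -(linB (@ga_linr _ A _)).
by have := to_corner_repr (to_corner a); move/(congr1 (@sub_val _ _ _))/to_quotP;
  rewrite -(linB (@ga_linl _ A _)) -(linB (@ga_linr _ A _)).
Qed.

Lemma cls_e v : cls (e **: v) = cls v.
Proof.
by apply/to_quotP; rewrite trunc_ssE (linB (gm_linr _)) gm_assoc gi_idem subrr; apply: ss_0.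
Qed.

Fact trunc_linl q : linear (trunc_act^~ q).
Proof.
elim/quot_ind: q => v c x y; have [a <-] := to_corner_surj x; have [b <-] := to_corner_surj y.
by rewrite -to_corner_lin !trunc_actE ga_linr ga_linl gm_linl to_quot_lin.
Qed.
Fact trunc_linr x : linear (trunc_act x).
Proof.
have [a <-] := to_corner_surj x; move=> c; elim/quot_ind=> u; elim/quot_ind=> v.
by rewrite -to_quot_lin !trunc_actE gm_linr to_quot_lin.
Qed.
Fact trunc_assoc x y q : trunc_act x (trunc_act y q) = trunc_act (x ** y) q.
Proof.
have [a <-] := to_corner_surj x; have [b <-] := to_corner_surj y; elim/quot_ind: q => v.
by rewrite to_cornerM !trunc_actE gm_assoc -!ga_assoc (ga_assoc e e) gi_idem.
Qed.
Fact trunc_homog d n x q : homog (ga_gr C) d x -> homog trunc_gr n q ->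
  homog trunc_gr (d + n) (trunc_act x q).
Proof.
move=> /to_corner_homog[a ha <-]; elim/quot_ind: q => v; rewrite /homog trunc_grE => <-.
rewrite trunc_actE trunc_grE; congr cls; apply: gm_homog; last exact: homog_comp.
by rewrite /homog comp_idem_r comp_idem_l ha.
Qed.
Fact trunc_dec : decomposes (fun i => trunc_act (lu_one C i)).
Proof.
have one1 i q : trunc_act (lu_one C i) q = q.
  by case: i; rewrite -to_corner_one; elim/quot_ind: q => v; rewrite trunc_actE !gi_idem cls_e.
split=> [i c u v|[] [] q|q]; first by rewrite !one1.
  by rewrite eqxx !one1.
by exists [:: tt] => //; rewrite big_seq1 one1.
Qed.

(** The value at V of the left adjoint of costandardization: the quotient of e V by
    its intersection with J V, realized as a quotient of all of V. *)
Definition trunc : gmod C := GMod trunc_linl trunc_linr trunc_assoc trunc_homog trunc_dec.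
Definition tcls (v : V) : trunc := cls v.

Lemma tcls_lin : linear tcls. Proof. exact: to_quot_lin. Qed.
Lemma tcls_surj (q : trunc) : exists v, tcls v = q.
Proof. by elim/quot_ind: q => v; exists v. Qed.
Lemma tcls0 v : tcls v = 0 <-> ideal_part J V (e **: v). Proof. exact: to_quot0. Qed.
Lemma tcls_e v : tcls (e **: v) = tcls v. Proof. exact: cls_e. Qed.
Lemma tcls_act a v : to_corner a **: tcls v = tcls ((e ** a ** e) **: v).
Proof. exact: trunc_actE. Qed.
Lemma tcls_gr d v : gm_gr trunc d (tcls v) = tcls (gm_gr V d v).
Proof. exact: trunc_grE. Qed.
Lemma tcls_homog d q : homog (gm_gr trunc) d q -> exists2 v, homog (gm_gr V) d v & tcls v = q.
Proof.
have [v <-] := tcls_surj q; rewrite /homog tcls_gr => <-.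
by exists (gm_gr V d v); first exact: homog_comp.
Qed.
Lemma tcls_J a v : J a -> tcls (a **: v) = 0.
Proof. by move=> Ja; apply/tcls0/gs_act/ideal_part_gen. Qed.
Lemma tcls_eact a v : tcls ((e ** a) **: v) = tcls (a **: v).
Proof. by rewrite -gm_assoc tcls_e. Qed.
End Module.

Lemma trunc_map_ex (V W : gmod A) d (f : V -> W) : is_ghom d f ->
  exists2 g : trunc V -> trunc W, is_ghom d g & forall v, g (tcls v) = tcls (f v).
Proof.
move=> hf; have [lf af df] := hf.
pose g : trunc V -> _ := quot_lift (U := trunc_ss V) (fun v => tcls (f v)).
have gE v : g (tcls v) = tcls (f v).
  apply: quot_liftE => [c u u'|u tu]; first by rewrite lf tcls_lin.
  by apply/tcls0; rewrite -af; apply: ideal_part_map hf _ tu.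
exists g => //; split=> [c q q'|x q|n q].
- have [v <-] := tcls_surj q; have [v' <-] := tcls_surj q'.
  by rewrite -tcls_lin !gE lf tcls_lin.
- have [v <-] := tcls_surj q; have [a <-] := to_corner_surj x.
  by rewrite tcls_act !gE af tcls_act.
by move=> /tcls_homog[v hv <-]; rewrite gE /homog tcls_gr (df _ _ hv).
Qed.

Lemma trunc_gmor (V W : gmod A) (f : gmor V W) :
  exists g : gmor (trunc V) (trunc W), forall v, g (tcls v) = tcls (f v).
Proof. by have [g hg gE] := trunc_map_ex (gmorP f); exists (GMor hg). Qed.

Definition trunc_map (V W : gmod A) (f : gmor V W) : gmor (trunc V) (trunc W) :=
  projT1 (cid (trunc_gmor f)).
Lemma trunc_mapE (V W : gmod A) (f : gmor V W) v : trunc_map f (tcls v) = tcls (f v).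
Proof. exact: (projT2 (cid (trunc_gmor f))). Qed.

Section Adjunction.
Variable Z : gmod C.
Notation chomZ := (@chom k I (quot_lualg J) ebar Z).
Notation jstZ := (@jst_ss k I (quot_lualg J) ebar Z).
(** Costandardization, for an arbitrary ideal and idempotent. *)
Definition coind : gmod A := inflation (@right_adjoint k I (quot_lualg J) ebar Z).

Lemma coind_ext (g h : coind) :
  (forall a, sub_val g (to_right a) = sub_val h (to_right a)) -> g = h.
Proof.
move=> gh; apply: sub_val_inj; apply/funext => x.
by have [a <-] := to_right_surj x; apply: gh.
Qed.

Lemma coind_act a b (g : coind) : sub_val (a **: g) (to_right b) = sub_val g (to_right (b ** a)).
Proof. by rewrite -to_right_ract. Qed.

Lemma coind_lact c x (g : coind) : sub_val g (lact c x) = c **: sub_val g x.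
Proof.
elim/span_ind: (sub_val g) / (subP g) => [|d u v _ _ gu gv|h [i [n [[_ hl _] _]]]]; last exact: hl.
- by rewrite (lin0 (gm_linr _)).
have E y : (d *: u + v) y = d *: u y + v y by [].
by rewrite !E gu gv gm_linr.
Qed.

Lemma coind_homog n (g : coind) : homog (gm_gr coind) n g ->
  homog (gm_gr Z) n (sub_val g (to_right e)).
Proof.
move=> hg; have lg := jst_lin (subP g).
have he : homog (right_ideal_gr ebar) 0 (to_right e).
  by rewrite /homog to_right_gr (gi_homog e).
rewrite /homog -[in RHS]hg /= /jst_comp0 (@fsumT_seq _ _ _ [:: 0]) //.
  by rewrite big_seq1 add0r he.
move=> m; rewrite inE => m0.
by rewrite (homogE _ he) (negPf m0) (lin0 lg) (lin0 (gr_lin _ _)).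
Qed.

Variable V : gmod A.

(** With [adj_sharp], the adjunction between truncation and coinduction: a map to the
    coinduced module is determined by its values at e. *)
Lemma adj_flat (f : gmor V coind) :
  exists g : gmor (trunc V) Z, forall v, g (tcls v) = sub_val (f v) (to_right e).
Proof.
pose g : trunc V -> _ := quot_lift (U := trunc_ss V) (fun v => sub_val (f v) (to_right e)).
have evE a v : sub_val (f v) (to_right a) = sub_val (f ((e ** a) **: v)) (to_right e).
  by rewrite gmor_act coind_act ga_assoc gi_idem to_right_e.
have Jf a v : J a -> f (a **: v) = 0.
  by move=> /to_quot0 Ja; rewrite gmor_act -[LHS]/(gm_act (_ : quot_lualg J) _) Ja (lin0 (gm_linl _)).
have tf v : ideal_part J V v -> f v = 0.
  elim/span_ind=> [|c u u' _ _ fu fu'|_ [a [u [Ja ->]]]]; last exact: Jf.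
    exact: lin0 (gmor_lin f).
  by rewrite gmor_lin fu fu' scaler0 addr0.
have gE v : g (tcls v) = sub_val (f v) (to_right e).
  apply: quot_liftE => [c u u'|u tu]; first by rewrite gmor_lin.
  by rewrite evE gi_idem (tf _ tu).
suff hg : is_ghom 0 g by exists (GMor hg).
split=> [c q q'|x q|n q].
- have [v <-] := tcls_surj q; have [v' <-] := tcls_surj q'.
  by rewrite -tcls_lin !gE gmor_lin.
- have [v <-] := tcls_surj q; have [a <-] := to_corner_surj x.
  rewrite tcls_act !gE -coind_lact to_right_lact gmor_act coind_act.
  by rewrite to_right_e -[e ** a ** e]ga_assoc to_right_e -ga_assoc gi_idem.
move=> /tcls_homog[v hv <-]; rewrite gE addr0.
exact/coind_homog/(gmor_homog f).
Qed.

Lemma adj_sharp (g : gmor (trunc V) Z) :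
  exists f : gmor V coind, forall v a, sub_val (f v) (to_right a) = g (tcls (a **: v)).
Proof.
pose phi v (x : N) := g (tcls (repr (sub_val x) **: v)).
have phiE v a : phi v (to_right a) = g (tcls (a **: v)).
  congr (g _); apply/eqP; rewrite -(tcls_eact a) -subr_eq0 -(linB (@tcls_lin _)) -(linB (gm_linl _)).
  by apply/eqP/tcls_J/to_quotP; rewrite /to_quot reprK.
have phi_lin : linear phi.
  move=> c u v; apply/funext => x; rewrite -[RHS]/(c *: phi u x + phi v x) /phi.
  by rewrite gm_linr tcls_lin gmor_lin.
have phi_chom i d v : lu_one A i **: v = v -> homog (gm_gr V) d v -> chomZ i d (phi v).
  move=> iv hv; split; first split.
  - move=> c x y; have [a <-] := to_right_surj x; have [b <-] := to_right_surj y.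
    by rewrite -to_right_lin !phiE gm_linl tcls_lin gmor_lin.
  - move=> b x; have [a <-] := to_right_surj x; have [c <-] := to_corner_surj b.
    rewrite to_right_lact !phiE -gmor_act tcls_act gm_assoc -(tcls_eact (_ ** a)).
    by congr (g (tcls _)); rewrite !ga_assoc.
  - move=> n x /to_right_homog[a ha <-]; rewrite phiE; apply: gmor_homog.
    by rewrite /homog tcls_gr (gm_homog ha hv).
  move=> x; have [a <-] := to_right_surj x.
  by rewrite to_right_ract !phiE -gm_assoc iv.
have phi_jst v : jstZ (phi v).
  have [s _ ->] := dec_sum (gm_dec V) v; rewrite (lin_sum phi_lin); apply: ss_sum => i _.
  have [t _ ->] := dec_sum (gr_dec (gm_gr V)) (lu_one A i **: v).
  rewrite (lin_sum phi_lin); apply: ss_sum => d _; apply: span_gen; exists i, d.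
  apply: phi_chom; last exact: homog_comp.
  by rewrite -act_gr0 gm_assoc gi_idem.
pose f v : coind := mk_sub (phi_jst v).
suff hf : is_ghom 0 f by exists (GMor hf).
split=> [c u v|a v|n v hv].
- by apply: sub_val_inj; rewrite /= phi_lin.
- by apply: coind_ext => b; rewrite coind_act -[LHS]/(phi _ _) -[RHS]/(phi _ _) !phiE gm_assoc.
rewrite addr0; have [s _ vE] := dec_sum (gm_dec V) v.
have lin_f : linear f by move=> c u u'; apply: sub_val_inj; rewrite /= phi_lin.
rewrite [f v](congr1 f vE) (lin_sum lin_f); apply: homog_sum => i.
have hiv : homog (gm_gr V) n (lu_one A i **: v) by rewrite /homog act_gr0 hv.
have iv : lu_one A i **: (lu_one A i **: v) = lu_one A i **: v by rewrite gm_assoc gi_idem.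
apply: sub_val_inj; have [cf _] := phi_chom _ _ _ iv hiv.
by rewrite /= (jst_comp0E _ cf) eqxx.
Qed.
End Adjunction.

(** The transpose of p composed with the counit of the adjunction. *)
Lemma coind_map (Z Z' : gmod C) (p : gmor Z Z') : exists f : gmor (coind Z) (coind Z'),
  forall h x, sub_val (f h) x = p (sub_val h x).
Proof.
have idP : is_ghom 0 (id : coind Z -> coind Z) by split=> // n v; rewrite addr0.
have [ev evE] := adj_flat (GMor idP).
have pevP : is_ghom 0 (fun q => p (ev q)).
  split=> [c u v|a v|n v hv]; rewrite ?gmor_lin ?gmor_act //.
  by rewrite addr0; apply/gmor_homog/gmor_homog.
have [f fE] := adj_sharp (GMor pevP); exists f => h x; have [a <-] := to_right_surj x.
by rewrite fE; apply: (congr1 p); rewrite evE -(to_right_e a); apply: coind_act.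
Qed.
End Truncation.

(** * Coinduction preserves surjections *)

Section Coinduction.
Variables (k : fieldType) (I : choiceType) (A : lualg k I).
Variables (disp : Order.disp_t) (L : porderType disp) (D : weights I L).
Variables (T : triangular_basis A D) (w : L -> gidem A).
Hypothesis w_sum : forall l, gi_val (w l) = weight_sum A D l.
Notation S := (ws_S D).
Notation inc := (@ws_inc _ _ _ D).
Notation wt := (@ws_wt _ _ _ D).
Notation one i := (gi_val (lu_one A i)).
Notation X := (tb_X T).
Notation H := (tb_H T).
Notation Y := (tb_Y T).
Notation J m := (strat_ideal w m).
Variable m : L.
Notation cor := (to_corner (J m) (w m)).
Notation rt := (to_right (J m) (w m)).

Lemma to_corner_J a : J m a -> cor a = 0.
Proof. by move=> Ja; apply/to_corner0/hi_r/hi_l. Qed.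

Lemma to_right_J a : J m a -> rt a = 0.
Proof. by move=> Ja; apply: sub_val_inj; apply/to_quot0/hi_l. Qed.

Lemma w_one_wt s : wt s = m -> w m ** one (inc s) = one (inc s).
Proof. by move=> sm; rewrite (w_one w_sum) sm eqxx. Qed.
Lemma one_w_wt s : wt s = m -> one (inc s) ** w m = one (inc s).
Proof. by move=> sm; rewrite (one_w w_sum) sm eqxx. Qed.

Lemma lin_eq_w (W : lmodType k) (f g : A -> W) : linear f -> linear g ->
  (forall s a, wt s = m -> one (inc s) ** a = a -> f a = g a) ->
  forall a, f (w m ** a) = g (w m ** a).
Proof.
move=> lf lg fg a; have [r [_ memr ->]] := w_expand w_sum m.
rewrite (lin_sum (@ga_linl _ A a)) (lin_sum lf) (lin_sum lg).
apply: eq_big_seq => s; rewrite memr => /eqP sm; apply: fg sm _.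
by rewrite ga_assoc gi_idem.
Qed.

(** Lifting a homomorphism out of e_m A_(>= m) 1_i amounts to lifting its values at
    the free generators in Y, homogeneously. *)
Lemma coind_surj (Z1 Z2 : gmod (stratum w m)) (p : gmor Z1 Z2) :
  (forall z, exists y, p y = z) ->
  forall h : coind Z2, exists h' : coind Z1, forall x, p (sub_val h' x) = sub_val h x.
Proof.
move=> p_surj h; have [F FE] := coind_map p.
suff [h' Fh'] : exists h', F h' = h by exists h' => x; rewrite -FE Fh'.
elim/span_ind: h / (jst_span h) => [|c u v _ _ [u' <-] [v' <-]|h [i [d [[lh bh gh] ih]]]].
- by exists 0; rewrite (lin0 (gmor_lin F)).
- by exists (c *: u' + v'); rewrite gmor_lin.
pose cond y := exists2 t, wt t = m & Y t i y.
have /choice[z zP] : forall y, exists z : Z1,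
    (cond y -> p z = sub_val h (rt y) /\ exists n, homog (ga_gr A) n y /\ homog (gm_gr Z1) (n + d) z)
    /\ (~ cond y -> z = 0).
  move=> y; have [cy|cy] := pselect (cond y); last by exists 0.
  have [t tm Yy] := cy; have [_ [n hy]] := tb_Y_homog Yy.
  have [z0 pz0] := p_surj (sub_val h (rt y)); exists (gm_gr Z1 (n + d) z0).
  split=> // _; split; last by exists n; split=> //; apply: homog_comp.
  rewrite -gmor_comp pz0; apply: gh.
  by rewrite /homog to_right_gr hy.
pose theta y a := cor a **: z y.
have lin_t y : linear (theta y) by move=> c a b; rewrite /theta to_corner_lin gm_linl.
have t0 y a : J m a -> theta y a = 0.
  by move=> /to_corner_J ca; rewrite /theta ca (lin0 (gm_linl _)).
have [Phi [lin_Phi Phi0 PhiY PhiE]] := Y_free T w_sum lin_t t0.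
(* Equivariance: modulo the ideal, w m ** a is a combination of products h y. *)
have Phi_act b a : Phi (w m ** b ** w m ** a) = cor b **: Phi (w m ** a).
  pose f u := Phi (w m ** b ** u); pose g u := cor b **: Phi u.
  have lin_f : linear f by move=> c u v; rewrite /f ga_linr lin_Phi.
  have lin_g : linear g by move=> c u v; rewrite /g lin_Phi gm_linr.
  rewrite -ga_assoc; move: a; apply: (lin_eq_w lin_f lin_g) => s a sm /(tri_from T).
  apply: (lin_eq_span lin_f lin_g); rewrite /f /g {f g lin_f lin_g}.
  move=> _ [_ [s' [t [j [x [hh [y [-> Xx Hh Yy ->]]]]]]]].
  case: (XP Xx) => [ss' x1|ss']; last first.
    have Je : J m (x ** hh ** y).
      by rewrite -(X_r Xx); apply/hi_r/hi_r/hi_l/(J_one w_sum); rewrite -sm lt_geF.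
    by rewrite (Phi0 _ Je) (Phi0 _ (hi_l _ Je)) (lin0 (gm_linr _)).
  subst s'; rewrite (PhiE _ _ _ _ _ _ _ Xx Hh Yy) x1 (H_l Hh) ga_assoc.
  rewrite (PhiY _ _ _ _ Yy) -?(H_wt Hh) //; last by rewrite -ga_assoc (H_r Hh).
  have whh : w m ** hh = hh by rewrite -(H_l Hh) ga_assoc w_one_wt.
  by rewrite /theta gm_assoc to_cornerM -!ga_assoc whh to_corner_l.
have Phi_gr n a : gm_gr Z1 (n + d) (Phi a) = Phi (ga_gr A n a).
  pose f u := gm_gr Z1 (n + d) (Phi u); pose g u := Phi (ga_gr A n u).
  have lin_f : linear f by move=> c u v; rewrite /f lin_Phi gr_lin.
  have lin_g : linear g by move=> c u v; rewrite /g gr_lin lin_Phi.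
  move: (tri_all T a); move: a; apply: (lin_eq_span lin_f lin_g); rewrite /f /g {f g lin_f lin_g}.
  move=> _ [i' [s [t [j [x [hh [y [_ Xx Hh Yy ->]]]]]]]].
  have [_ [nx hx]] := tb_X_homog Xx; have [_ [nh hhh]] := tb_H_homog Hh.
  have hxh := ga_homog hx hhh.
  have [cy|cy] := pselect (cond y); last first.
    have [_ [ny hy]] := tb_Y_homog Yy; have [_ z0] := zP y.
    have P0 : Phi (x ** hh ** y) = 0.
      by rewrite (PhiE _ _ _ _ _ _ _ Xx Hh Yy) /theta z0 // (lin0 (gm_linr _)).
    rewrite P0 (lin0 (gr_lin _ _)) (homogE _ (ga_homog hxh hy)).
    by case: ifP; rewrite ?P0 // (lin0 lin_Phi).
  have [/(_ cy)[_ [ny [hy hz]]] _] := zP y.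
  rewrite (homogE _ (ga_homog hxh hy)) (PhiE _ _ _ _ _ _ _ Xx Hh Yy).
  have hcor : homog (ga_gr (stratum w m)) (nx + nh) (cor (x ** hh)).
    by rewrite /homog to_corner_gr hxh.
  rewrite (homogE _ (gm_homog hcor hz)) addrA (inj_eq (addIr d)).
  by case: ifP => _; rewrite ?(PhiE _ _ _ _ _ _ _ Xx Hh Yy) // (lin0 lin_Phi).
have p_Phi a : p (Phi (w m ** (a ** one i))) = sub_val h (rt a).
  have -> : sub_val h (rt a) = sub_val h (rt (w m ** (a ** one i))).
    by rewrite to_right_e ih; congr (sub_val h _); rewrite -to_right_ract.
  pose f u := p (Phi (u ** one i)); pose g u := sub_val h (rt (u ** one i)).
  have lin_f : linear f by move=> c u v; rewrite /f ga_linl lin_Phi gmor_lin.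
  have lin_g : linear g by move=> c u v; rewrite /g ga_linl to_right_lin lh.
  rewrite ga_assoc; move: a; apply: (lin_eq_w lin_f lin_g) => s a sm sa.
  have {}sa : span (tri T (fun i' _ j => i' = inc s /\ j = i)) (a ** one i).
    exact: tri_r (tri_from T sa).
  rewrite /f /g {f g lin_f lin_g}; move: sa.
  pose f u := p (Phi u); pose g u := sub_val h (rt u).
  have lin_f : linear f by move=> c u v; rewrite /f lin_Phi gmor_lin.
  have lin_g : linear g by move=> c u v; rewrite /g to_right_lin lh.
  apply: (lin_eq_span lin_f lin_g); rewrite /f /g {f g lin_f lin_g}.
  move=> _ [_ [s' [t [_ [x [hh [y [[-> ->] Xx Hh Yy ->]]]]]]]].
  case: (XP Xx) => [ss' x1|ss']; last first.
    have Je : J m (x ** hh ** y).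
      by rewrite -(X_r Xx); apply/hi_r/hi_r/hi_l/(J_one w_sum); rewrite -sm lt_geF.
    by rewrite (Phi0 _ Je) (to_right_J Je) (lin0 (gmor_lin p)) (lin0 lh).
  subst s'; have tm : wt t = m by rewrite -(H_wt Hh).
  have cy : cond y by exists t.
  have [/(_ cy)[pz _] _] := zP y.
  rewrite x1 (H_l Hh) (PhiY _ _ _ _ Yy tm) ?(H_r Hh) // /theta gmor_act pz -bh to_right_lact.
  by congr (sub_val h (rt _)); rewrite -ga_assoc -(Y_l Yy) (ga_assoc (w m)) w_one_wt.
pose h0 (x : sub_space (right_ideal (upper_idem w m))) := Phi (repr (sub_val x) ** one i).
have h0E a : h0 (rt a) = Phi (w m ** a ** one i).
  apply/eqP; rewrite -subr_eq0 -(linB lin_Phi) -(linB (@ga_linl _ A _)); apply/eqP/Phi0/hi_r/to_quotP.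
  by rewrite /to_quot reprK.
have h0_chom : @chom k I (upper_quot w m) (upper_idem w m) Z1 i d h0.
  split; first split.
  - move=> c x y; have [a <-] := to_right_surj x; have [b <-] := to_right_surj y.
    by rewrite -to_right_lin !h0E ga_linr ga_linl lin_Phi.
  - move=> b x; have [a <-] := to_right_surj x; have [c <-] := to_corner_surj b.
    by rewrite to_right_lact !h0E -!(ga_assoc (w m)) -Phi_act !ga_assoc.
  - move=> n x /to_right_homog[a ha <-]; rewrite h0E /homog Phi_gr.
    by rewrite comp_idem_r comp_idem_l ha.
  move=> x; have [a <-] := to_right_surj x.
  by rewrite to_right_ract !h0E -!ga_assoc gi_idem.
have h0_jst : @jst_ss k I (upper_quot w m) (upper_idem w m) Z1 h0.
  by apply: span_gen; exists i, d.
exists (mk_sub h0_jst); apply: coind_ext => a.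
by rewrite FE -[sub_val _ _]/(h0 _) h0E -ga_assoc p_Phi.
Qed.

(** A left adjoint of a functor preserving surjections preserves projectives. *)
Lemma trunc_projective (P : gmod A) : projective P -> projective (trunc (J m) (w m) P).
Proof.
move=> proj_P Z1 Z2 p f p_surj.
have [f' f'E] := adj_sharp f; have [F FE] := coind_map p.
have F_surj h : exists h', F h' = h.
  have [h' ph'] := coind_surj p_surj h; exists h'; apply: coind_ext => a.
  by rewrite FE ph'.
have [g' g'E] := proj_P _ _ F f' F_surj; have [g gE] := adj_flat g'.
exists g => q; have [v <-] := tcls_surj q.
by rewrite gE -FE g'E f'E tcls_e.
Qed.
End Coinduction.

(** * Truncations of standardizations *)

Lemma unit_act (k : fieldType) (C : lualg k unit) (Z : gmod C) (z : Z) : lu_one C tt **: z = z.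
Proof.
have [s _ ->] := dec_sum (gm_dec Z) z; rewrite (lin_sum (gm_linr _)).
by apply: eq_bigr => -[] _; rewrite gm_assoc gi_idem.
Qed.

Section Induction.
Variables (k : fieldType) (I : choiceType) (A : lualg k I) (J : hideal A) (e : gidem A).
Notation ebar := (quot_idem J e).
Notation C := (corner ebar).
Notation pj := (to_quot J).
Notation cor := (to_corner J e).
Variable Z : gmod C.

(** Standardization, for an arbitrary ideal and idempotent. *)
Definition ind : gmod A := inflation (@left_adjoint k I (quot_lualg J) ebar Z).

Fact to_left_subproof (a : A) : left_ideal ebar (pj (a ** e)).
Proof. by rewrite /= qmulE -ga_assoc gi_idem. Qed.
Definition to_left (a : A) : sub_space (left_ideal ebar) := mk_sub (to_left_subproof a).

Lemma to_left_lin : linear to_left.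
Proof. by move=> c a b; apply: sub_val_inj; rewrite /= ga_linl to_quot_lin. Qed.
Lemma to_left_surj x : exists a, to_left a = x.
Proof.
have [a xa] : exists a, sub_val x = pj a by elim/quot_ind: (sub_val x) => a; exists a.
by exists a; apply: sub_val_inj; have := subP x; rewrite /= xa qmulE.
Qed.
Lemma to_left_e a : to_left (a ** e) = to_left a.
Proof. by apply: sub_val_inj; rewrite /= -ga_assoc gi_idem. Qed.

Definition ind_tens (a : A) (z : Z) : ind := @jsh_tens k I (quot_lualg J) ebar Z (to_left a) z.

Lemma ind_tens_linr a : linear (ind_tens a).
Proof. by move=> c u v; rewrite /ind_tens jsh_linr. Qed.
Lemma ind_tens_e a z : ind_tens (a ** e) z = ind_tens a z.
Proof. by rewrite /ind_tens to_left_e. Qed.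
Lemma ind_tens_bal a b z : ind_tens a (cor b **: z) = ind_tens (a ** e ** b) z.
Proof.
rewrite /ind_tens -jsh_bal; congr (jsh_tens _ _); apply: sub_val_inj.
by rewrite /= qmulE !ga_assoc -(ga_assoc a e e) gi_idem.
Qed.
Lemma ind_tens_act a b z : b **: ind_tens a z = ind_tens (b ** a) z.
Proof.
rewrite -[LHS]/(@jsh_act k I (quot_lualg J) ebar Z (pj b) _) jsh_actE; congr (jsh_tens _ _).
by apply: sub_val_inj; rewrite /= qmulE ga_assoc.
Qed.
Lemma ind_tens_span x : span [set x | exists a z, x = ind_tens a z] x.
Proof.
elim/span_ind: x / (span_tens x) => [|c u v _ _|_ [m [z ->]]]; [exact: ss_0|exact: ss_lin|].
by have [a <-] := to_left_surj m; apply: span_gen; exists a, z.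
Qed.
Lemma ind_J a (x : ind) : J a -> a **: x = 0.
Proof.
by move=> /to_quot0 Ja; rewrite -[LHS]/(@gm_act _ _ (quot_lualg J) _ _ _) Ja (lin0 (gm_linl _)).
Qed.
Lemma ind_trace (x : ind) : ideal_part J ind x -> x = 0.
Proof.
elim/span_ind=> [//|c u v _ _ -> ->|_ [a [u [Ja ->]]]]; first by rewrite scaler0 addr0.
exact: ind_J.
Qed.

(** So the unit from Z to the weight space of its standardization is surjective. *)
Lemma ind_e (x : ind) : exists z, e **: x = ind_tens e z.
Proof.
elim/span_ind: x / (ind_tens_span x) => [|c u v _ _ [y yE] [z zE]|_ [a [z ->]]].
- by exists 0; rewrite (lin0 (gm_linr _)) (lin0 (ind_tens_linr _)).
- by exists (c *: y + z); rewrite gm_linr yE zE ind_tens_linr.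
by exists (cor a **: z); rewrite ind_tens_act ind_tens_bal gi_idem.
Qed.

Lemma ind_tens_homog n z : homog (gm_gr Z) n z -> homog (gm_gr ind) n (ind_tens e z).
Proof.
move=> hz; have he : homog (left_ideal_gr ebar) 0 (to_left e).
  by apply: sub_val_inj; rewrite /= -[LHS]/(quot_gr J 0 _) quot_grE gi_idem (gi_homog e).
have := @jsh_compE k I (quot_lualg J) ebar Z n 0 n _ _ he hz.
by rewrite add0r eqxx.
Qed.

(** Coordinate functions on A that are compatible with the right action of the corner
    give linear maps from the standardization to Z. *)
Lemma ind_lift (psi : A -> C) : linear psi -> (forall a, J a -> psi a = 0) ->
  (forall a b, psi (a ** e ** b ** e) = psi (a ** e) ** cor b) ->
  exists2 rho : ind -> Z, linear rho & forall a z, rho (ind_tens a z) = psi (a ** e) **: z.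
Proof.
move=> lin_psi psi0 psiM; pose f (m : sub_space (left_ideal ebar)) := psi (repr (sub_val m)).
have fE a : f (to_left a) = psi (a ** e).
  apply/eqP; rewrite -subr_eq0 -(linB lin_psi); apply/eqP/psi0/to_quotP.
  by rewrite /to_quot reprK.
pose phi m (z : Z) := f m **: z.
have phi_linl z : linear (phi^~ z).
  move=> c x y; have [a <-] := to_left_surj x; have [b <-] := to_left_surj y.
  by rewrite /phi -to_left_lin !fE ga_linl lin_psi gm_linl.
have phi_linr m : linear (phi m) by move=> c x y; rewrite /phi gm_linr.
have phi_bal m c z : phi (@corner_ract k I (quot_lualg J) ebar m c) z = phi m (c **: z).
  have [a <-] := to_left_surj m; have [b <-] := to_corner_surj c.
  have -> : @corner_ract k I (quot_lualg J) ebar (to_left a) (cor b) = to_left (a ** e ** b).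
    by apply: sub_val_inj; rewrite /= qmulE !ga_assoc -(ga_assoc a e e) gi_idem.
  by rewrite /phi !fE psiM gm_assoc.
exists (@tens_lift k _ _ _ (@corner_ract k I (quot_lualg J) ebar) (fun (b : C) (v : Z) => b **: v) _ phi).
  exact: tens_lift_lin.
by move=> a z; rewrite [LHS](tens_liftE phi_linl phi_linr phi_bal) /phi fE.
Qed.

(** The map a (x) z |-> (e a e) z is a retraction of the unit. *)
Lemma ind_tens_e_inj z : ind_tens e z = 0 -> z = 0.
Proof.
have corM a b : cor (a ** e ** b ** e) = cor (a ** e) ** cor b.
  by rewrite to_cornerM -(ga_assoc a e e) gi_idem to_corner_r.
have cor0 a : J a -> cor a = 0 by move=> Ja; apply/to_corner0/hi_r/hi_l.
have [rho lin_rho rhoE] := ind_lift (@to_corner_lin _ _ _ J e) cor0 corM.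
move=> z0; have := rhoE e z; rewrite z0 (lin0 lin_rho) gi_idem to_corner_one => ->.
by rewrite unit_act.
Qed.
End Induction.

Section Standard.
Variables (k : fieldType) (I : choiceType) (A : lualg k I).
Variables (disp : Order.disp_t) (L : porderType disp) (D : weights I L).
Variables (T : triangular_basis A D) (w : L -> gidem A).
Hypothesis w_sum : forall l, gi_val (w l) = weight_sum A D l.
Notation S := (ws_S D).
Notation inc := (@ws_inc _ _ _ D).
Notation wt := (@ws_wt _ _ _ D).
Notation one i := (gi_val (lu_one A i)).
Notation X := (tb_X T).
Notation H := (tb_H T).
Notation Y := (tb_Y T).
Notation J m := (strat_ideal w m).
Notation U m V := (ideal_part (J m) V).
Notation F m V := (trunc (J m) (w m) V).
Variables (l : L) (Z : gmod (stratum w l)).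
Notation cor := (to_corner (J l) (w l)).
Notation tz := (@ind_tens k I A (J l) (w l) Z).
Notation IZ := (@ind k I A (J l) (w l) Z).

Lemma ind_full m (x : IZ) : ~~ (m <= l)%O -> U m IZ x.
Proof.
move=> ml; move: (ind_tens_span x); apply: span_in => _ [a [z ->]].
rewrite -ind_tens_e -[tz (a ** w l) z]ind_tens_e -ind_tens_act; apply/ideal_part_gen/hi_l.
exact: J_w.
Qed.

(** In weight l, the coordinates along X given by [X_free] separate the summands x Z.
    In any other weight m, either the standardization is its own ideal part or
    its weight space of weight m vanishes. *)
Lemma ind_independent : upper_independent T w IZ.
Proof.
move=> m i r v [ur rv] tv [s x] sr.
have [le_ml|ml] := boolP (m <= l)%O; last exact: ind_full.
have [ml|ml] := eqVneq m l; last first.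
  have [/= sm _ sv] := rv _ sr; suff -> : v (s, x) = 0 by exact: (ss_0 (U m IZ)).
  rewrite -sv; apply: ind_J; apply: (J_one w_sum).
  by rewrite sm; apply: contra ml => lm; rewrite eq_le le_ml.
subst m; have /choice[u uE] : forall p, exists z, p \in r -> v p = tz (w l) z.
  move=> p; have [pr|pr] := boolP (p \in r); last by exists 0.
  have [pl _ pv] := rv _ pr; have [z zE] := ind_e (v p); exists z => _.
  by rewrite -zE -pv gm_assoc (w_one_wt w_sum pl).
have sum0 : \sum_(p <- r) tz p.2 (u p) = 0.
  apply: (ind_trace (J := J l)); move: tv; congr (ideal_part _ _ _); apply: eq_big_seq => p pr.
  by rewrite (uE _ pr) ind_tens_act ind_tens_e.
pose theta y := if y == x then cor else fun _ => 0.
have lin_t y : linear (theta y).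
  by rewrite /theta; case: ifP => _; [apply: to_corner_lin | apply: lin_zero].
have t0 y a : J l a -> theta y a = 0.
  by move=> Ja; rewrite /theta; case: ifP => // _; apply: to_corner_J.
have [Psi [lin_Psi Psi0 PsiE]] := X_free T w_sum lin_t t0.
have PsiM a b : Psi (a ** w l ** b ** w l) = Psi (a ** w l) ** cor b.
  have [q [_ memq wE]] := w_expand w_sum l; rewrite -(ga_assoc (a ** w l)) {1 3}wE.
  rewrite !(lin_sum (@ga_linr _ A _)) (lin_sum (@ga_linl _ A _)) !(lin_sum lin_Psi).
  rewrite (lin_sum (@ga_linl _ (stratum w l) _)); apply: eq_big_seq => t; rewrite memq => /eqP tl.
  have at1 : (a ** one (inc t)) ** one (inc t) = a ** one (inc t) by rewrite -ga_assoc gi_idem.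
  pose f a := Psi (a ** (b ** w l)); pose g a := Psi a ** cor b.
  have lin_f : linear f by move=> c a1 a2; rewrite /f ga_linl lin_Psi.
  have lin_g : linear g by move=> c a1 a2; rewrite /g lin_Psi ga_linl.
  move: (tri_to T at1); apply: (lin_eq_span lin_f lin_g); rewrite /f /g {f g lin_f lin_g}.
  move=> _ [i' [s' [t' [_ [x' [h [y [-> Xx Hh Yy ->]]]]]]]].
  case: (YP Yy) => [tt' y1|tt']; last first.
    have Je : J l (x' ** h ** y).
      by rewrite -(Y_l Yy); apply/hi_l/hi_r/(J_one w_sum); rewrite -tl lt_geF.
    by rewrite (Psi0 _ Je) (Psi0 _ (hi_r _ Je)) mul0x.
  subst t'; have sl : wt s' = l by rewrite (H_wt Hh).
  have xh1 : x' ** h ** one (inc t) = x' ** h by rewrite -ga_assoc (H_r Hh).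
  rewrite y1 xh1 -ga_assoc !(PsiE _ _ _ _ Xx sl) ?(H_l Hh) //; last by rewrite ga_assoc (H_l Hh).
  rewrite /theta; case: ifP => _; last by rewrite mul0x.
  have hw : h ** w l = h by rewrite -(H_r Hh) -ga_assoc (one_w_wt w_sum tl).
  by rewrite to_cornerM hw ga_assoc to_corner_r.
have [rho lin_rho rhoE] := ind_lift Z lin_Psi Psi0 PsiM.
have : cor (one (inc s)) **: rho (\sum_(p <- r) tz p.2 (u p)) = 0.
  by rewrite sum0 (lin0 lin_rho) (lin0 (gm_linr _)).
have rE p : p \in r -> cor (one (inc s)) **: rho (tz p.2 (u p)) =
    if p == (s, x) then cor (one (inc s)) **: u p else 0.
  move=> pr; have [pl Xp _] := rv _ pr; rewrite rhoE.
  have -> : p.2 ** w l = p.2 ** one (inc p.1) by rewrite -{1}(X_r Xp) -ga_assoc (one_w_wt w_sum pl) (X_r Xp).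
  rewrite (PsiE _ _ _ _ Xp pl) ?gi_idem // /theta -pair_eqE /pair_eq /=.
  case: (p.2 == x); last by rewrite andbF (lin0 (gm_linl _)) (lin0 (gm_linr _)).
  have [/= sl _ _] := rv _ sr.
  rewrite gm_assoc to_cornerM (one_w_wt w_sum sl) lu_oneM (inj_eq (@ws_inj _ _ _ D)) andbT eq_sym.
  by case: eqP => [->|_] //; rewrite (lin0 (@to_corner_lin _ _ _ _ _)) (lin0 (gm_linl _)).
rewrite (lin_sum lin_rho) (lin_sum (gm_linr _)) (eq_big_seq _ rE) (bigD1_seq (s, x)) //= eqxx.
rewrite big1_seq ?addr0 => [us0|p /andP[/negPf-> _] //].
have [sl _ sv] := rv _ sr; rewrite -sv (uE _ sr) ind_tens_act (one_w_wt w_sum sl).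
rewrite -(w_one_wt w_sum sl) -{1}(gi_idem (w l)) -ind_tens_bal us0 (lin0 (ind_tens_linr _)).
exact: (ss_0 (U l IZ)).
Qed.

Lemma trunc_ind_other m (x : F m IZ) : m != l -> x = 0.
Proof.
move=> ml; have [v <-] := tcls_surj x; apply/tcls0.
have [le_ml|not_ml] := boolP (m <= l)%O; last exact: ind_full.
rewrite ind_J; first exact: (ss_0 (U m IZ)).
by apply: J_w; apply: contra ml => lm; rewrite eq_le le_ml.
Qed.

Lemma trunc_ind : exists f : gmor Z (F l IZ), bijective f.
Proof.
pose f (z : Z) : F l IZ := tcls (J l) (w l) (tz (w l) z).
have hf : is_ghom 0 f.
  split=> [c u v|x v|n v hv]; first by rewrite /f ind_tens_linr tcls_lin.
    have [a <-] := to_corner_surj x; rewrite /f tcls_act ind_tens_act ind_tens_bal gi_idem.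
    by congr (tcls _ _ _); rewrite !ind_tens_e.
  by rewrite addr0 /homog tcls_gr (ind_tens_homog hv).
have f_inj : injective f.
  move=> u v /eqP; rewrite -subr_eq0 -(linB (@tcls_lin _ _ _ _ _ _)) => /eqP/tcls0 uv.
  have {uv} : tz (w l) (u - v) = 0.
    apply: (ind_trace (J := J l)); move: uv; congr (ideal_part _ _ _).
    by rewrite -(linB (ind_tens_linr _)) ind_tens_act gi_idem.
  by move/ind_tens_e_inj/eqP; rewrite subr_eq0 => /eqP.
have f_surj y : exists z, f z = y.
  have [v <-] := tcls_surj y; have [z zE] := ind_e v; exists z.
  by rewrite /f -zE tcls_e.
have [g gK] := choice f_surj; exists (GMor hf); exists g => //= z.
exact: f_inj (gK _).
Qed.
End Standard.

(** * Extension-closed classes and vanishing of extensions *)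

Section Morphisms.
Variables (k : fieldType) (I : choiceType) (A : lualg k I).

Lemma gid_ghom (V : gmod A) : is_ghom 0 (id : V -> V).
Proof. by split=> // n v; rewrite addr0. Qed.
Definition gid (V : gmod A) : gmor V V := GMor (@gid_ghom V).

Lemma gcomp_ghom (U V W : gmod A) (g : gmor V W) (f : gmor U V) : is_ghom 0 (fun u => g (f u)).
Proof.
split=> [c u v|a v|n v hv]; rewrite ?gmor_lin ?gmor_act //.
by rewrite addr0; apply/gmor_homog/gmor_homog.
Qed.
Definition gcomp (U V W : gmod A) (g : gmor V W) (f : gmor U V) : gmor U W := GMor (gcomp_ghom g f).

Definition gcomb (U V : gmod A) (c : k) (f g : gmor U V) : gmor U V :=
  GMor (hom_lin c (gmorP f) (gmorP g)).
Lemma gcombE (U V : gmod A) c (f g : gmor U V) x : gcomb c f g x = c *: f x + g x.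
Proof. by []. Qed.

Lemma ghom_comp (V W : gmod A) d (f : V -> W) n v :
  is_ghom d f -> gm_gr W (n + d) (f v) = f (gm_gr V n v).
Proof.
move=> [lf _ hf]; have [s _ ->] := dec_sum (gr_dec (gm_gr V)) v.
rewrite !(lin_sum lf) !(lin_sum (gr_lin _ _)) (lin_sum lf); apply: eq_bigr => j _.
rewrite (homogE _ (hf _ _ (homog_comp _ j v))) (homogE _ (homog_comp _ j v)) (inj_eq (addIr d)).
by case: ifP; rewrite ?(lin0 lf).
Qed.

Lemma inv_ghom (V W : gmod A) d (f : V -> W) (g : W -> V) :
  is_ghom d f -> cancel f g -> cancel g f -> is_ghom (- d) g.
Proof.
move=> hf fK gK; have [lf af _] := hf; have f_inj := can_inj fK.
split=> [c u v|a v|n v hv]; apply: f_inj; first by rewrite lf !gK.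
  by rewrite af !gK.
by rewrite -(ghom_comp _ _ hf) subrK !gK.
Qed.

Lemma corestrict (V W : gmod A) (U : gsub W) (f : gmor V W) : (forall x, U (f x)) ->
  exists g : gmor V (sub_gmod U), forall x, sub_val (g x) = f x.
Proof.
move=> Uf; suff hg : is_ghom 0 (fun x => mk_sub (Uf x) : sub_gmod U) by exists (GMor hg).
split=> [c x y|a x|n x hx]; apply: sub_val_inj; rewrite /= ?gmor_lin ?gmor_act //.
by rewrite addr0 gmor_comp hx.
Qed.

Lemma lift_exact (P V1 V2 V3 : gmod A) (g : gmor V1 V2) (f : gmor V2 V3) (u : gmor P V2) :
  projective P -> (forall y, f y = 0 <-> exists x, g x = y) -> (forall x, f (u x) = 0) ->
  exists v : gmor P V1, forall x, g (v x) = u x.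
Proof.
move=> proj_P exact_gf fu; have fg0 x : f (g x) = 0 by apply/exact_gf; exists x.
have [u' u'E] := corestrict (U := gker f) fu; have [g' g'E] := corestrict (U := gker f) fg0.
have g'_surj w : exists x, g' x = w.
  have /exact_gf[x gx] := ker_val w; exists x; apply: sub_val_inj.
  by rewrite g'E.
have [v vE] := proj_P _ _ g' u' g'_surj; exists v => x.
by rewrite -g'E vE u'E.
Qed.

Record ext_closed (P : gmod A -> Prop) : Prop := ExtClosed {
  ec_zero : forall V : gmod A, (forall v : V, v = 0) -> P V;
  ec_iso : forall (V W : gmod A) (f : gmor V W), bijective f -> P V -> P W;
  ec_ext : forall (V1 V2 V3 : gmod A) (g : gmor V1 V2) (f : gmor V2 V3),
    short_exact g f -> P V1 -> P V3 -> P V2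
}.

(** Invariance under isomorphisms of arbitrary degree combines invariance under
    isomorphism with invariance under degree shift. *)
Definition sim_closed (P : gmod A -> Prop) : Prop :=
  forall (V W : gmod A) d (f : V -> W), is_ghom d f -> bijective f -> P V -> P W.

Lemma ec_giso (P : gmod A -> Prop) V W : ext_closed P -> giso V W -> P W -> P V.
Proof.
move=> cP [f [g fK gK]]; have hg := inv_ghom (gmorP f) fK gK; rewrite oppr0 in hg.
by apply: (ec_iso cP (f := GMor hg)); exists f.
Qed.

Lemma sim_shift (P : gmod A -> Prop) d V : sim_closed P -> P V -> P (shift d V).
Proof.
move=> sP; apply: (sP V (shift d V) d (fun v => v)); last by exists id.
by split=> // n v hv; rewrite /homog /= /shift_comp addrK.
Qed.

Lemma flag_closed (B : Type) (layer : B -> gmod A -> Prop) (P : gmod A -> Prop) :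
  ext_closed P -> (forall b V, layer b V -> P V) -> forall V, has_flag layer V -> P V.
Proof.
move=> cP layP V [n [F [b [_ F0 Fn Fi]]]].
suff key j : (j <= n)%N -> P (sub_gmod (F j)).
  have hval : is_ghom 0 (fun x : sub_gmod (F n) => sub_val x).
    split=> [c x y|a x|d x hx] //; rewrite addr0.
    exact: (congr1 (fun z : sub_gmod (F n) => sub_val z) hx).
  apply: (ec_iso cP (f := GMor hval)) (key n (leqnn n)).
  by exists (fun v => mk_sub (Fn v)) => [x|v] //; apply: sub_val_inj.
elim: j => [_|j IH jn].
  by apply: (ec_zero cP) => x; apply: sub_val_inj; apply: F0 (subP x).
have [Fj layj] := Fi (Ordinal jn).
have hg : is_ghom 0 (fun x : sub_gmod (F j) => mk_sub (Fj _ (subP x)) : sub_gmod (F j.+1)).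
  split=> [c x y|a x|d x hx]; apply: sub_val_inj => //.
  by rewrite addr0; exact: (congr1 (fun z : sub_gmod (F j) => sub_val z) hx).
have hf : is_ghom 0 (to_quot (restrict (F j.+1) (F j)) : _ -> subquotient (F j.+1) (F j)).
  split=> [c x y|a x|d x hx]; first exact: to_quot_lin.
    by rewrite /= quotm_actE.
  rewrite addr0.
  exact: etrans (quotm_grE (restrict (F j.+1) (F j)) d x) (congr1 (to_quot _) hx).
apply: (ec_ext cP (g := GMor hg) (f := GMor hf)); last exact: layP layj.
  split=> [x y /(congr1 (fun z : sub_gmod (F j.+1) => sub_val z)) /= xy|z|y].
  - exact: sub_val_inj.
  - by elim/quot_ind: z => y; exists y.
  split=> [/to_quot0 Fy|[x <-]]; last by apply/to_quot0; apply: (subP x).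
  by exists (@mk_sub _ _ (F j) _ Fy); apply: sub_val_inj.
exact: IH (ltnW jn).
Qed.

Lemma projective_ext_closed : ext_closed (@projective k I A).
Proof.
have iso (V W : gmod A) (f : gmor V W) : bijective f -> projective V -> projective W.
  move=> [g fK gK] pV X Y p h p_surj.
  have hg := inv_ghom (gmorP f) fK gK; rewrite oppr0 in hg.
  have [q qE] := pV _ _ p (gcomp h f) p_surj.
  by exists (gcomp q (GMor hg)) => w; rewrite /= qE /= gK.
split=> [V V0 X Y p f _|V W f|V1 V2 V3 g f [g_inj f_surj exact_gf] p1 p3 X Y p h p_surj].
- exists (GMor (hom_0 V X)) => x; rewrite (V0 x) (lin0 (gmor_lin f)).
  exact: lin0 (gmor_lin p).
- exact: iso.
have [s sE] := p3 _ _ f (gid V3) f_surj.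
have [a aE] := p1 _ _ p (gcomp h g) p_surj.
have [b bE] := p3 _ _ p (gcomp h s) p_surj.
have fr v : f (gcomb (-1) (gcomp s f) (gid V2) v) = 0.
  by rewrite gcombE gmor_lin /= sE /= scaleN1r addNr.
have /choice[r rE] : forall v, exists x, g x = gcomb (-1) (gcomp s f) (gid V2) v.
  by move=> v; apply/exact_gf/fr.
have hr : is_ghom 0 r.
  split=> [c u v|c v|n v hv]; try apply: g_inj; rewrite ?gmor_lin ?gmor_act ?rE ?gmor_lin ?gmor_act //.
  by rewrite addr0 -gmor_comp rE gmor_comp hv.
exists (gcomb 1 (gcomp a (GMor hr)) (gcomp b f)) => v.
rewrite gcombE scale1r (linD (gmor_lin p)) /= aE bE /= rE gcombE /=.
by rewrite gmor_lin scaleN1r addrAC addNr add0r.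
Qed.

Lemma projective_sim_closed : sim_closed (@projective k I A).
Proof.
move=> V W d f hf [f' fK gK] pV X Y p h p_surj.
have hf' := inv_ghom hf fK gK.
have hp : is_ghom 0 (p : shift (- d) X -> shift (- d) Y).
  split=> [c u v|a v|n v hv]; rewrite ?gmor_lin ?gmor_act //.
  by rewrite addr0 /homog /= /shift_comp gmor_comp; congr (p _).
have hhf : is_ghom 0 ((fun v => h (f v)) : V -> shift (- d) Y).
  have [lf af df] := hf; split=> [c u v|a v|n v hv]; rewrite ?lf ?af ?gmor_lin ?gmor_act //.
  by rewrite /homog /= /shift_comp addr0 opprK gmor_comp (df _ _ hv).
have [q qE] := pV _ _ (GMor hp) (GMor hhf) p_surj.
suff hq : is_ghom 0 ((fun w => q (f' w)) : W -> X).
  by exists (GMor hq) => w; have := qE (f' w); rewrite /= gK.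
have [lf' af' df'] := hf'; split=> [c u v|a v|n v hv]; rewrite ?lf' ?af' ?gmor_lin ?gmor_act //.
have := gmor_homog q (df' _ _ hv).
by rewrite /homog /= /shift_comp opprK subrK addr0.
Qed.

Lemma all_ext_closed : ext_closed (fun _ : gmod A => True). Proof. by []. Qed.
Lemma all_sim_closed : sim_closed (fun _ : gmod A => True). Proof. by []. Qed.

(** Vanishing of the positive Ext groups in the category of graded modules. All
    resolutions are allowed, so that the truncation of a resolution may serve. *)
Definition ext_vanish (V W : gmod A) : Prop :=
  forall (R : resolution V) n (f : gmor (res_mod R n.+1) W),
  (forall x, f (res_d R n.+1 x) = 0) ->
  exists g : gmor (res_mod R n) W, forall x, f x = g (res_d R n x).

Lemma res_dd (V : gmod A) (R : resolution V) n x : res_d R n (res_d R n.+1 x) = 0.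
Proof. by apply/res_exact; exists x. Qed.

(** In an extension of W3 by W1, a cocycle becomes one with values in W1 after
    subtracting a lift of the solution found in W3; lifts exist because the terms
    of the resolution are projective. *)
Lemma ext_vanish_closed V : ext_closed (ext_vanish V).
Proof.
split=> [W W0 R n f _|W W' h [h' hK h'K] vW R n f f0|W1 W2 W3 g f [g_inj f_surj exact_gf] v1 v3 R n u u0].
- by exists (GMor (hom_0 _ _)) => x; apply: W0.
- have hh' := inv_ghom (gmorP h) hK h'K; rewrite oppr0 in hh'.
  have [x|q qE] := vW R n (gcomp (GMor hh') f).
    by rewrite /= f0; apply: (lin0 (gmor_lin (GMor hh'))).
  by exists (gcomp h q) => x; rewrite /= -qE /= h'K.
have [x|a aE] := v3 R n (gcomp f u); first by rewrite /= u0 (lin0 (gmor_lin f)).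
have [b bE] := @res_proj _ _ _ _ R n _ _ f a f_surj.
pose c := gcomb (-1) (gcomp b (res_d R n)) u.
have cE x : c x = u x - b (res_d R n x) by rewrite /c gcombE scaleN1r addrC.
have fc x : f (c x) = 0.
  by rewrite cE (linB (gmor_lin f)) bE -aE subrr.
have [c' c'E] := lift_exact (@res_proj _ _ _ _ R n.+1) exact_gf fc.
have [x|q qE] := v1 R n c'.
  apply: g_inj; rewrite c'E cE u0 res_dd (lin0 (gmor_lin b)) (lin0 (gmor_lin g)).
  exact: subr0.
exists (gcomb 1 b (gcomp g q)) => x.
by rewrite gcombE scale1r /= -qE c'E cE addrC subrK.
Qed.

(** A section of the augmentation extends to maps h up the resolution with d h d = d,
    and composing with h solves the cocycle equation. *)
Lemma projective_ext_vanish V W : projective V -> ext_vanish V W.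
Proof.
move=> pV R n f f0.
have [h hE] : exists h : gmor (res_mod R n) (res_mod R n.+1),
    forall x, res_d R n (h (res_d R n x)) = res_d R n x.
  elim: n {f f0} => [|n [h hE]].
    have [s sE] := pV _ _ (res_aug R) (gid V) (@res_surj _ _ _ _ R).
    pose u := gcomb (-1) (gcomp s (res_aug R)) (gid (res_mod R 0)).
    have uE x : u x = x - s (res_aug R x) by rewrite /u gcombE scaleN1r addrC.
    have augu x : res_aug R (u x) = 0 by rewrite uE (linB (gmor_lin _)) sE subrr.
    have [h hE] := lift_exact (@res_proj _ _ _ _ R 0) (@res_exact0 _ _ _ _ R) augu.
    exists h => x; rewrite hE uE; have -> : res_aug R (res_d R 0 x) = 0 by apply/res_exact0; exists x.
    by rewrite (lin0 (gmor_lin s)) subr0.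
  pose u := gcomb (-1) (gcomp h (res_d R n)) (gid (res_mod R n.+1)).
  have uE x : u x = x - h (res_d R n x) by rewrite /u gcombE scaleN1r addrC.
  have du x : res_d R n (u x) = 0 by rewrite uE (linB (gmor_lin _)) hE subrr.
  have [h' h'E] := lift_exact (@res_proj _ _ _ _ R n.+1) (@res_exact _ _ _ _ R n) du.
  by exists h' => x; rewrite h'E uE res_dd (lin0 (gmor_lin h)) subr0.
exists (gcomp f h) => x; rewrite /=; apply/eqP; rewrite -subr_eq0 -(linB (gmor_lin f)).
have /res_exact[y <-] : res_d R n (x - h (res_d R n x)) = 0.
  by rewrite (linB (gmor_lin _)) hE subrr.
by rewrite f0.
Qed.

(** A cocycle factors through the quotient by the kernel of the differential, which
    embeds into the next term. *)
Lemma injective_ext_vanish V W : injective_gmod W -> ext_vanish V W.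
Proof.
move=> iW R n f f0; pose K := gker (res_d R n); pose Q := quot_gmod K.
have qlift (Z : gmod A) (h : gmor (res_mod R n.+1) Z) : (forall x, K x -> h x = 0) ->
    exists h' : gmor Q Z, forall x, h' (to_quot K x) = h x.
  move=> hK; pose h' : Q -> Z := quot_lift h.
  have h'E x : h' (to_quot K x) = h x by apply: quot_liftE => //; apply: gmor_lin.
  suff hh' : is_ghom 0 h' by exists (GMor hh').
  split=> [c|a|m]; elim/quot_ind=> u.
  - by elim/quot_ind=> v; rewrite -to_quot_lin !h'E gmor_lin.
  - by rewrite /= quotm_actE !h'E gmor_act.
  have grE : gm_gr Q m (to_quot K u) = to_quot K (gm_gr _ m u) := quotm_grE K m u.
  by rewrite /homog grE addr0 h'E gmor_comp -!h'E => ->.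
have [i iE] := qlift _ (res_d R n) (fun x => id).
have fK x : K x -> f x = 0 by move=> /res_exact[y <-].
have [f' f'E] := qlift _ f fK.
have i_inj : injective i.
  elim/quot_ind=> u; elim/quot_ind=> v; rewrite !iE => uv; apply/to_quotP.
  by rewrite /K /= (linB (gmor_lin _)) uv subrr.
have [g gE] := iW _ _ i f' i_inj; exists g => x.
by rewrite -f'E -gE iE.
Qed.
End Morphisms.

(** * From the weight algebras to the algebra, and the two levels *)

Section Transfer.
Variables (k : fieldType) (I : choiceType) (A : lualg k I).
Variables (disp : Order.disp_t) (L : porderType disp) (D : weights I L).
Variables (T : triangular_basis A D) (w : L -> gidem A).
Hypothesis w_sum : forall l, gi_val (w l) = weight_sum A D l.
Notation S := (ws_S D).
Notation inc := (@ws_inc _ _ _ D).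
Notation wt := (@ws_wt _ _ _ D).
Notation one i := (gi_val (lu_one A i)).
Notation J m := (strat_ideal w m).
Notation U m V := (ideal_part (J m) V).
Notation F m V := (trunc (J m) (w m) V).
Notation cls m v := (tcls (J m) (w m) v).

Lemma trunc_exact m (V1 V2 V3 : gmod A) (g : gmor V1 V2) (f : gmor V2 V3) :
  strat_exact D w g f -> forall q : F m V2,
  trunc_map (J m) (w m) f q = 0 -> exists x, trunc_map (J m) (w m) g x = q.
Proof.
move=> ex q; have [v <-] := tcls_surj q; rewrite trunc_mapE => /tcls0 fv.
have /choice[y yP] : forall s, exists y, wt s = m -> U m V2 (one (inc s) **: v - g y).
  move=> s; have [sm|sm] := eqVneq (wt s) m; last by exists 0 => /eqP; rewrite (negPf sm).
  have sv : one (inc s) **: (one (inc s) **: v) = one (inc s) **: v by rewrite gm_assoc gi_idem.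
  have [|y yP] := ex s _ sv; last by exists y => _; rewrite -sm.
  rewrite sm -(one_w_wt w_sum sm) -gm_assoc gmor_act; apply: gs_act.
  by rewrite gmor_act.
have [r [_ memr wE]] := w_expand w_sum m.
exists (cls m (\sum_(s <- r) y s)); rewrite trunc_mapE -[RHS]tcls_e wE.
rewrite (lin_sum (gm_linl v)) (lin_sum (gmor_lin g)).
apply/esym/eqP; rewrite -subr_eq0 -(linB (@tcls_lin _ _ _ _ _ _)) -sumrB; apply/eqP/tcls0/gs_act.
by apply: ss_sum => s; rewrite memr => /eqP /yP.
Qed.

Variable P : forall m, gmod (stratum w m) -> Prop.
Hypothesis P_closed : forall m, ext_closed (@P m).
Hypothesis P_sim : forall m, sim_closed (@P m).

(** The modules over A built from given classes of modules over the weight algebras: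
    standardizations of members of these classes belong to it, and it is closed
    under extensions because truncation is exact on independent modules. *)
Definition lift_class (V : gmod A) : Prop :=
  upper_independent T w V /\ forall m, P (F m V).

Lemma lift_class_sim : sim_closed lift_class.
Proof.
move=> V W d f hf [g fK gK] [indV PV]; have hg := inv_ghom hf fK gK.
split=> [|m]; first exact: upper_independent_retract hg hf gK indV.
have [f' hf' f'E] := trunc_map_ex (J m) (w m) hf.
have [g' hg' g'E] := trunc_map_ex (J m) (w m) hg.
apply: (P_sim hf') (PV m); exists g' => q; have [v <-] := tcls_surj q.
  by rewrite f'E g'E fK.
by rewrite g'E f'E gK.
Qed.

Lemma lift_class_closed : ext_closed lift_class.
Proof.
split=> [V V0|V W f f_bij|V1 V2 V3 g f gf_exact [ind1 P1] [ind3 P3]].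
- split=> [m i r v _ _ p _|m]; first by rewrite (V0 (v p)); apply: ss_0.
  apply: (ec_zero (P_closed m)) => q; have [v <-] := tcls_surj q.
  by rewrite (V0 v) (lin0 (@tcls_lin _ _ _ _ _ _)).
- exact: lift_class_sim (gmorP f) f_bij.
split=> [|m]; first exact: upper_independent_ext gf_exact ind1 ind3.
have [g_inj f_surj exact_gf] := gf_exact.
apply: (ec_ext (P_closed m) (g := trunc_map (J m) (w m) g) (f := trunc_map (J m) (w m) f)) (P1 m) (P3 m).
have ex : strat_exact D w g f := strat_exact_base f_surj (fun y => proj1 (exact_gf y)).
split=> [q q'|q|q].
- have [v <-] := tcls_surj q; have [v' <-] := tcls_surj q'; rewrite !trunc_mapE => /eqP.
  rewrite -subr_eq0 -(linB (@tcls_lin _ _ _ _ _ _)) -(linB (gmor_lin g)) => /eqP/tcls0.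
  rewrite -gmor_act => /(ideal_part_ses w_sum gf_exact ind3)/tcls0.
  by rewrite (linB (@tcls_lin _ _ _ _ _ _)) => /eqP; rewrite subr_eq0 => /eqP.
- have [v <-] := tcls_surj q; have [y yv] := f_surj v; exists (cls m y).
  by rewrite trunc_mapE yv.
split=> [|[x <-]]; first exact: trunc_exact.
have [v <-] := tcls_surj x; rewrite !trunc_mapE.
have -> : f (g v) = 0 by apply/exact_gf; exists v.
exact: lin0 (@tcls_lin _ _ _ _ _ _).
Qed.

Lemma lift_class_standardize l (Z : gmod (stratum w l)) : P Z -> lift_class (standardize Z).
Proof.
move=> PZ; split=> [|m]; first exact: (ind_independent (T := T) w_sum).
have [->|ml] := eqVneq m l; last by apply: (ec_zero (P_closed m)) => q; apply: trunc_ind_other ml.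
have [f f_bij] := trunc_ind Z; apply: (ec_iso (P_closed l) (f := f) f_bij PZ).
Qed.

Lemma resolution_strat_exact (V : gmod A) (R : resolution V) : upper_independent T w V ->
  strat_exact D w (res_d R 0) (res_aug R) /\ forall n, strat_exact D w (res_d R n.+1) (res_d R n).
Proof.
move=> indV.
have ex0 : strat_exact D w (res_d R 0) (res_aug R).
  exact: strat_exact_base (@res_surj _ _ _ _ R) (fun y => proj1 (@res_exact0 _ _ _ _ R y)).
split=> // n; elim: n => [|n IH].
  apply: (strat_exact_step w_sum _ _ indV ex0) => x; last exact: (proj1 (@res_exact _ _ _ _ R _ x)).
  by apply/res_exact0; exists x.
have indR := projective_independent (T := T) w_sum (@res_proj _ _ _ _ R n).
apply: (strat_exact_step w_sum _ _ indR IH) => x; first exact: res_dd.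
exact: (proj1 (@res_exact _ _ _ _ R _ x)).
Qed.

(** Truncation turns a projective resolution of V into one of the truncation of V, and
    by adjunction the two complexes of cochains agree. *)
Lemma ext_vanish_costandardize m (V : gmod A) (Z : gmod (stratum w m)) :
  lift_class V -> (forall Z', P Z' -> ext_vanish Z' Z) -> ext_vanish V (costandardize Z).
Proof.
move=> [indV PV] vZ R n f f0.
have [ex0 ex] := resolution_strat_exact R indV.
have fun0 (V1 V2 V3 : gmod A) (g : gmor V1 V2) (h : gmor V2 V3) : (forall x, h (g x) = 0) ->
    forall q, (exists y, trunc_map (J m) (w m) g y = q) -> trunc_map (J m) (w m) h q = 0.
  move=> hg0 q [y <-]; have [v <-] := tcls_surj y; rewrite !trunc_mapE hg0.
  exact: lin0 (@tcls_lin _ _ _ _ _ _).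
pose FR := @Resolution _ _ (stratum w m) (F m V) (fun n => F m (res_mod R n))
  (fun n => trunc_map (J m) (w m) (res_d R n)) (trunc_map (J m) (w m) (res_aug R))
  (fun n => trunc_projective T w_sum (@res_proj _ _ _ _ R n)).
have R1 q : exists x, trunc_map (J m) (w m) (res_aug R) x = q.
  have [v <-] := tcls_surj q; have [x xv] := res_surj R v; exists (cls m x).
  by rewrite trunc_mapE xv.
have aug_d x : res_aug R (res_d R 0 x) = 0 by apply/res_exact0; exists x.
pose FR' := FR R1 (fun x => conj (@trunc_exact m _ _ _ _ _ ex0 x) (fun0 _ _ _ _ _ aug_d x))
  (fun n x => conj (@trunc_exact m _ _ _ _ _ (ex n) x) (fun0 _ _ _ _ _ (@res_dd _ _ _ _ R n) x)).
have [f' f'E] := adj_flat (J := J m) (e := w m) f.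
have [q|g gE] := vZ _ (PV m) FR' n f'.
  by have [v <-] := tcls_surj q; rewrite /= trunc_mapE f'E f0.
have [g' g'E] := adj_sharp g; exists g' => x; apply: coind_ext => a.
rewrite g'E -gmor_act -(trunc_mapE (J m) (w m)) -gE f'E gmor_act.
by rewrite -(to_right_e _ _ a); apply/esym/coind_act.
Qed.
End Transfer.

Section Refinement.
Variables (k : fieldType) (C : lualg k unit) (K : choiceType) (E : refinement C K).

Fact refine_dec (V : gmod C) : decomposes (fun p => gm_act (g := V) (lu_one (refined E) p)).
Proof.
apply: (@decomposes_span _ _ _ _ _ (fun p => [set v | gm_act (g := V) (lu_one (refined E) p) v = v])).
- by move=> p; apply: gm_linr.
- move=> p q v /= <-; rewrite gm_assoc.
  case: eqVneq => [->|pq]; first by congr gm_act; apply: (gi_idem (lu_one (refined E) q)).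
  have -> : lu_one (refined E) p ** lu_one (refined E) q = 0 := @lu_orth _ _ (refined E) _ _ pq.
  exact: lin0 (gm_linl _).
move=> v; rewrite -(unit_act v).
have [s _ ->] := dec_sum (lu_dec (refined E)) (lu_one C tt : C).
rewrite (lin_sum (gm_linl v)); apply: ss_sum => -[p q] _; apply: span_gen; exists p => /=.
by rewrite gm_assoc !ga_assoc (gi_idem (rf_one E p)).
Qed.

(** The inverse of [unrefine]: only the decomposition into weight spaces changes. *)
Definition refine (V : gmod C) : gmod (refined E) :=
  @GMod _ _ (refined E) V (@gm_act _ _ C V) (gm_gr V) (@gm_linl _ _ _ V) (@gm_linr _ _ _ V)
    (@gm_assoc _ _ _ V) (@gm_homog _ _ _ V) (refine_dec V).

Definition refine_mor (V W : gmod C) (f : gmor V W) : gmor (refine V) (refine W) :=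
  @GMor _ _ _ (refine V) (refine W) f (gmorP f).

Lemma refine_projective (P : gmod C) : projective P -> projective (refine P).
Proof.
move=> pP V W p f p_surj.
have [g gE] := pP (unrefine V) (unrefine W) (@GMor _ _ _ (unrefine V) (unrefine W) p (gmorP p))
  (@GMor _ _ _ P (unrefine W) f (gmorP f)) p_surj.
by exists (@GMor _ _ _ (refine P) V g (gmorP g)).
Qed.

Lemma ext_vanish_unrefine (V : gmod C) (W : gmod (refined E)) :
  ext_vanish (refine V) W -> ext_vanish V (unrefine W).
Proof.
move=> vW R n f f0.
pose R' := @Resolution _ _ (refined E) (refine V) (fun n => refine (res_mod R n))
  (fun n => refine_mor (res_d R n)) (refine_mor (res_aug R))
  (fun n => refine_projective (@res_proj _ _ _ _ R n))
  (@res_surj _ _ _ _ R) (@res_exact0 _ _ _ _ R) (@res_exact _ _ _ _ R).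
have [g gE] := vW R' n (@GMor _ _ _ (refine (res_mod R n.+1)) W f (gmorP f)) f0.
by exists (@GMor _ _ _ (res_mod R n) (unrefine W) g (gmorP g)).
Qed.

Variable P : gmod (refined E) -> Prop.
Hypotheses (P_closed : ext_closed P) (P_sim : sim_closed P).

Lemma refine_sim : sim_closed (fun V => P (refine V)).
Proof. by move=> V W d f hf; apply: (P_sim (V := refine V) (W := refine W) (d := d) (f := f)). Qed.

Lemma refine_closed : ext_closed (fun V => P (refine V)).
Proof.
split=> [V V0|V W f|V1 V2 V3 g f ex].
- exact: (ec_zero P_closed).
- exact: (ec_iso P_closed (f := refine_mor f)).
exact: (ec_ext P_closed (g := refine_mor g) (f := refine_mor f)).
Qed.

Lemma refine_unrefine (W : gmod (refined E)) : P W -> P (refine (unrefine W)).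
Proof.
apply: (P_sim (V := W) (W := refine (unrefine W)) (d := 0) (f := fun v => v)); last by exists id.
by split=> // n v; rewrite addr0.
Qed.
End Refinement.

Lemma id_weight_sum (k : fieldType) (C : lualg k unit) (disp : Order.disp_t)
    (B : finPOrderType disp) (irr : irr_labelling C B) (Q : based_affine_qh irr) b :
  gi_val (qh_idem Q b) = weight_sum (refined (qh_ref Q)) (id_weights (@qh_inj _ _ _ _ _ Q)) b.
Proof.
rewrite /weight_sum; have -> : [set s : B | s = b] = [set b] by apply/seteqP; split.
by rewrite fsbig_set1.
Qed.

Section TwoLevels.
Variables (k : fieldType) (I : choiceType) (A : lualg k I).
Variables (disp : Order.disp_t) (L : porderType disp) (D : weights I L).
Variable T : triangular_basis A D.
Variables (disp' : Order.disp_t) (B : L -> finPOrderType disp').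
Variables (irr : forall l : L, irr_labelling (weight_algebra A D l) (B l)).
Variable Q : forall l : L, based_affine_qh (irr l).
Variable P : forall l (b : B l), gmod (stratum (qh_idem (Q l)) b) -> Prop.
Hypothesis P_closed : forall l b, ext_closed (@P l b).
Hypothesis P_sim : forall l b, sim_closed (@P l b).

Let wA (l : L) : gi_val (weight_idem A D l) = weight_sum A D l := erefl.

Definition stratum_class l (V : gmod (weight_algebra A D l)) : Prop :=
  lift_class (qh_basis (Q l)) (@P l) (refine (qh_ref (Q l)) V).

Lemma stratum_class_closed l : ext_closed (@stratum_class l).
Proof. exact (refine_closed (lift_class_closed (qh_basis (Q l)) (id_weight_sum (Q l)) (@P_closed l) (@P_sim l))). Qed.
Lemma stratum_class_sim l : sim_closed (@stratum_class l).
Proof. exact: (refine_sim (lift_class_sim (@P_sim l))). Qed.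

Definition module_class (V : gmod A) : Prop := lift_class T stratum_class V.

Lemma module_class_closed : ext_closed module_class.
Proof. exact: (lift_class_closed T wA stratum_class_closed stratum_class_sim). Qed.

Lemma module_class_shift d V : module_class V -> module_class (shift d V).
Proof. exact: (sim_shift (P := module_class) d (lift_class_sim stratum_class_sim)). Qed.

Lemma module_class_layer (b : {l : L & B l}) (V : gmod A) (M : gmod (weight_algebra A D (tag b)))
    (N : gmod (stratum (qh_idem (Q (tag b))) (tagged b))) :
  giso V (standardize M) -> giso M (unrefine (standardize N)) -> P N -> module_class V.
Proof.
move=> VM MN PN; apply: (ec_giso module_class_closed VM).
apply: (lift_class_standardize T wA stratum_class_closed).
apply: (ec_giso (@stratum_class_closed (tag b)) MN).
apply: refine_unrefine; first exact: lift_class_sim (@P_sim (tag b)).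
exact: (lift_class_standardize (qh_basis (Q (tag b))) (id_weight_sum (Q (tag b))) (@P_closed (tag b)) PN).
Qed.

Lemma module_class_ext (V W : gmod A) (b : {l : L & B l}) (M : gmod (weight_algebra A D (tag b)))
    (N : gmod (stratum (qh_idem (Q (tag b))) (tagged b))) :
  giso W (costandardize M) -> giso M (unrefine (costandardize N)) ->
  (forall N', P N' -> ext_vanish N' N) -> module_class V -> ext_vanish V W.
Proof.
move=> WM MN vN tV; apply: (ec_giso (ext_vanish_closed V) WM).
apply: (ext_vanish_costandardize wA tV) => V' mV'.
apply: (ec_giso (ext_vanish_closed V') MN); apply: ext_vanish_unrefine.
exact: (ext_vanish_costandardize (id_weight_sum (Q (tag b))) mV' vN).
Qed.
End TwoLevels.

Lemma Ext_vanishesP (k : fieldType) (I : choiceType) (A : lualg k I) (V W : gmod A) n :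
  (forall d, ext_vanish (shift d V) W) -> (0 < n)%N -> Ext_vanishes n V W.
Proof.
case: n => // n vVW _ d R; elim/quot_ind=> f; apply/to_quot0.
have [g gE] := vVW d R n (GMor (subP (sub_val f))) (subP f).
by exists g.
Qed.

Theorem theorem12p8 (k : closedFieldType) (I : choiceType) (A : lualg k I)
    (A_findim : alg_locally_findim A) (A_below : alg_bounded_below A)
    (disp : Order.disp_t) (L : porderType disp) (D : weights I L)
    (T : triangular_basis A D)
    (disp' : Order.disp_t) (B : L -> finPOrderType disp')
    (irr : forall l : L, irr_labelling (weight_algebra A D l) (B l))
    (Q : forall l : L, based_affine_qh (irr l))
    (V W : gmod A) :
  (pure_Delta_flag Q V /\ pure_bnabla_flag Q W) \/
  (pure_bDelta_flag Q V /\ pure_nabla_flag Q W) ->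
  forall n : nat, (1 <= n)%N -> Ext_vanishes n V W.
Proof.
move=> flags n n_gt0; apply: Ext_vanishesP n_gt0 => d.
case: flags => -[flagV flagW].
  pose P l (b : B l) := @projective k _ (stratum (qh_idem (Q l)) b).
  have Pc l b : ext_closed (@P l b) := @projective_ext_closed _ _ _.
  have Ps l b : sim_closed (@P l b) := @projective_sim_closed _ _ _.
  have tV : module_class T P V.
    apply: (flag_closed (module_class_closed T Pc Ps) _ flagV) => b V' [M [N [pN _ _ MN]] VM].
    exact: (module_class_layer T Pc Ps VM MN pN).
  apply: (flag_closed (ext_vanish_closed _) _ flagW) => b W' [M [N [_ _ MN]] WM].
  apply: (module_class_ext (T := T) (P := P) WM MN _ (module_class_shift Ps d tV)) => N' pN'.
  exact: projective_ext_vanish.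
pose P l (b : B l) (_ : gmod (stratum (qh_idem (Q l)) b)) := True.
have Pc l b : ext_closed (@P l b) := @all_ext_closed _ _ _.
have Ps l b : sim_closed (@P l b) := @all_sim_closed _ _ _.
have tV : module_class T P V.
  apply: (flag_closed (module_class_closed T Pc Ps) _ flagV) => b V' [M [N [_ _ MN]] VM].
  exact: (module_class_layer T Pc Ps VM MN Logic.I).
apply: (flag_closed (ext_vanish_closed _) _ flagW) => b W' [M [N [iN _ _ MN]] WM].
apply: (module_class_ext (T := T) (P := P) WM MN _ (module_class_shift Ps d tV)) => N' _.
exact: injective_ext_vanish.
Qed.
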